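(* Fix integers $m\ge1$ and $1\le i\le m$. Let $E(X_{m,i})$ denote the average of $X_{m,i}(\lambda)$ over all partitions $\lambda$ of $n$. Then, as $n\to\infty$, $$E(X_{m,i})-\frac{n}{m}=\frac{m+1-2i}{2Cm}\sqrt n\log n+c_{m,i}\sqrt n+O(\log n),$$ where $C=\pi\sqrt{2/3}$ and $$c_{m,i}=\frac{(\gamma+\log(2/C))(m+1-2i)}{Cm}+\frac{2}{Cm}\sum_{\ell=1}^{m-1}\frac{\omega^{-\ell(i-1)}}{1-\omega^{\ell}}\log(1-\omega^{\ell}),$$ with $\omega=e^{2\pi\sqrt{-1}/m}$ and $\gamma$ Euler's constant. (Here $\log$ is the principal branch of the logarithm.)
   Context: For a partition $\lambda:\ n=\lambda_1+\lambda_2+\dots+\lambda_k$ with $\lambda_1\ge\lambda_2\ge\dots\ge\lambda_k\ge1$, and integers $m\ge1$, $1\le i\le m$, define $X_{m,i}(\lambda)=\sum_{j\equiv i \pmod m}\lambda_j$, the sum of the parts whose index is congruent to $i$ modulo $m$. *)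

(* Defs.v *)
From Stdlib Require Import Reals Lra Lia List Sorted ZArith.
From Coquelicot Require Import Coquelicot.
Import ListNotations.
Open Scope R_scope.

Definition is_partition (n : nat) (l : list nat) : Prop :=
  Sorted.Sorted (fun a b => (b <= a)%nat) l /\ List.Forall (fun x => (1 <= x)%nat) l /\
  list_sum l = n.

(* X_{m,i}(l) = sum of the parts l_j (1-based index j) with j = i mod m. *)
Definition X (m i : nat) (l : list nat) : nat :=
  list_sum (map (fun j => if Nat.eqb (Nat.modulo (S j) m) (Nat.modulo i m)
                          then nth j l 0%nat else 0%nat)
                (seq 0 (length l))).

(* Average of X_{m,i} over a list L of partitions (enumerating all partitions
   of n exactly once). *)
Definition avgX (m i : nat) (L : list (list nat)) : R :=
  fold_right Rplus 0 (map (fun l => INR (X m i l)) L) / INR (length L).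

Definition Cpart : R := PI * sqrt (2 / 3).

Definition euler_gamma : R :=
  real (Lim_seq (fun N => sum_n (fun k => / INR (S k)) N - ln (INR (S N)))).

(* Principal argument in (-pi, pi] (the standard atan2). *)
Definition carg (z : C) : R :=
  let x := fst z in let y := snd z in
  if Rlt_dec 0 x then atan (y / x)
  else if Rlt_dec x 0 then
         (if Rle_dec 0 y then atan (y / x) + PI else atan (y / x) - PI)
  else if Rlt_dec 0 y then PI / 2
  else if Rlt_dec y 0 then - (PI / 2)
  else 0.

Definition Clog (z : C) : C := (ln (Cmod z), carg z).

Definition cis (t : R) : C := (cos t, sin t).

Definition omega_pow (m : nat) (k : Z) : C := cis (2 * PI * IZR k / INR m).

Definition c_const (m i : nat) : C :=
  Cplus
    (RtoC ((euler_gamma + ln (2 / Cpart)) * (INR (m + 1) - 2 * INR i) / (Cpart * INR m)))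
    (Cmult (RtoC (2 / (Cpart * INR m)))
       (fold_right Cplus (RtoC 0)
          (map (fun l =>
                  Cmult (Cdiv (omega_pow m (- (Z.of_nat l * (Z.of_nat i - 1)))%Z)
                              (Cminus (RtoC 1) (omega_pow m (Z.of_nat l))))
                        (Clog (Cminus (RtoC 1) (omega_pow m (Z.of_nat l)))))
               (seq 1 (m - 1))))).

(* Main.v *)
(** Conjugation turns [X] into a sum over parts [k] of the weight
    [f k = #{j <= k : j = i mod m}], so the total of [X] is
    [sum_{k,j} f(k) p(n - kj)]; the weight [f k = k] gives [n p(n)].  Hence
    [E(X) - n/m = sum_{k,j} g(k) p(n - kj) / p(n)] with [g k = f k - k/m] periodic of mean
    [(m+1-2i)/(2m)].

    The only asymptotic input on [p] is [p(n-s)/p(n) = e^{-cs/sqrt n} (1 + O((1 + s^2/n)/sqrt n))],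
    [c = pi/sqrt 6], and no circle method is needed for it.  Put [Z n = sum_{x<n} p x] and
    [Y n = sum_{x<=n} Z x].  Since the series of [p] times [(1-x)(1-x^2)] has nonnegative
    coefficients, the elementary estimate for the second sums of [sigma] turns
    [n p(n) = sum_s sigma(s) p(n-s)] into [n p(n) = c^2 Y n + O(Z n)].  This is a second order
    recurrence for [Y], and its Riccati form forces [Y n / Z n = sqrt n / c + O(1)].

    With [a = c/sqrt n], what remains is [sum_k g(k) / (e^{ak} - 1)].  Monotonicity of
    [1/(e^u - 1) - 1/u] reduces it up to [O(1)] to harmonic sums, which give [gamma - log a], and
    to [sum_k (g(k) - mean)/k], which the discrete Fourier transform and
    [sum_k w^k / k = - log (1 - w)] evaluate. *)

Require Import Defs.
From Stdlib Require Import ZArith Reals Lra Lia List Sorted Permutation.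
From Coquelicot Require Import Coquelicot.
Open Scope R_scope.

(** * Finite sums *)

(** The average must be followed to [O(log n)] below a term [sqrt n log n], so an asymptotic formula
    for [log p] alone would be too weak: the ratios [p(n-s)/p(n)] are needed with error [1/sqrt n],
    uniformly in [s].

    Two stability properties supply this. The comparison of [sum_s sigma(s) u(n-s)] with [zeta(2) Y]
    is linear in [u], and its error bound is a nonnegative combination of values of [u]; adjoining
    one more part size therefore keeps the same constant, and the estimate passes from parts 1 and 2
    to all partitions without loss. The Riccati map contracts near [sqrt n / c] by a factor of about
    [1 - 2c/sqrt n], while the drift of its fixed point and the effect of the error [O(Z n)] are
    both of order [1/sqrt n], so a deviation [O(1)] maintains itself.

    The logarithm in the final error has a single source: the defect [1/sqrt n] of the ratios
    multiplies a Bose sum of size [sqrt n log n]. Passing from the exponential double sum to its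
    closed form costs only [O(1)]. *)

Fixpoint rsum (n : nat) (f : nat -> R) : R :=
  match n with O => 0 | S n => rsum n f + f n end.

Lemma rsum_ext n f g : (forall i, (i < n)%nat -> f i = g i) -> rsum n f = rsum n g.
Proof.
  induction n as [|n IH]; intros H; simpl; [reflexivity|].
  rewrite IH, H by auto with arith; reflexivity.
Qed.

Lemma rsum_plus n f g : rsum n (fun i => f i + g i) = rsum n f + rsum n g.
Proof. induction n as [|n IH]; simpl; [|rewrite IH]; ring. Qed.

Lemma rsum_minus n f g : rsum n (fun i => f i - g i) = rsum n f - rsum n g.
Proof. induction n as [|n IH]; simpl; [|rewrite IH]; ring. Qed.

Lemma rsum_scal n c f : rsum n (fun i => c * f i) = c * rsum n f.
Proof. induction n as [|n IH]; simpl; [|rewrite IH]; ring. Qed.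

Lemma rsum_scal_r n c f : rsum n (fun i => f i * c) = rsum n f * c.
Proof. induction n as [|n IH]; simpl; [|rewrite IH]; ring. Qed.

Lemma rsum_const n c : rsum n (fun _ => c) = INR n * c.
Proof. induction n as [|n IH]; [simpl; ring|]. rewrite S_INR; simpl; rewrite IH; ring. Qed.

Lemma rsum_0 n f : (forall i, (i < n)%nat -> f i = 0) -> rsum n f = 0.
Proof. intros H. rewrite (rsum_ext n f (fun _ => 0) H), rsum_const. ring. Qed.

Lemma rsum_le n f g : (forall i, (i < n)%nat -> f i <= g i) -> rsum n f <= rsum n g.
Proof.
  induction n as [|n IH]; intros H; simpl; [lra|].
  apply Rplus_le_compat; auto with arith.
Qed.

Lemma rsum_nonneg n f : (forall i, (i < n)%nat -> 0 <= f i) -> 0 <= rsum n f.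
Proof. intros H. rewrite <- (rsum_0 n (fun _ => 0)) by auto. now apply rsum_le. Qed.

Lemma rsum_abs n f g :
  (forall i, (i < n)%nat -> Rabs (f i) <= g i) -> Rabs (rsum n f) <= rsum n g.
Proof.
  induction n as [|n IH]; intros H; simpl; [rewrite Rabs_R0; lra|].
  eapply Rle_trans; [apply Rabs_triang|]. apply Rplus_le_compat; auto with arith.
Qed.

Lemma rsum_swap n m f :
  rsum n (fun i => rsum m (fun j => f i j)) = rsum m (fun j => rsum n (fun i => f i j)).
Proof.
  induction n as [|n IH]; simpl.
  - symmetry; apply rsum_0; auto.
  - rewrite IH, <- rsum_plus. reflexivity.
Qed.

Lemma rsum_telescope n f : rsum n (fun i => f (S i) - f i) = f n - f O.
Proof. induction n as [|n IH]; simpl; [|rewrite IH]; ring. Qed.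

Lemma rsum_split n m f : rsum (n + m) f = rsum n f + rsum m (fun i => f (n + i)%nat).
Proof.
  induction m as [|m IH]; [rewrite Nat.add_0_r; simpl; ring|].
  rewrite Nat.add_succ_r; simpl; rewrite IH; ring.
Qed.

Lemma rsum_first n f : rsum (S n) f = f O + rsum n (fun i => f (S i)).
Proof. change (S n) with (1 + n)%nat. rewrite rsum_split; simpl; ring. Qed.

Lemma rsum_extend n m f :
  (n <= m)%nat -> (forall i, (n <= i)%nat -> (i < m)%nat -> f i = 0) -> rsum m f = rsum n f.
Proof.
  intros Hnm H. replace m with (n + (m - n))%nat by lia. rewrite rsum_split.
  rewrite (rsum_0 (m - n)); [ring|]. intros; apply H; lia.
Qed.

Lemma rsum_le_extend n m f :
  (n <= m)%nat -> (forall i, 0 <= f i) -> rsum n f <= rsum m f.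
Proof.
  intros Hnm H. replace m with (n + (m - n))%nat by lia. rewrite rsum_split.
  assert (0 <= rsum (m - n) (fun i => f (n + i)%nat)) by (apply rsum_nonneg; auto). lra.
Qed.

Lemma rsum_rev n f : rsum n f = rsum n (fun i => f (n - 1 - i)%nat).
Proof.
  induction n as [|n IH]; [reflexivity|].
  rewrite (rsum_first n (fun i => f (S n - 1 - i)%nat)). simpl.
  rewrite IH. replace (n - 0 - 0)%nat with n by lia.
  rewrite Rplus_comm. f_equal. apply rsum_ext; intros; f_equal; lia.
Qed.

(** Multiplication of a generating series by [x^k]. The test guards against truncated subtraction,
    which would return [u 0] below [k] in place of a zero coefficient. *)
Definition shift (k : nat) (u : nat -> R) (n : nat) : R :=
  if (k <=? n)%nat then u (n - k)%nat else 0.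

Lemma shift_le k u n : (k <= n)%nat -> shift k u n = u (n - k)%nat.
Proof. intros H. unfold shift. now rewrite (proj2 (Nat.leb_le _ _) H). Qed.

Lemma shift_gt k u n : (n < k)%nat -> shift k u n = 0.
Proof. intros H. unfold shift. now rewrite (proj2 (Nat.leb_gt _ _) H). Qed.

Lemma shift_plus k u v n : shift k (fun x => u x + v x) n = shift k u n + shift k v n.
Proof. unfold shift. destruct (k <=? n)%nat; ring. Qed.

Lemma shift_shift j k u n : shift j (shift k u) n = shift (j + k) u n.
Proof.
  destruct (Nat.le_gt_cases j n) as [H|H].
  - rewrite shift_le by easy. destruct (Nat.le_gt_cases (j + k) n).
    + rewrite !shift_le by lia. f_equal; lia.
    + rewrite !shift_gt by lia. reflexivity.
  - rewrite !shift_gt by lia. reflexivity.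
Qed.

Lemma shift_ext k u v n :
  (forall x, (x <= n)%nat -> u x = v x) -> shift k u n = shift k v n.
Proof.
  intros H. destruct (Nat.le_gt_cases k n).
  - rewrite !shift_le by easy. apply H; lia.
  - rewrite !shift_gt by easy. reflexivity.
Qed.

Lemma shift_rsum j N F n :
  shift j (fun x => rsum N (fun i => F i x)) n = rsum N (fun i => shift j (F i) n).
Proof. unfold shift. destruct (j <=? n)%nat; [easy|]. symmetry; now apply rsum_0. Qed.

Lemma shift_scal j c u n : shift j (fun x => c * u x) n = c * shift j u n.
Proof. unfold shift. destruct (j <=? n)%nat; ring. Qed.

(* If [u] counts partitions, this is the sum of [f] over all parts of all partitions of [n]:
   those with at least [j] parts equal to [k] are counted by [u (n - k j)].  Any cutoff
   [N >= n] gives the same value.  For [f = INR] it is [sum_s sigma(s) u (n - s)]. *)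
Definition lambert (N : nat) (f u : nat -> R) (n : nat) : R :=
  rsum N (fun i => rsum N (fun j => f (S i) * shift (S i * S j)%nat u n)).

Lemma lambert_shift N f u k n : lambert N f (shift k u) n = shift k (lambert N f u) n.
Proof.
  unfold lambert. rewrite shift_rsum. apply rsum_ext; intros i _.
  rewrite shift_rsum. apply rsum_ext; intros j _.
  rewrite shift_scal, !shift_shift. do 2 f_equal; lia.
Qed.

Lemma lambert_plus N f u v n :
  lambert N f (fun x => u x + v x) n = lambert N f u n + lambert N f v n.
Proof.
  unfold lambert. rewrite <- rsum_plus. apply rsum_ext; intros i _.
  rewrite <- rsum_plus. apply rsum_ext; intros j _. rewrite shift_plus; ring.
Qed.

Lemma lambert_ext N f g u v n :
  (forall i, (1 <= i <= N)%nat -> f i = g i) -> (forall x, (x <= n)%nat -> u x = v x) ->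
  lambert N f u n = lambert N g v n.
Proof.
  intros Hf Hu. unfold lambert. apply rsum_ext; intros i Hi. apply rsum_ext; intros j Hj.
  rewrite Hf by lia. f_equal. now apply shift_ext.
Qed.

(** * Totals over partitions with bounded parts *)

Section Recursion.
Variables (a : nat -> nat -> R) (f : nat -> R).
Hypothesis a_S : forall k n, a (S k) n = a k n + shift (S k) (a (S k)) n.

(** With [A_k] the series of [a k], the hypothesis reads [A_{k+1} = A_k / (1 - x^{k+1})], so the
    multiples of [S k] contribute [A_k x^{k+1} / (1 - x^{k+1}) = x^{k+1} A_{k+1}]. On coefficients
    the sum telescopes, and [n < N] puts the last shift beyond [n]. *)
Lemma rec_telescope k N n : (n < N)%nat ->
  rsum N (fun j => shift (S k * S j)%nat (a k) n) = shift (S k) (a (S k)) n.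
Proof.
  intros HN.
  rewrite (rsum_ext _ _ (fun j =>
    (fun t => - shift (S k * S t)%nat (a (S k)) n) (S j) - (fun t => - shift (S k * S t)%nat (a (S k)) n) j)).
  - rewrite (rsum_telescope N (fun t => - shift (S k * S t)%nat (a (S k)) n)).
    rewrite (shift_gt (S k * S N)%nat) by nia. replace (S k * 1)%nat with (S k) by lia. ring.
  - intros j _.
    rewrite (shift_ext (S k * S j)%nat (a (S k)) (fun x => a k x + shift (S k) (a (S k)) x))
      by (intros; apply a_S).
    rewrite shift_plus, shift_shift. replace (S k * S j + S k)%nat with (S k * S (S j))%nat by lia.
    ring.
Qed.

(** The recursion determines [T], and [A_k] times [sum_{i <= k} f(i) x^i / (1 - x^i)] solves it. As
    [T (S k)] reappears on the right at smaller arguments, the induction on [k] contains a strong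
    induction on [n]. *)
Lemma total_rec (T : nat -> nat -> R) :
  (forall n, T O n = 0) ->
  (forall k n, T (S k) n =
     T k n + shift (S k) (fun x => T (S k) x + f (S k) * a (S k) x) n) ->
  forall N k n, (n < N)%nat -> (k <= N)%nat ->
    T k n = rsum k (fun i => rsum N (fun j => f (S i) * shift (S i * S j)%nat (a k) n)).
Proof.
  intros T0 TS N. induction k as [|k IHk]; [intros; apply T0|].
  intros n; induction n as [n IHn] using (well_founded_induction Wf_nat.lt_wf).
  intros HnN Hk. rewrite TS, shift_plus, IHk by lia.
  assert (E : shift (S k) (T (S k)) n = shift (S k) (fun x =>
    rsum (S k) (fun i => rsum N (fun j => f (S i) * shift (S i * S j)%nat (a (S k)) x))) n).
  { destruct (Nat.le_gt_cases (S k) n).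
    - rewrite !shift_le by easy. apply IHn; lia.
    - rewrite !shift_gt by easy. reflexivity. }
  rewrite E, shift_scal, <- (rec_telescope k N n HnN), <- rsum_scal.
  rewrite shift_rsum.
  (* [a (S k)] is split into [a k] and its own shift; the row [i = k] of the first half is the
     telescoped term. *)
  transitivity (rsum (S k) (fun i => rsum N (fun j => f (S i) * shift (S i * S j)%nat (a k) n))
    + rsum (S k) (fun i => rsum N (fun j => f (S i) * shift (S i * S j)%nat (shift (S k) (a (S k))) n))).
  - change (rsum (S k) (fun i => rsum N (fun j => f (S i) * shift (S i * S j)%nat (a k) n)))
      with (rsum k (fun i => rsum N (fun j => f (S i) * shift (S i * S j)%nat (a k) n))
        + rsum N (fun j => f (S k) * shift (S k * S j)%nat (a k) n)).
    rewrite (rsum_ext (S k) (fun i => shift (S k) _ n)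
      (fun i => rsum N (fun j => f (S i) * shift (S i * S j)%nat (shift (S k) (a (S k))) n))).
    + ring.
    + intros i _. rewrite shift_rsum. apply rsum_ext; intros j _.
      rewrite shift_scal, !shift_shift. do 2 f_equal; lia.
  - rewrite <- rsum_plus. apply rsum_ext; intros i _. rewrite <- rsum_plus.
    apply rsum_ext; intros j _. rewrite <- Rmult_plus_distr_l, <- shift_plus. f_equal.
    apply shift_ext; intros; symmetry; apply a_S.
Qed.
End Recursion.

(** * Counting by columns *)

(* In terms of the conjugate partition: adds a part equal to [k]. *)
Definition add_column (k : nat) (l : list nat) : list nat :=
  map S l ++ repeat 1%nat (k - length l).

(** Deletes one copy of the largest part of the conjugate, which is [length l]. *)
Definition strip_column (l : list nat) : list nat :=
  filter (fun x => negb (x =? 0)%nat) (map pred l).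

Definition col_weight (m i k : nat) : nat :=
  list_sum (map (fun j => if Nat.eqb (S j mod m) (i mod m) then 1%nat else 0%nat) (seq 0 k)).

Lemma length_add_column k l : (length l <= k)%nat -> length (add_column k l) = k.
Proof. intros H. unfold add_column. rewrite length_app, length_map, repeat_length. lia. Qed.

Lemma sum_add_column k l :
  (length l <= k)%nat -> list_sum (add_column k l) = (list_sum l + k)%nat.
Proof.
  intros H. unfold add_column. rewrite list_sum_app.
  assert (E1 : forall l, list_sum (map S l) = (list_sum l + length l)%nat)
    by (intros l'; induction l'; simpl; lia).
  assert (E2 : forall j, list_sum (repeat 1%nat j) = j) by (intros j; induction j; simpl; lia).
  rewrite E1, E2. lia.
Qed.

Lemma strip_add_column k l :
  List.Forall (fun x => (1 <= x)%nat) l -> strip_column (add_column k l) = l.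
Proof.
  intros H. unfold strip_column, add_column. rewrite map_app, filter_app.
  replace (filter _ (map pred (repeat 1%nat (k - length l)))) with (@nil nat)
    by (induction (k - length l)%nat; simpl; auto).
  rewrite app_nil_r, map_map. simpl. rewrite map_id.
  induction H as [|x l Hx H IH]; [reflexivity|]. simpl.
  destruct x; [lia|]. simpl. now rewrite IH.
Qed.

Lemma Forall_ge_add_column k l : List.Forall (fun x => (1 <= x)%nat) (add_column k l).
Proof.
  apply Forall_app; split.
  - apply Forall_map, Forall_forall; intros; lia.
  - apply Forall_forall; intros x Hx. apply repeat_spec in Hx. lia.
Qed.

Lemma sorted_add_column k l :
  StronglySorted (fun a b => (b <= a)%nat) l ->
  StronglySorted (fun a b => (b <= a)%nat) (add_column k l).
Proof.
  unfold add_column. generalize (k - length l)%nat as j. intros j H.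
  induction H as [|x l H IH Hx]; simpl.
  - induction j; simpl; constructor; auto. apply Forall_forall; intros y Hy.
    apply repeat_spec in Hy. lia.
  - constructor; auto. apply Forall_app; split.
    + apply Forall_map. eapply Forall_impl; [|exact Hx]. simpl; intros; lia.
    + apply Forall_forall; intros y Hy. apply repeat_spec in Hy. lia.
Qed.

(** The terminal case of [add_strip_column]: once the head of a nonincreasing list of positive parts
    is 1, the whole remainder consists of ones and disappears with the column. *)
Lemma strip_ones l :
  List.Forall (fun x => (1 <= x)%nat) l -> List.Forall (fun x => (x <= 1)%nat) l ->
  strip_column l = nil /\ l = repeat 1%nat (length l).
Proof.
  intros H1 H2. induction l as [|x l IH]; [auto|].
  inversion H1; inversion H2; subst. destruct IH as [A B]; auto.
  assert (x = 1%nat) by lia; subst. split; [exact A|]. simpl. now rewrite <- B.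
Qed.

Lemma length_strip_column l : (length (strip_column l) <= length l)%nat.
Proof.
  unfold strip_column. eapply Nat.le_trans; [apply filter_length_le|]. now rewrite length_map.
Qed.

Lemma add_strip_column l :
  StronglySorted (fun a b => (b <= a)%nat) l -> List.Forall (fun x => (1 <= x)%nat) l ->
  add_column (length l) (strip_column l) = l.
Proof.
  intros H. induction H as [|x l H IH Hx]; intros Hp; [reflexivity|].
  inversion Hp; subst. destruct x as [|[|x]]; [lia| |].
  - destruct (strip_ones (1%nat :: l)) as [A B]; auto.
    rewrite A. unfold add_column. simpl. simpl in B. congruence.
  - change (strip_column (S (S x) :: l)) with (S x :: strip_column l).
    unfold add_column in *. simpl. f_equal. auto.
Qed.

Lemma sorted_strip_column l :
  StronglySorted (fun a b => (b <= a)%nat) l ->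
  StronglySorted (fun a b => (b <= a)%nat) (strip_column l).
Proof.
  intros H. induction H as [|x l H IH Hx]; [constructor|].
  unfold strip_column in *. simpl. destruct (pred x =? 0)%nat; simpl; auto.
  constructor; auto. apply Forall_forall; intros y Hy.
  apply filter_In in Hy; destruct Hy as [Hy _]. apply in_map_iff in Hy.
  destruct Hy as [z [<- Hz]]. rewrite Forall_forall in Hx. specialize (Hx z Hz). lia.
Qed.

Lemma Forall_ge_strip_column l : List.Forall (fun x => (1 <= x)%nat) (strip_column l).
Proof.
  apply Forall_forall; intros x Hx. apply filter_In in Hx. destruct Hx as [_ Hx].
  destruct x; simpl in *; [discriminate|lia].
Qed.

Lemma is_partition_strong n l :
  is_partition n l <->
  StronglySorted (fun a b => (b <= a)%nat) l /\ List.Forall (fun x => (1 <= x)%nat) l /\ list_sum l = n.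
Proof.
  unfold is_partition. split; intros [H1 H2]; split; auto.
  - apply Sorted_StronglySorted; auto. intros a b c; simpl; lia.
  - now apply StronglySorted_Sorted.
Qed.

Lemma length_le_list_sum l : List.Forall (fun x => (1 <= x)%nat) l -> (length l <= list_sum l)%nat.
Proof. intros H; induction H; simpl; lia. Qed.

Lemma nth_add_column k l j : (j < k)%nat -> nth j (add_column k l) 0%nat = S (nth j l 0%nat).
Proof.
  intros Hj. unfold add_column. destruct (Nat.le_gt_cases (length l) j).
  - rewrite app_nth2 by (rewrite length_map; lia). rewrite length_map.
    rewrite (nth_overflow l) by lia.
    rewrite (nth_indep _ 0%nat 1%nat) by (rewrite repeat_length; lia). now rewrite nth_repeat.
  - rewrite app_nth1 by (rewrite length_map; lia).
    rewrite (nth_indep _ 0%nat 1%nat) by (rewrite length_map; lia). apply map_nth.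
Qed.

(** Missing rows count as 0, so [X] before and after a column is added can be read off the same [k]
    rows. *)
Lemma X_extend m i l k : (length l <= k)%nat ->
  X m i l = list_sum (map (fun j => if Nat.eqb (S j mod m) (i mod m)
                          then nth j l 0%nat else 0%nat) (seq 0 k)).
Proof.
  intros H. unfold X. replace k with (length l + (k - length l))%nat by lia.
  rewrite seq_app, map_app, list_sum_app. simpl.
  rewrite <- (Nat.add_0_r (list_sum _)) at 1. f_equal. symmetry.
  assert (E : forall s j0, (length l <= j0)%nat ->
    list_sum (map (fun j => if Nat.eqb (S j mod m) (i mod m)
                          then nth j l 0%nat else 0%nat) (seq j0 s)) = 0%nat).
  { induction s; intros j0 Hj; simpl; auto. rewrite nth_overflow by lia.
    rewrite IHs by lia. now destruct (_ =? _)%nat. }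
  now apply E.
Qed.

Lemma X_add_column m i k l : (length l <= k)%nat ->
  X m i (add_column k l) = (X m i l + col_weight m i k)%nat.
Proof.
  intros H. rewrite (X_extend m i _ k), (X_extend m i l k) by (rewrite ?length_add_column; lia).
  unfold col_weight.
  assert (E : forall s j0, (j0 + s <= k)%nat ->
   list_sum (map (fun j => if Nat.eqb (S j mod m) (i mod m)
                          then nth j (add_column k l) 0%nat else 0%nat) (seq j0 s)) =
   (list_sum (map (fun j => if Nat.eqb (S j mod m) (i mod m)
                          then nth j l 0%nat else 0%nat) (seq j0 s)) +
   list_sum (map (fun j => if Nat.eqb (S j mod m) (i mod m)
                          then 1%nat else 0%nat) (seq j0 s)))%nat).
  { induction s; intros j0 Hj; simpl map; simpl list_sum; auto.
    rewrite IHs by lia. rewrite nth_add_column by lia. destruct (_ =? _)%nat; lia. }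
  apply E; lia.
Qed.

Lemma list_sum_Permutation (l l' : list nat) : Permutation l l' -> list_sum l = list_sum l'.
Proof. intros H; induction H; simpl; lia. Qed.

(** * Enumeration by the number of rows *)

Section Enumeration.
Variable enum : nat -> list (list nat).
Hypothesis Henum : forall n, NoDup (enum n) /\ (forall l, In l (enum n) <-> is_partition n l).

(** At most [k] rows, that is, conjugates with all parts at most [k]. *)
Definition enum_upto (k n : nat) : list (list nat) :=
  filter (fun l => length l <=? k)%nat (enum n).

Lemma in_enum_upto k n l : In l (enum_upto k n) <->
  StronglySorted (fun a b => (b <= a)%nat) l /\ List.Forall (fun x => (1 <= x)%nat) l /\
  list_sum l = n /\ (length l <= k)%nat.
Proof.
  unfold enum_upto. rewrite filter_In, (proj2 (Henum n)), is_partition_strong, Nat.leb_le. tauto.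
Qed.

Lemma NoDup_enum_upto k n : NoDup (enum_upto k n).
Proof. apply NoDup_filter, Henum. Qed.

Lemma enum_upto_all k n : (n <= k)%nat -> enum_upto k n = enum n.
Proof.
  intros H. unfold enum_upto. rewrite <- (filter_ext_in (fun _ => true)).
  - generalize (enum n). induction l; simpl; congruence.
  - intros l Hl. symmetry. apply Nat.leb_le.
    apply (proj2 (Henum n)) in Hl. destruct Hl as [_ [H1 H2]].
    apply length_le_list_sum in H1. lia.
Qed.

(** A partition with exactly [S k] rows loses its first column and becomes an arbitrary partition of
    [n - S k] with at most [S k] rows. In the conjugate one part [S k] is removed, which is the
    recursion required by [total_rec]. *)
Lemma enum_upto_S k n : Permutation (enum_upto (S k) n)
  (enum_upto k n ++
   if (S k <=? n)%nat then map (add_column (S k)) (enum_upto (S k) (n - S k)) else nil).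
Proof.
  assert (Hlen : forall l, In l (if (S k <=? n)%nat
      then map (add_column (S k)) (enum_upto (S k) (n - S k)) else nil) -> length l = S k).
  { intros l. destruct (S k <=? n)%nat; [|intros []]. intros Hl. apply in_map_iff in Hl.
    destruct Hl as [l' [<- Hl']]. apply in_enum_upto in Hl'. apply length_add_column. tauto. }
  apply NoDup_Permutation; [apply NoDup_enum_upto| |].
  - apply NoDup_app; [apply NoDup_enum_upto| |].
    + destruct (S k <=? n)%nat; [|constructor].
      apply NoDup_map_NoDup_ForallPairs; [|apply NoDup_enum_upto].
      intros l l' Hl Hl' E. apply in_enum_upto in Hl, Hl'.
      rewrite <- (strip_add_column (S k) l), <- (strip_add_column (S k) l') by tauto.
      now rewrite E.
    + intros l Hl Hl'. apply Hlen in Hl'. apply in_enum_upto in Hl. lia.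
  - intros l. rewrite in_app_iff, !in_enum_upto. split.
    + intros [H1 [H2 [H3 H4]]]. destruct (Nat.le_gt_cases (length l) k) as [Hk|Hk]; [left; tauto|].
      right. assert (Hl : length l = S k) by lia.
      assert (S k <= n)%nat by (apply length_le_list_sum in H2; lia).
      rewrite (proj2 (Nat.leb_le _ _) H). apply in_map_iff. exists (strip_column l).
      assert (E := add_strip_column l H1 H2). rewrite Hl in E. split; [exact E|].
      apply in_enum_upto. pose proof (length_strip_column l) as Hs.
      repeat split; [now apply sorted_strip_column|apply Forall_ge_strip_column| |lia].
      rewrite <- E in H3. rewrite sum_add_column in H3 by lia. lia.
    + intros [H|H]; [intuition lia|]. pose proof (Hlen l H) as Hl.
      destruct (Nat.leb_spec (S k) n) as [Hn|]; [|destruct H].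
      apply in_map_iff in H. destruct H as [l' [<- H]]. apply in_enum_upto in H.
      repeat split; [now apply sorted_add_column|apply Forall_ge_add_column| |lia].
      rewrite sum_add_column by tauto. lia.
Qed.

Definition count_upto (k n : nat) : R := INR (length (enum_upto k n)).

Lemma enum_upto_0 n : enum_upto 0 n = if (n =? 0)%nat then nil :: nil else nil.
Proof.
  assert (H : forall l, In l (enum_upto 0 n) <-> l = nil /\ n = 0%nat).
  { intros l. rewrite in_enum_upto. split.
    - intros [_ [_ [H1 H2]]]. destruct l; simpl in *; [auto|lia].
    - intros [-> ->]. repeat constructor. }
  pose proof (NoDup_enum_upto 0 n) as ND.
  destruct (Nat.eqb_spec n 0) as [->|Hn].
  - destruct (enum_upto 0 0) as [|x [|y t]].
    + destruct (proj2 (H nil)); auto.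
    + destruct (proj1 (H x)) as [-> _]; simpl; auto.
    + destruct (proj1 (H x)) as [-> _]; [simpl; auto|].
      destruct (proj1 (H y)) as [-> _]; [simpl; auto|].
      inversion ND; subst. simpl in *. tauto.
  - destruct (enum_upto 0 n) as [|x t]; auto. destruct (proj1 (H x)); simpl; auto. lia.
Qed.

Lemma count_upto_0 n : count_upto 0 n = if (n =? 0)%nat then 1 else 0.
Proof. unfold count_upto. rewrite enum_upto_0. now destruct (n =? 0)%nat. Qed.

Lemma count_upto_S k n :
  count_upto (S k) n = count_upto k n + shift (S k) (count_upto (S k)) n.
Proof.
  unfold count_upto at 1 2. rewrite (Permutation_length (enum_upto_S k n)), length_app, plus_INR.
  f_equal. unfold shift, count_upto. destruct (S k <=? n)%nat; [|reflexivity].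
  now rewrite length_map.
Qed.

Lemma count_upto_all k n : (n <= k)%nat -> count_upto k n = INR (length (enum n)).
Proof. intros H. unfold count_upto. now rewrite enum_upto_all. Qed.

(** [X] is additive under adding a column: each of the partitions counted by [count_upto] gains
    [col_weight m i (S k)], so the totals obey the recursion of [total_rec]. With [S n] rows allowed
    the bound on the rows is vacuous. *)
Lemma total_X m i n :
  fold_right Rplus 0 (map (fun l => INR (X m i l)) (enum n)) =
  lambert (S n) (fun k => INR (col_weight m i k)) (fun x => INR (length (enum x))) n.
Proof.
  set (T := fun k n => INR (list_sum (map (X m i) (enum_upto k n)))).
  transitivity (T (S n) n).
  - unfold T. rewrite enum_upto_all by lia. induction (enum n); simpl; [reflexivity|].
    rewrite plus_INR. now rewrite IHl.
  - rewrite (total_rec count_upto (fun k => INR (col_weight m i k)) count_upto_S T) with (N := S n).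
    + unfold lambert. apply rsum_ext; intros a _. apply rsum_ext; intros b _. f_equal.
      apply shift_ext; intros x Hx. apply count_upto_all. lia.
    + intros x. unfold T. rewrite enum_upto_0. now destruct (x =? 0)%nat.
    + intros k x. unfold T.
      rewrite (list_sum_Permutation _ _ (Permutation_map (X m i) (enum_upto_S k x))).
      rewrite map_app, list_sum_app, plus_INR. f_equal. unfold shift.
      destruct (S k <=? x)%nat; [|reflexivity]. unfold count_upto.
      rewrite map_map, <- mult_INR, <- plus_INR. f_equal.
      assert (H : forall l, In l (enum_upto (S k) (x - S k)) -> (length l <= S k)%nat)
        by (intros l Hl; apply in_enum_upto in Hl; tauto).
      induction (enum_upto (S k) (x - S k)) as [|l L IH]; simpl map; simpl list_sum; [simpl; lia|].
      rewrite X_add_column by (apply H; simpl; auto).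
      rewrite IH by (intros; apply H; simpl; auto). simpl length. lia.
    + lia.
    + lia.
Qed.

(** The same recursion for the size, to which a column of height [k] adds [k]; the total size of all
    partitions of [n] is [n p(n)]. *)
Lemma total_size n :
  INR n * INR (length (enum n)) = lambert (S n) INR (fun x => INR (length (enum x))) n.
Proof.
  set (T := fun k n => INR n * count_upto k n).
  transitivity (T (S n) n).
  - unfold T. now rewrite count_upto_all by lia.
  - rewrite (total_rec count_upto INR count_upto_S T) with (N := S n).
    + unfold lambert. apply rsum_ext; intros a _. apply rsum_ext; intros b _. f_equal.
      apply shift_ext; intros x Hx. apply count_upto_all. lia.
    + intros x. unfold T. rewrite count_upto_0. destruct (Nat.eqb_spec x 0); subst; simpl; ring.
    + intros k x. unfold T. rewrite count_upto_S.
      destruct (Nat.le_gt_cases (S k) x).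
      * rewrite !shift_le by easy. rewrite minus_INR by easy. ring.
      * rewrite !shift_gt by easy. ring.
    + lia.
    + lia.
Qed.
End Enumeration.

(** * Approximating the divisor sum *)

(** For [n <= N], [cumul] and [cumul2] are the coefficients of [x/(1-x)] and [x/(1-x)^2] times the
    series of [u], hence the first and second sums [Z] and [Y]. As convolutions they commute with
    [shift]. *)
Definition cumul (N : nat) (u : nat -> R) (n : nat) : R :=
  rsum N (fun s => shift (S s) u n).

Definition cumul2 (N : nat) (u : nat -> R) (n : nat) : R :=
  rsum N (fun s => INR (S s) * shift (S s) u n).

(** Tested against [u], the divisor sum [sigma(s)] behaves like [zeta * s] up to a bounded multiple
    of the constant weight 1. *)
Definition sigma_close (zeta K : R) (N : nat) (u : nat -> R) : Prop :=
  forall n, (n <= N)%nat ->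
    Rabs (lambert N INR u n - zeta * cumul2 N u n) <= K * cumul N u n.

(** The series of [v] is that of [u] divided by [1 - x^k]. All three functionals are linear and
    commute with shifts, so the errors add up exactly as the bounds do, and [K] is unchanged. *)
Lemma sigma_close_step zeta K N k u v :
  (1 <= k)%nat -> (forall n, v n = u n + shift k v n) ->
  sigma_close zeta K N u -> sigma_close zeta K N v.
Proof.
  intros Hk Hv Hu n. induction n as [n IH] using (well_founded_induction Wf_nat.lt_wf).
  intros Hn.
  assert (E1 : lambert N INR v n = lambert N INR u n + shift k (lambert N INR v) n).
  { rewrite <- lambert_shift, <- lambert_plus. now apply lambert_ext. }
  assert (E2 : cumul N v n = cumul N u n + shift k (cumul N v) n).
  { unfold cumul. rewrite shift_rsum, <- rsum_plus. apply rsum_ext; intros s _.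
    rewrite shift_shift, Nat.add_comm, <- shift_shift, <- shift_plus. now apply shift_ext. }
  assert (E3 : cumul2 N v n = cumul2 N u n + shift k (cumul2 N v) n).
  { unfold cumul2. rewrite shift_rsum, <- rsum_plus. apply rsum_ext; intros s _.
    rewrite shift_scal, shift_shift, Nat.add_comm, <- shift_shift, <- Rmult_plus_distr_l, <- shift_plus.
    f_equal. now apply shift_ext. }
  rewrite E1, E2, E3. specialize (Hu n Hn). destruct (Nat.le_gt_cases k n) as [H|H].
  - rewrite !shift_le by easy. specialize (IH (n - k)%nat ltac:(lia) ltac:(lia)).
    eapply Rle_trans; [|apply Rle_trans with (1 := Rplus_le_compat _ _ _ _ Hu IH); lra].
    eapply Rle_trans; [|apply Rabs_triang]. right. f_equal. ring.
  - rewrite !shift_gt by easy. rewrite !Rplus_0_r. exact Hu.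
Qed.

Lemma rsum_INR n : rsum n (fun s => INR (S s)) = INR n * (INR n + 1) / 2.
Proof. induction n as [|n IH]; [simpl; lra|]. cbn [rsum]. rewrite IH, S_INR. field. Qed.

Lemma rsum_INR_sq n :
  rsum n (fun s => INR (S s) ^ 2) = INR n * (INR n + 1) * (2 * INR n + 1) / 6.
Proof. induction n as [|n IH]; [simpl; lra|]. cbn [rsum]. rewrite IH, S_INR. field. Qed.

(** The sum is that of [d (n - dk)] over [d <= n/k]. The weight [n - dk] vanishes at the cut, which
    smooths it and leaves an error linear in [n]. *)
Lemma inner_sum N n k : (1 <= k)%nat -> (k <= n)%nat -> (n <= N)%nat ->
  Rabs (rsum N (fun d => INR (S d) * shift (S d * k) INR n) - INR n ^ 3 / (6 * INR k ^ 2))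
    <= INR n / 3.
Proof.
  intros Hk Hkn HN. set (D := (n / k)%nat).
  assert (HD : (k * D <= n /\ n < k * S D)%nat).
  { pose proof (Nat.div_mod n k ltac:(lia)). pose proof (Nat.mod_upper_bound n k ltac:(lia)).
    unfold D. nia. }
  rewrite (rsum_extend D N).
  2:{ nia. }
  2:{ intros d H1 H2. rewrite shift_gt by nia. ring. }
  rewrite (rsum_ext _ _ (fun d => INR n * INR (S d) - INR k * INR (S d) ^ 2)).
  2:{ intros d Hd. rewrite shift_le by nia. rewrite minus_INR by nia. rewrite mult_INR. ring. }
  rewrite rsum_minus, !rsum_scal, rsum_INR, rsum_INR_sq.
  destruct HD as [H1 H2]. apply le_INR in H1. apply lt_INR in H2. rewrite mult_INR in H1, H2.
  rewrite S_INR in H2.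
  assert (Hk1 : 1 <= INR k) by (apply (le_INR 1); easy).
  apply le_INR in Hkn. pose proof (pos_INR D) as HD0.
  set (x := INR n) in *. set (y := INR k) in *. set (z := INR D) in *.
  set (t := x / y - z).
  assert (Ex : x = y * (z + t)) by (unfold t; field; lra).
  assert (Ht : 0 <= t <= 1).
  { assert (t * y = x - y * z) by (unfold t; field; lra).
    split; apply (Rmult_le_reg_r y); lra. }
  (* With [n = k (z + t)] and [0 <= t <= 1], the terms in [z^3] and [z^2] cancel; what remains is of
     order [k (z + 1)]. *)
  replace (_ - _) with (y / 6 * (3 * t * z - z - 3 * z * t ^ 2 - t ^ 3)).
  2:{ rewrite Ex. field. lra. }
  rewrite Rabs_mult, (Rabs_right (y / 6)) by lra.
  assert (Rabs (3 * t * z - z - 3 * z * t ^ 2 - t ^ 3) <= z + 1).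
  { assert (0 <= t ^ 3 <= 1) by (split; simpl; nra).
    assert (0 <= t * (1 - t) <= 1 / 4) by (split; [|pose proof (pow2_ge_0 (t - 1 / 2))]; nra).
    apply Rabs_le. split; nra. }
  apply Rle_trans with (y / 6 * (z + 1)); [apply Rmult_le_compat_l; lra|]. nra.
Qed.

Section Base.
Variable zeta : R.
Hypothesis Hzeta : forall n, (1 <= n)%nat ->
  0 <= zeta - rsum n (fun k => / INR (S k) ^ 2) <= / INR n.

(** The left sum is [sum_s sigma(s) (n - s)], grouped by the codivisor [k] of [s]. The [n] values of
    [k] cost [n/3] each, and the tail of [zeta] costs [n^2/6]. *)
Lemma sigma_cubic N n : (1 <= n)%nat -> (n <= N)%nat ->
  Rabs (lambert N INR INR n - zeta * INR n ^ 3 / 6) <= INR n ^ 2 / 2.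
Proof.
  intros Hn HN. unfold lambert. rewrite rsum_swap.
  rewrite (rsum_extend n N).
  2:{ easy. }
  2:{ intros j H1 H2. apply rsum_0; intros i _. rewrite shift_gt by nia. ring. }
  assert (Hn1 : 1 <= INR n) by (apply (le_INR 1); easy).
  set (F := fun j => rsum N (fun i => INR (S i) * shift (S i * S j) INR n)).
  assert (H1 : Rabs (rsum n F - rsum n (fun k => INR n ^ 3 / 6 * / INR (S k) ^ 2)) <= INR n ^ 2 / 3).
  { rewrite <- rsum_minus. eapply Rle_trans.
    - apply rsum_abs with (g := fun _ => INR n / 3). intros k Hk. unfold F.
      replace (INR n ^ 3 / 6 * / INR (S k) ^ 2) with (INR n ^ 3 / (6 * INR (S k) ^ 2)).
      + apply inner_sum; lia.
      + field. apply not_0_INR; lia.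
    - rewrite rsum_const. right; field. }
  rewrite rsum_scal in H1. destruct (Hzeta n Hn) as [H2 H3].
  set (S := rsum n (fun k => / INR (Datatypes.S k) ^ 2)) in *.
  assert (H4 : Rabs (INR n ^ 3 / 6 * S - zeta * INR n ^ 3 / 6) <= INR n ^ 2 / 6).
  { assert (E : INR n ^ 3 * / INR n = INR n ^ 2) by (field; lra).
    assert (0 <= INR n ^ 3) by (apply pow_le; lra).
    apply Rabs_le. split; nra. }
  unfold F in H1.
  replace (_ - _) with ((rsum n F - INR n ^ 3 / 6 * S) + (INR n ^ 3 / 6 * S - zeta * INR n ^ 3 / 6))
    by (unfold F; ring).
  eapply Rle_trans; [apply Rabs_triang|]. unfold F; lra.
Qed.

(* The bounds on [u] are those of the number of partitions into parts at most 2.  Starting from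
   parts at most 1 would fail: the error term of [sum_{s<=n} sigma(s)] carries a logarithm. *)
Lemma sigma_close_base N u :
  (forall n, (INR n + 1) / 2 <= u n <= INR n / 2 + 1) -> sigma_close zeta 14 N u.
Proof.
  intros Hu n HN. destruct n as [|n'].
  - replace (lambert N INR u 0) with 0; [|symmetry; apply rsum_0; intros; apply rsum_0; intros;
      rewrite shift_gt by lia; ring].
    replace (cumul2 N u 0) with 0; [|symmetry; apply rsum_0; intros; rewrite shift_gt by lia; ring].
    replace (cumul N u 0) with 0; [|symmetry; apply rsum_0; intros; rewrite shift_gt by lia; ring].
    rewrite !Rmult_0_r, Rminus_0_r, Rabs_R0; lra.
  - set (n := S n') in *. assert (Hn : (1 <= n)%nat) by (unfold n; lia). clearbody n. clear n'.
    assert (Hn1 : 1 <= INR n) by (apply (le_INR 1); easy).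
    pose proof (sigma_cubic N n Hn HN) as H1.
    assert (Hz : 1 <= zeta <= 2).
    { destruct (Hzeta 1 ltac:(lia)) as [A B]. simpl in A, B. lra. }
    assert (HZ : INR n ^ 2 / 4 <= cumul N u n).
    { unfold cumul. rewrite (rsum_extend n N); [|easy|intros; apply shift_gt; lia].
      rewrite (rsum_ext _ _ (fun s => u (n - 1 - s)%nat))
        by (intros; rewrite shift_le by lia; f_equal; lia).
      rewrite <- (rsum_rev n u).
      apply Rle_trans with (rsum n (fun s => / 2 * INR (S s))).
      - rewrite rsum_scal, rsum_INR. nra.
      - apply rsum_le; intros s _. rewrite S_INR. specialize (Hu s). lra. }
    assert (HL : Rabs (lambert N INR u n - / 2 * lambert N INR INR n) <= INR n ^ 2).
    { unfold lambert. rewrite <- rsum_scal, <- rsum_minus.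
      apply Rle_trans with (rsum N (fun i => if (i <? n)%nat then INR n else 0)).
      - apply rsum_abs; intros i Hi. rewrite <- rsum_scal, <- rsum_minus.
        destruct (Nat.ltb_spec i n) as [Hin|Hin].
        2:{ rewrite rsum_0; [rewrite Rabs_R0; lra|]. intros j _. rewrite !shift_gt by nia. ring. }
        assert (Hq : (S i * (n / S i) <= n)%nat) by (apply Nat.Div0.mul_div_le).
        pose proof (Nat.div_mod n (S i) ltac:(lia)) as Hdm.
        pose proof (Nat.mod_upper_bound n (S i) ltac:(lia)) as Hmb.
        rewrite (rsum_extend (n / S i) N).
        2:{ nia. }
        2:{ intros j A B. rewrite !shift_gt by nia. ring. }
        eapply Rle_trans.
        + apply rsum_abs with (g := fun _ => INR (S i)). intros j Hj.
          rewrite !shift_le by nia. specialize (Hu (n - S i * S j)%nat).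
          pose proof (pos_INR (S i)) as A. set (w := INR (S i)) in *.
          replace (_ - _) with (w * (u (n - S i * S j)%nat - / 2 * INR (n - S i * S j))) by ring.
          rewrite Rabs_mult, (Rabs_right w) by lra.
          apply Rle_trans with (w * 1); [|lra]. apply Rmult_le_compat_l; [lra|].
          apply Rabs_le. lra.
        + rewrite rsum_const, <- mult_INR. apply le_INR. lia.
      - rewrite (rsum_extend n N); [|easy|intros i A B; now rewrite (proj2 (Nat.ltb_ge _ _) A)].
        rewrite (rsum_ext _ _ (fun _ => INR n)); [rewrite rsum_const; simpl; lra|].
        intros i A. now rewrite (proj2 (Nat.ltb_lt _ _) A). }
    assert (HY : Rabs (cumul2 N u n - (INR n ^ 3 - INR n) / 12) <= INR n ^ 2).
    { unfold cumul2. rewrite (rsum_extend n N); [|easy|intros; rewrite shift_gt by lia; ring].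
      replace ((INR n ^ 3 - INR n) / 12) with (rsum n (fun s => INR (S s) * (INR n - INR (S s)) / 2)).
      - rewrite <- rsum_minus. apply Rle_trans with (rsum n (fun s => INR (S s))).
        + apply rsum_abs; intros s Hs. rewrite shift_le by lia.
          specialize (Hu (n - S s)%nat). rewrite minus_INR in Hu by lia.
          pose proof (pos_INR (S s)) as A. set (w := INR (S s)) in *.
          replace (_ - _) with (w * (u (n - S s)%nat - (INR n - w) / 2)) by field.
          rewrite Rabs_mult, (Rabs_right w) by lra. apply Rle_trans with (w * 1); [|lra]. apply Rmult_le_compat_l; [lra|].
          apply Rabs_le. lra.
        + rewrite rsum_INR. nra.
      - rewrite (rsum_ext _ _ (fun s => (INR n / 2) * INR (S s) - / 2 * INR (S s) ^ 2))
          by (intros; field).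
        rewrite rsum_minus, !rsum_scal, rsum_INR, rsum_INR_sq. field. }
    (* The errors add up to [(1/4 + 1 + 2 + 1/6) n^2], where 2 is the bound on [zeta]; this is below
       14 times the lower bound [n^2/4] of [cumul]. *)
    apply Rabs_le_between in H1, HL, HY.
    assert (0 <= INR n <= INR n ^ 2) by nra.
    apply Rabs_le. split; nra.
Qed.
End Base.

(** * Ratios of partition numbers *)

Lemma le_exp_half x : 0 <= x -> x * exp (- x) <= 1.
Proof.
  intros Hx. pose proof (exp_ineq1_le x). pose proof (exp_pos (- x)) as P.
  assert (E : exp x * exp (- x) = 1) by (rewrite <- exp_plus, Rplus_opp_r; apply exp_0).
  nra.
Qed.

(** With its square below, this trades polynomial factors for a fraction of an exponential rate. *)
Lemma le_exp_scaled b y : 0 < b -> y * exp (- (b * y)) <= / b.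
Proof.
  intros Hb. destruct (Rle_or_lt 0 y) as [Hy|Hy].
  - pose proof (le_exp_half (b * y) ltac:(nra)). apply (Rmult_le_reg_l b); [easy|].
    rewrite Rinv_r by lra. lra.
  - pose proof (exp_pos (- (b * y))). pose proof (Rinv_0_lt_compat b Hb). nra.
Qed.

Lemma sq_le_exp_scaled b y : 0 < b -> 0 <= y -> y ^ 2 * exp (- (b * y)) <= 4 / b ^ 2.
Proof.
  intros Hb Hy. pose proof (le_exp_scaled (b / 2) y ltac:(lra)) as H.
  replace (exp (- (b * y))) with (exp (- (b / 2 * y)) ^ 2).
  - replace (4 / b ^ 2) with ((/ (b / 2)) ^ 2) by (field; lra).
    rewrite <- Rpow_mult_distr. apply pow_incr. split; [|easy].
    pose proof (exp_pos (- (b / 2 * y))); nra.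
  - simpl. rewrite Rmult_1_r, <- exp_plus. f_equal; field.
Qed.

Lemma exp_le_mono x y : x <= y -> exp x <= exp y.
Proof.
  intros H. destruct (Rle_lt_or_eq_dec _ _ H) as [H1| ->]; [|lra]. left; now apply exp_increasing.
Qed.

Lemma exp_neg_le x y : x <= y -> exp (- y) <= exp (- x).
Proof.
  intros H. apply exp_le_mono; lra.
Qed.

Lemma exp_neg_taylor x : 0 <= x -> 0 <= exp (- x) - (1 - x) <= x ^ 2.
Proof.
  intros Hx. pose proof (exp_ineq1_le (- x)) as H1. pose proof (exp_ineq1_le x) as H2.
  assert (E : exp x * exp (- x) = 1) by (rewrite <- exp_plus, Rplus_opp_r; apply exp_0).
  pose proof (exp_pos (- x)). split; [lra|].
  assert (exp (- x) * (1 + x) <= 1) by nra. nra.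
Qed.

Lemma nat_above x : exists n : nat, x <= INR n.
Proof.
  destruct (INR_unbounded x) as [n Hn]. exists n; lra.
Qed.

Lemma sqrt_INR_sq n : sqrt (INR n) * sqrt (INR n) = INR n.
Proof. apply sqrt_sqrt, pos_INR. Qed.

Lemma sqrt_INR_ge1 n : (1 <= n)%nat -> 1 <= sqrt (INR n).
Proof. intros H. rewrite <- sqrt_1. apply sqrt_le_1_alt. apply (le_INR 1), H. Qed.

Lemma sqrt_INR_S n : (1 <= n)%nat -> sqrt (INR (S n)) <= sqrt (INR n) + / (2 * sqrt (INR n)).
Proof.
  intros H. pose proof (sqrt_INR_ge1 n H). pose proof (sqrt_INR_sq n).
  set (w := sqrt (INR n)) in *. assert (0 < / (2 * w)) by (apply Rinv_0_lt_compat; lra).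
  rewrite <- (sqrt_pow2 (w + / (2 * w))) by lra. apply sqrt_le_1_alt.
  rewrite S_INR, <- H1. replace ((w + / (2 * w)) ^ 2) with (w * w + 1 + / (2 * w) ^ 2) by (field; lra).
  assert (0 <= / (2 * w) ^ 2) by (left; apply Rinv_0_lt_compat, pow_lt; lra). lra.
Qed.

(** * Sequences with [n p(n) = c^2 Y(n) + O(Z(n))] *)

Section Renewal.
Variables (p : nat -> R) (c K : R).
Hypothesis c_ge1 : 1 <= c.
Hypothesis K_ge0 : 0 <= K.
Hypothesis p_pos : forall n, 0 < p n.
Hypothesis p_incr : forall n, p n <= p (S n).

Let Z (n : nat) : R := rsum n p.
Let Y (n : nat) : R := rsum (S n) Z.

Hypothesis p_Y : forall n, Rabs (INR n * p n - c ^ 2 * Y n) <= K * Z n.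

Lemma Z_S n : Z (S n) = Z n + p n.
Proof. reflexivity. Qed.

Lemma Y_S n : Y (S n) = Y n + Z (S n).
Proof. reflexivity. Qed.

Lemma Z_pos n : (1 <= n)%nat -> 0 < Z n.
Proof.
  intros H. destruct n; [lia|]. rewrite Z_S. pose proof (p_pos n).
  assert (0 <= Z n) by (apply rsum_nonneg; intros; left; auto). lra.
Qed.

Lemma Z_nonneg n : 0 <= Z n.
Proof. apply rsum_nonneg; intros; left; auto. Qed.

Lemma Z_le_Y n : Z n <= Y n.
Proof.
  destruct n; [unfold Y, Z; simpl; lra|]. rewrite Y_S.
  assert (0 <= Y n) by (apply rsum_nonneg; intros; apply Z_nonneg). lra.
Qed.

Lemma Y_le_Z n : Y n <= INR n * Z n.
Proof.
  induction n as [|n IH]; [unfold Y, Z; simpl; lra|].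
  rewrite Y_S, S_INR. pose proof (Z_S n). pose proof (p_pos n). pose proof (pos_INR n). nra.
Qed.

Lemma Y_pos n : (1 <= n)%nat -> 0 < Y n.
Proof. intros H. pose proof (Z_pos n H). pose proof (Z_le_Y n). lra. Qed.

Lemma Y_step n : Y n <= Y (S n).
Proof. rewrite Y_S. pose proof (Z_nonneg (S n)). lra. Qed.

(* [r = Y n / Z n] obeys the Riccati-type recursion
   [r' = 1 + r n / (n + E + c^2 r)], [|E| <= K], whose fixed point is near [sqrt n / c]. *)
Lemma riccati_step n r E A (w := sqrt (INR n)) :
  (1 <= n)%nat -> K + 1 <= INR n -> Rabs E <= K -> 1 <= r ->
  (c ^ 2 + K) / c <= 2 * c * A -> c ^ 2 + K <= c ^ 2 * A -> K / c + 1 <= c * A ->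
  Rabs (r - w / c) <= A ->
  Rabs (1 + r * INR n / (INR n + E + c ^ 2 * r) - sqrt (INR (S n)) / c) <= A.
Proof.
  intros Hn HK HE Hr A1 A2 A3 H. apply Rabs_le_between in HE. apply Rabs_le_between in H.
  pose proof (sqrt_INR_ge1 n Hn) as Hw. pose proof (sqrt_INR_sq n) as Hw2.
  pose proof (sqrt_INR_S n Hn) as HS.
  assert (HS' : w <= sqrt (INR (S n))) by (apply sqrt_le_1_alt; rewrite S_INR; lra).
  fold w in Hw, Hw2, HS. set (w' := sqrt (INR (S n))) in *.
  rewrite <- Hw2 in *. clearbody w w'.
  set (v := w / c) in *. assert (Ev : c * v = w) by (unfold v; field; lra).
  assert (Ev' : w' / c <= v + / (2 * w)).
  { apply (Rmult_le_reg_l c); [lra|]. replace (c * (w' / c)) with w' by (field; lra).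
    rewrite Rmult_plus_distr_l, Ev.
    assert (0 < / (2 * w)) by (apply Rinv_0_lt_compat; lra). nra. }
  assert (Ev2 : v <= w' / c).
  { apply (Rmult_le_reg_l c); [lra|]. replace (c * (w' / c)) with w' by (field; lra). lra. }
  set (x := w' / c) in *. clearbody x.
  assert (Hv : 0 < v) by nra.
  assert (HD : 0 < w * w + E + c ^ 2 * r) by nra.
  assert (HA : 1 <= A) by (assert (0 < c ^ 2) by nra; nra).
  (* Cleared of the denominator, each bound is linear in [r], so the worst case is an endpoint
     [v - A] or [v + A] of the interval allowed for [r]. There [c^2 r^2] differs from [w^2] by about
     [2 c A w], which outweighs the effect of [E] and the growth of [sqrt n]. *)
  apply Rabs_le. split.
  - (* lower bound *)
    set (iw := / (2 * w)) in *.
    assert (Hiw : 2 * w * iw = 1) by (unfold iw; field; lra).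
    assert (0 < iw) by (unfold iw; apply Rinv_0_lt_compat; lra).
    set (t := v - A + iw - 1).
    assert (Ht : t <= r * (w * w) / (w * w + E + c ^ 2 * r)).
    { apply (Rmult_le_reg_r (w * w + E + c ^ 2 * r)); [easy|].
      replace (r * (w * w) / (w * w + E + c ^ 2 * r) * (w * w + E + c ^ 2 * r))
        with (r * (w * w)) by (field; lra).
      assert (iw <= 1 / 2) by nra.
      destruct (Rle_or_lt t 0) as [Ht|Ht]; [assert (0 <= r * (w * w)) by nra; nra|].
      set (b := v - A) in *. assert (Hb : 0 < b) by (unfold t, b in *; lra).
      assert (Htb : t = b + iw - 1) by reflexivity.
      assert (Ecb : c * b = w - c * A) by (unfold b; rewrite <- Ev; ring).
      assert (B1 : c ^ 2 * b ^ 2 <= w * w - c * A * w) by (replace (c ^ 2 * b ^ 2) with ((c * b) ^ 2) by ring; nra).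
      assert (B2 : K * b <= K / c * w).
      { replace (K / c * w) with (K * v) by (unfold v; field; lra). unfold b. nra. }
      assert (B3 : b * (K + c ^ 2 * b) <= w * w - w / 2 ) by nra.
      assert (B4 : 0 <= w * w - c ^ 2 * t).
      { assert (c ^ 2 * t <= c ^ 2 * b) by nra. replace (c ^ 2 * b) with (c * w - c ^ 2 * A) in H1 by
        (replace (c ^ 2 * b) with (c * (c * b)) by ring; rewrite Ecb; ring). nra. }
      assert (B5 : t * (w * w + K) <= b * (w * w - c ^ 2 * t)).
      { assert (t * (K + c ^ 2 * b) <= b * (K + c ^ 2 * b)) by (apply Rmult_le_compat_r; nra).
        assert ((b - t) * (w * w) = w * w - w / 2) by (rewrite Htb; nra). nra. }
      assert (b * (w * w - c ^ 2 * t) <= r * (w * w - c ^ 2 * t)) by (apply Rmult_le_compat_r; unfold b; lra).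
      nra. }
    unfold t in Ht. lra.
  - (* upper bound *)
    set (B := v + A) in *.
    assert (Ht : r * (w * w) / (w * w + E + c ^ 2 * r) <= B - 1).
    { apply (Rmult_le_reg_r (w * w + E + c ^ 2 * r)); [easy|].
      replace (r * (w * w) / (w * w + E + c ^ 2 * r) * (w * w + E + c ^ 2 * r))
        with (r * (w * w)) by (field; lra).
      assert (HB : 0 <= B - 1) by (unfold B; lra).
      assert (HrB : r <= B) by (unfold B; lra).
      assert (B1 : c ^ 2 * B ^ 2 = w * w + 2 * (c * A) * w + c ^ 2 * A * A)
        by (unfold B; rewrite <- Ev; ring).
      assert (B2 : (c ^ 2 + K) * v <= 2 * (c * A) * w).
      { replace ((c ^ 2 + K) * v) with ((c ^ 2 + K) / c * w) by (unfold v; field; lra). nra. }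
      assert (B3 : w * w + (c ^ 2 + K) * B <= c ^ 2 * B ^ 2 + K) by (rewrite B1; unfold B; nra).
      assert (B4 : r * (w * w - c ^ 2 * (B - 1)) <= (B - 1) * (w * w - K)).
      { destruct (Rle_or_lt (w * w - c ^ 2 * (B - 1)) 0); [nra|].
        assert (r * (w * w - c ^ 2 * (B - 1)) <= B * (w * w - c ^ 2 * (B - 1)))
          by (apply Rmult_le_compat_r; lra).
        nra. }
      nra. }
    unfold B in Ht. lra.
Qed.

Lemma riccati : exists A, 1 <= A /\ forall n, (1 <= n)%nat ->
  Rabs (Y n / Z n - sqrt (INR n) / c) <= A.
Proof.
  destruct (nat_above (K + 1)) as [n0 Hn0].
  (* The first two summands cover [n <= n0] through the trivial bound [0 <= Y/Z <= n]; the next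
     three are the lower bounds on [A] that [riccati_step] requires. *)
  set (A := INR n0 + sqrt (INR n0) / c + (c ^ 2 + K) / c / (2 * c) + (c ^ 2 + K) / c ^ 2
    + (K / c + 1) / c + 1).
  assert (T1 : 0 <= INR n0) by apply pos_INR.
  assert (T2 : 0 <= sqrt (INR n0) / c) by (apply Rdiv_le_0_compat; [apply sqrt_pos|lra]).
  assert (T3 : 0 <= (c ^ 2 + K) / c / (2 * c)) by (repeat apply Rdiv_le_0_compat; nra).
  assert (T4 : 0 <= (c ^ 2 + K) / c ^ 2) by (apply Rdiv_le_0_compat; nra).
  assert (T5 : 0 <= (K / c + 1) / c).
  { assert (0 <= K / c) by (apply Rdiv_le_0_compat; lra). apply Rdiv_le_0_compat; lra. }
  exists A. split; [unfold A; lra|].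
  induction n as [|n IH]; [lia|]. intros _.
  destruct (Nat.le_gt_cases (S n) n0) as [Hle|Hgt].
  - pose proof (Z_pos (S n) ltac:(lia)) as HZ. pose proof (Z_le_Y (S n)). pose proof (Y_le_Z (S n)).
    assert (0 <= Y (S n) / Z (S n) <= INR (S n)).
    { split; [apply Rdiv_le_0_compat; lra|]. apply (Rmult_le_reg_r (Z (S n))); [easy|].
      replace (Y (S n) / Z (S n) * Z (S n)) with (Y (S n)) by (field; lra). lra. }
    assert (0 <= sqrt (INR (S n)) / c) by (apply Rdiv_le_0_compat; [apply sqrt_pos|lra]).
    assert (sqrt (INR (S n)) / c <= sqrt (INR n0) / c).
    { apply Rmult_le_compat_r; [left; apply Rinv_0_lt_compat; lra|]. apply sqrt_le_1_alt, le_INR, Hle. }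
    apply le_INR in Hle. apply Rabs_le. unfold A. lra.
  - assert (Hn : (n = 0 \/ 1 <= n)%nat) by lia. destruct Hn as [->|Hn].
    { assert (n0 = 0)%nat by lia. subst. simpl in Hn0. lra. }
    specialize (IH Hn). pose proof (Z_pos n Hn) as HZ.
    assert (HnR : K + 1 <= INR n) by (apply Rle_trans with (1 := Hn0), le_INR; lia).
    (* With this [E] the denominator of the Riccati map is exactly [n Z(n+1) / Z(n)]. *)
    set (E := (INR n * p n - c ^ 2 * Y n) / Z n).
    assert (HE : Rabs E <= K).
    { unfold E, Rdiv. rewrite Rabs_mult, Rabs_inv, (Rabs_right (Z n)) by lra.
      apply (Rmult_le_reg_r (Z n)); [easy|]. rewrite Rmult_assoc, Rinv_l, Rmult_1_r by lra. apply p_Y. }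
    assert (Hr : 1 <= Y n / Z n).
    { apply (Rmult_le_reg_r (Z n)); [easy|]. replace (Y n / Z n * Z n) with (Y n) by (field; lra).
      rewrite Rmult_1_l. apply Z_le_Y. }
    pose proof (p_pos n) as Hp.
    assert (Hd : INR n + E + c ^ 2 * (Y n / Z n) = INR n * (Z n + p n) / Z n)
      by (unfold E; field; lra).
    replace (Y (S n) / Z (S n)) with
      (1 + Y n / Z n * INR n / (INR n + E + c ^ 2 * (Y n / Z n))).
    + apply riccati_step; auto.
      * replace (2 * c * A) with ((2 * c) * (A - (c ^ 2 + K) / c / (2 * c)) + (c ^ 2 + K) / c)
          by (field; lra).
        assert (0 <= (2 * c) * (A - (c ^ 2 + K) / c / (2 * c))) by (apply Rmult_le_pos; unfold A; lra).
        lra.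
      * replace (c ^ 2 * A) with (c ^ 2 * (A - (c ^ 2 + K) / c ^ 2) + (c ^ 2 + K))
          by (field; lra).
        assert (0 <= c ^ 2 * (A - (c ^ 2 + K) / c ^ 2)) by (apply Rmult_le_pos; unfold A; nra).
        lra.
      * replace (c * A) with (c * (A - (K / c + 1) / c) + (K / c + 1)) by (field; lra).
        assert (0 <= c * (A - (K / c + 1) / c)) by (apply Rmult_le_pos; unfold A; lra).
        lra.
    + rewrite Hd, Y_S, Z_S. field. assert (1 <= INR n) by lra. repeat split; lra.
Qed.

(** Inverting [Y/Z = sqrt n / c + O(1)] is safe once [sqrt n >= 2 c A], where [Y/Z] is at least half
    its main term. Below that, [n] is at most [4 c^2 A^2], and the trivial bound [1 + c] goes into
    the second summand of the constant. *)
Lemma ratio_Z_Y : exists A, 0 <= A /\ forall n, (1 <= n)%nat ->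
  Rabs (Z n / Y n - c / sqrt (INR n)) <= A / INR n.
Proof.
  destruct riccati as [A [HA H]].
  exists (2 * c ^ 2 * A + (1 + c) * (4 * c ^ 2 * A ^ 2)).
  split; [assert (0 <= c ^ 2 * A) by nra; assert (0 <= c ^ 2 * A ^ 2) by nra; nra|].
  intros n Hn. specialize (H n Hn).
  pose proof (Z_pos n Hn) as HZ. pose proof (Z_le_Y n) as HZY.
  pose proof (sqrt_INR_ge1 n Hn) as Hw. pose proof (sqrt_INR_sq n) as Hw2.
  set (w := sqrt (INR n)) in *. rewrite <- Hw2. set (r := Y n / Z n) in *.
  replace (Z n / Y n) with (/ r) by (unfold r; field; lra).
  assert (Hr : 1 <= r).
  { apply (Rmult_le_reg_r (Z n)); [easy|]. unfold r. replace (Y n / Z n * Z n) with (Y n) by (field; lra). lra. }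
  clearbody r w. assert (0 <= c ^ 2 * A) by nra. assert (0 <= c ^ 2 * A ^ 2) by nra.
  assert (Hww : 0 < w * w) by nra.
  destruct (Rle_or_lt (2 * c * A) w) as [Hbig|Hsmall].
  - replace (/ r - c / w) with (c / (w * r) * (w / c - r)) by (field; lra).
    assert (Hwr : w <= 2 * c * r).
    { apply Rabs_le_between in H. assert (E : c * (w / c) = w) by (field; lra).
      assert (c * (w / c - A) <= c * r) by (apply Rmult_le_compat_l; lra). lra. }
    rewrite Rabs_mult, Rabs_minus_sym.
    assert (Hcw : 0 <= c / (w * r)) by (apply Rdiv_le_0_compat; nra).
    rewrite (Rabs_right (c / (w * r))) by lra.
    apply Rle_trans with (2 * c ^ 2 / (w * w) * A).
    + apply Rmult_le_compat; auto using Rabs_pos.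
      apply (Rmult_le_reg_r (w * w * r)); [nra|].
      replace (c / (w * r) * (w * w * r)) with (c * w) by (field; lra).
      replace (2 * c ^ 2 / (w * w) * (w * w * r)) with (c * (2 * c * r)) by (field; lra).
      apply Rmult_le_compat_l; lra.
    + unfold Rdiv. rewrite (Rmult_comm (2 * c ^ 2 * / _)), <- Rmult_assoc.
      apply Rmult_le_compat_r; [left; apply Rinv_0_lt_compat; easy|]. nra.
  - apply Rle_trans with (1 + c).
    + assert (0 < / r <= 1) by (split; [apply Rinv_0_lt_compat; lra|rewrite <- Rinv_1; apply Rinv_le_contravar; lra]).
      assert (0 <= c / w <= c).
      { split; [apply Rdiv_le_0_compat; lra|]. apply (Rmult_le_reg_r w); [lra|].
        replace (c / w * w) with c by (field; lra). nra. }
      apply Rabs_le; lra.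
    + apply (Rmult_le_reg_r (w * w)); [easy|].
      replace (_ / (w * w) * (w * w)) with (2 * c ^ 2 * A + (1 + c) * (4 * c ^ 2 * A ^ 2)) by (field; lra).
      assert (w * w <= 4 * c ^ 2 * A ^ 2) by nra.
      assert ((1 + c) * (w * w) <= (1 + c) * (4 * c ^ 2 * A ^ 2)) by (apply Rmult_le_compat_l; lra). lra.
Qed.

Lemma Y_pred n : (1 <= n)%nat -> Y (n - 1) = Y n * (1 - Z n / Y n).
Proof.
  intros H. destruct n; [lia|]. simpl. rewrite Nat.sub_0_r.
  pose proof (Y_pos (S n) H). pose proof (Y_S n). field_simplify; lra.
Qed.

(** A crude bound at half the true rate, valid for all [s <= n]. From [m >= m0] on,
    [Z m / Y m >= c / (2 sqrt m)], and [sqrt m <= sqrt n], so each step down gains at least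
    [exp (- b)]. *)
Lemma Y_decay : exists K1, 1 <= K1 /\ forall n s, (1 <= n)%nat -> (s <= n)%nat ->
  Y (n - s) <= K1 * exp (- (c / 2 / sqrt (INR n) * INR s)) * Y n.
Proof.
  destruct ratio_Z_Y as [A [HA H]].
  destruct (nat_above ((2 * A / c) ^ 2 + 1)) as [m0 Hm0].
  exists (exp (c / 2 * INR m0)). split.
  { rewrite <- exp_0. apply exp_le_mono. pose proof (pos_INR m0); nra. }
  intros n s Hn. pose proof (sqrt_INR_ge1 n Hn) as Hw. set (b := c / 2 / sqrt (INR n)).
  assert (Hb : 0 < b <= c / 2).
  { unfold b. split; [apply Rdiv_lt_0_compat; lra|]. apply (Rmult_le_reg_r (sqrt (INR n))); [lra|].
    replace (c / 2 / sqrt (INR n) * sqrt (INR n)) with (c / 2) by (field; lra). nra. }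
  intros Hs.
  (* The truncated difference is 0 until [n - s] falls below [m0]. From then on every step is
     credited [c/2 >= b], so monotonicity of [Y] alone suffices. *)
  apply Rle_trans with (exp (c / 2 * INR (m0 - (n - s)) - b * INR s) * Y n).
  2:{ apply Rmult_le_compat_r; [left; now apply Y_pos|]. rewrite <- exp_plus.
      apply exp_le_mono. assert (INR (m0 - (n - s)) <= INR m0) by (apply le_INR; lia).
      assert (c / 2 * INR (m0 - (n - s)) <= c / 2 * INR m0) by (apply Rmult_le_compat_l; lra). lra. }
  induction s as [|s IH].
  - rewrite Nat.sub_0_r. simpl INR. rewrite Rmult_0_r, Rminus_0_r.
    assert (1 <= exp (c / 2 * INR (m0 - n))).
    { rewrite <- exp_0. apply exp_le_mono. pose proof (pos_INR (m0 - n)); nra. }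
    pose proof (Y_pos n Hn). nra.
  - specialize (IH ltac:(lia)). set (m := (n - s)%nat) in *.
    assert (Hm : (1 <= m <= n)%nat) by (unfold m; lia).
    replace (n - S s)%nat with (m - 1)%nat by (unfold m; lia). rewrite S_INR.
    pose proof (Y_pos n Hn) as HYn. pose proof (Y_pos m ltac:(lia)) as HYm.
    destruct (Nat.le_gt_cases m0 m) as [Hbig|Hsmall].
    + replace (m0 - (m - 1))%nat with (m0 - (m - 1))%nat by lia.
      apply Rle_trans with (exp (- b) * Y m).
      * rewrite Y_pred by lia. rewrite Rmult_comm. apply Rmult_le_compat_r; [lra|].
        specialize (H m ltac:(lia)). apply Rabs_le_between in H.
        pose proof (sqrt_INR_ge1 m ltac:(lia)) as Hwm. pose proof (sqrt_INR_sq m) as Hwm2.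
        assert (HmR : (2 * A / c) ^ 2 + 1 <= INR m) by (apply Rle_trans with (1 := Hm0), le_INR, Hbig).
        assert (Hwn : sqrt (INR m) <= sqrt (INR n)) by (apply sqrt_le_1_alt, le_INR; lia).
        set (v := sqrt (INR m)) in *. rewrite <- Hwm2 in *.
        assert (H2A : 2 * A / c <= v) by (assert (0 <= 2 * A / c) by (apply Rdiv_le_0_compat; lra); nra).
        assert (H3 : A / (v * v) <= c / 2 / v).
        { apply (Rmult_le_reg_r (v * v * 2 / c)); [apply Rdiv_lt_0_compat; nra|].
          replace (A / (v * v) * (v * v * 2 / c)) with (2 * A / c) by (field; lra).
          replace (c / 2 / v * (v * v * 2 / c)) with v by (field; lra). easy. }
        assert (H4 : b <= c / 2 / v).
        { unfold b, Rdiv. apply Rmult_le_compat_l; [lra|]. apply Rinv_le_contravar; lra. }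
        replace (c / v) with (c / 2 / v + c / 2 / v) in H by (field; lra).
        pose proof (exp_ineq1_le (- b)). lra.
      * apply Rle_trans with (exp (- b) * (exp (c / 2 * INR (m0 - m) - b * INR s) * Y n)).
        { apply Rmult_le_compat_l; [left; apply exp_pos|easy]. }
        rewrite <- Rmult_assoc, <- exp_plus. apply Rmult_le_compat_r; [lra|].
        apply exp_le_mono.
        assert (INR (m0 - m) <= INR (m0 - (m - 1))) by (apply le_INR; lia).
        assert (c / 2 * INR (m0 - m) <= c / 2 * INR (m0 - (m - 1))) by (apply Rmult_le_compat_l; lra). lra.
    + apply Rle_trans with (Y m).
      * destruct m; [lia|]. replace (S m - 1)%nat with m by lia. apply Y_step.
      * apply Rle_trans with (1 := IH). apply Rmult_le_compat_r; [lra|]. apply exp_le_mono.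
        replace (m0 - (m - 1))%nat with (S (m0 - m)) by lia. rewrite S_INR. lra.
Qed.

(** [Y(n-s)/Y(n)] is a product of factors [1 - Z m / Y m], each equal to [exp (- c/sqrt n)] up to
    [O((1 + s/sqrt n)/n)]; the condition [2 s <= n] keeps [sqrt m] comparable to [sqrt n]. The
    defects accumulate linearly in [s], damped by [Y_decay]. The factor [exp (c/2)] in [K2] pays for
    advancing the damping by one step. *)
Lemma Y_ratio : exists K2, 0 <= K2 /\ forall n s, (1 <= n)%nat -> (2 * s <= n)%nat ->
  Rabs (Y (n - s) / Y n - exp (- (c / sqrt (INR n) * INR s))) <=
    K2 * exp (- (c / 2 / sqrt (INR n) * INR s)) * (INR s / INR n * (1 + INR s / sqrt (INR n))).
Proof.
  destruct ratio_Z_Y as [A [HA H]]. destruct Y_decay as [K1 [HK1 HY]].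
  set (K3 := 2 * A + 2 * c + c ^ 2). set (K2 := K1 * K3 * exp (c / 2)).
  assert (HK3 : 0 <= K3) by (unfold K3; nra).
  assert (HK2 : 0 <= K2) by (unfold K2; pose proof (exp_pos (c / 2)); assert (0 <= K1 * K3) by nra; nra).
  exists K2. split; [easy|]. intros n s Hn.
  pose proof (sqrt_INR_ge1 n Hn) as Hw. pose proof (sqrt_INR_sq n) as Hw2.
  pose proof (Y_pos n Hn) as HYn.
  set (w := sqrt (INR n)) in *. set (a := c / w).
  assert (Ea : c / 2 / w = a / 2) by (unfold a; field; lra). rewrite Ea.
  assert (Ha : 0 < a <= c).
  { unfold a. split; [apply Rdiv_lt_0_compat; lra|]. apply (Rmult_le_reg_r w); [lra|].
    replace (c / w * w) with c by (field; lra). nra. }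
  assert (HnR : 1 <= INR n) by (apply (le_INR 1), Hn).
  induction s as [|s IH]; intros Hs.
  - rewrite Nat.sub_0_r. simpl INR. rewrite Rmult_0_r, Ropp_0, exp_0.
    replace (Y n / Y n - 1) with 0 by (field; lra). rewrite Rabs_R0. unfold Rdiv. lra.
  - specialize (IH ltac:(lia)). set (m := (n - s)%nat) in *.
    assert (Hm : (1 <= m <= n)%nat) by (unfold m; lia).
    replace (n - S s)%nat with (m - 1)%nat by (unfold m; lia). rewrite S_INR, Y_pred by lia.
    set (Q := Y m / Y n) in *.
    assert (HQ : 0 <= Q <= K1 * exp (- (a / 2 * INR s))).
    { specialize (HY n s Hn ltac:(lia)). fold w m in HY. rewrite Ea in HY. unfold Q. split.
      - apply Rdiv_le_0_compat; [left; apply Y_pos; lia|easy].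
      - apply (Rmult_le_reg_r (Y n)); [easy|]. replace (Y m / Y n * Y n) with (Y m) by (field; lra). easy. }
    set (rho := Z m / Y m) in *.
    assert (Hrho : Rabs (1 - rho - exp (- a)) <= K3 * ((1 + INR s / w) / INR n)).
    { specialize (H m ltac:(lia)). fold rho in H.
      pose proof (sqrt_INR_ge1 m ltac:(lia)) as Hv. pose proof (sqrt_INR_sq m) as Hv2.
      assert (Hvw : sqrt (INR m) <= w) by (apply sqrt_le_1_alt, le_INR; lia).
      set (v := sqrt (INR m)) in *.
      assert (Hmn : INR m = INR n - INR s) by (unfold m; apply minus_INR; lia).
      assert (H2m : INR n <= 2 * INR m).
      { change 2 with (INR 2). rewrite <- mult_INR. apply le_INR. unfold m. lia. }
      pose proof (pos_INR s) as Hs0.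
      assert (B1 : Rabs (rho - c / v) <= 2 * A / INR n).
      { apply Rle_trans with (1 := H). unfold Rdiv.
        apply (Rmult_le_reg_r (INR m * INR n)); [nra|].
        replace (A * / INR m * (INR m * INR n)) with (A * INR n) by (field; lra).
        replace (2 * A * / INR n * (INR m * INR n)) with (A * (2 * INR m)) by (field; lra). nra. }
      assert (B2 : 0 <= c / v - a <= 2 * c * (INR s / w) / INR n).
      { unfold a. replace (c / v - c / w) with (c * (w - v) / (v * w)) by (field; lra).
        assert (E : (w - v) * (w + v) = INR s) by lra. split.
        - apply Rdiv_le_0_compat; nra.
        - apply (Rmult_le_reg_r (v * w * (w + v) * INR n)); [assert (0 < v * w) by nra; assert (0 < v * w * (w + v)) by nra; nra|].
          replace (c * (w - v) / (v * w) * (v * w * (w + v) * INR n)) with (c * ((w - v) * (w + v)) * INR n) by (field; lra).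
          replace (2 * c * (INR s / w) / INR n * (v * w * (w + v) * INR n)) with (c * INR s * (2 * (v * (w + v)))) by (field; lra).
          rewrite E. apply Rmult_le_compat_l; nra. }
      assert (B3 : 0 <= exp (- a) - (1 - a) <= c ^ 2 / INR n).
      { pose proof (exp_neg_taylor a ltac:(lra)) as [T1 T2]. split; [easy|].
        apply Rle_trans with (1 := T2). right. unfold a. rewrite <- Hw2. field. lra. }
      apply Rle_trans with (2 * A / INR n + 2 * c * (INR s / w) / INR n + c ^ 2 / INR n).
      - apply Rabs_le_between in B1. apply Rabs_le. lra.
      - assert (0 <= INR s / w) by (apply Rdiv_le_0_compat; lra).
        replace (_ + _ + _) with ((2 * A + 2 * c * (INR s / w) + c ^ 2) / INR n) by (field; lra).
        replace (K3 * ((1 + INR s / w) / INR n)) with (K3 * (1 + INR s / w) / INR n) by (field; lra).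
        apply Rmult_le_compat_r; [left; apply Rinv_0_lt_compat; lra|].
        unfold K3. assert (0 <= A * (INR s / w)) by nra. assert (0 <= c ^ 2 * (INR s / w)) by nra. nra. }
    set (e := exp (- (a * INR s))) in *. set (d := exp (- (a / 2 * INR s))) in *.
    assert (Ee : exp (- (a * (INR s + 1))) = e * exp (- a)) by (unfold e; rewrite <- exp_plus; f_equal; ring).
    assert (Ed : exp (- (a / 2 * (INR s + 1))) = d * exp (- (a / 2)))
      by (unfold d; rewrite <- exp_plus; f_equal; ring).
    rewrite Ee, Ed.
    (* The old error is multiplied by the exact factor, and the new defect by the true ratio [Q]. *)
    replace (Y m * (1 - rho) / Y n - e * exp (- a))
      with (exp (- a) * (Q - e) + Q * (1 - rho - exp (- a))) by (unfold Q; field; lra).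
    assert (Hea : 0 < exp (- a) <= exp (- (a / 2))) by (split; [apply exp_pos|apply exp_neg_le; lra]).
    assert (Heh : 1 <= exp (c / 2) * exp (- (a / 2))).
    { rewrite <- exp_plus, <- exp_0. apply exp_le_mono. lra. }
    assert (Hd : 0 < d) by apply exp_pos.
    set (h := exp (- (a / 2))) in *. set (q := exp (c / 2)) in *.
    set (y := INR s / w) in *. pose proof (pos_INR s) as Hs0.
    assert (Hy0 : 0 <= y) by (apply Rdiv_le_0_compat; lra).
    replace ((INR s + 1) / w) with (y + / w) by (unfold y; field; lra).
    assert (Hiw : 0 < / w) by (apply Rinv_0_lt_compat; lra).
    eapply Rle_trans; [apply Rabs_triang|]. rewrite !Rabs_mult.
    rewrite (Rabs_right (exp (- a))), (Rabs_right Q) by lra.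
    apply Rle_trans with (h * (K2 * d * (INR s / INR n * (1 + y))) + K1 * d * (K3 * ((1 + y) / INR n))).
    { apply Rplus_le_compat; apply Rmult_le_compat; auto using Rabs_pos; lra. }
    assert (C1 : K1 * d * (K3 * ((1 + y) / INR n)) <= K2 * d * h * ((1 + y) / INR n)).
    { unfold K2. assert (0 <= (1 + y) / INR n) by (apply Rdiv_le_0_compat; lra).
      replace (K1 * K3 * q * d * h * ((1 + y) / INR n)) with
        ((K1 * d * (K3 * ((1 + y) / INR n))) * (q * h)) by ring.
      rewrite <- (Rmult_1_r (K1 * d * _)) at 1. apply Rmult_le_compat_l; [|easy].
      apply Rmult_le_pos; [nra|]. apply Rmult_le_pos; easy. }
    apply Rle_trans with (K2 * d * h * ((INR s + 1) / INR n * (1 + y))).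
    { replace (K2 * d * h * ((INR s + 1) / INR n * (1 + y))) with
        (h * (K2 * d * (INR s / INR n * (1 + y))) + K2 * d * h * ((1 + y) / INR n)) by (field; lra). lra. }
    rewrite <- (Rmult_assoc K2 d h).
    apply Rmult_le_compat_l; [assert (0 <= K2 * d) by nra; apply Rmult_le_pos; lra|].
    apply Rmult_le_compat_l; [apply Rdiv_le_0_compat; lra|]. lra.
Qed.

(** Relative to [c^2 Y], the error in [p_Y] is at most [K Z / (c^2 Y)], which [ratio_Z_Y] makes of
    order [1/sqrt n]. *)
Lemma p_approx : exists k, 0 <= k /\ forall n, (1 <= n)%nat ->
  exists e, Rabs e <= k / sqrt (INR n) /\ p n = c ^ 2 * Y n / INR n * (1 + e).
Proof.
  destruct ratio_Z_Y as [A [HA H]].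
  exists (K * (c + A) / c ^ 2). split; [apply Rdiv_le_0_compat; nra|].
  intros n Hn. specialize (H n Hn). pose proof (p_Y n) as Hp.
  pose proof (sqrt_INR_ge1 n Hn) as Hw. pose proof (sqrt_INR_sq n) as Hw2.
  pose proof (Y_pos n Hn) as HY. set (w := sqrt (INR n)) in *.
  exists ((INR n * p n - c ^ 2 * Y n) / (c ^ 2 * Y n)). rewrite <- Hw2 in *.
  assert (Hww : w <= w * w) by nra. split.
  - assert (HcY : 0 < c ^ 2 * Y n) by (apply Rmult_lt_0_compat; nra).
    unfold Rdiv at 1. rewrite Rabs_mult, Rabs_inv, (Rabs_right (c ^ 2 * Y n)) by lra.
    apply (Rmult_le_reg_r (c ^ 2 * Y n)); [easy|]. rewrite Rmult_assoc, Rinv_l, Rmult_1_r by lra.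
    apply Rle_trans with (1 := Hp).
    replace (K * (c + A) / c ^ 2 / w * (c ^ 2 * Y n)) with (K * ((c + A) / w * Y n)) by (field; lra).
    apply Rmult_le_compat_l; [easy|]. apply Rabs_le_between in H.
    assert (HAw : A / (w * w) <= A / w).
    { apply Rmult_le_compat_l; [easy|]. apply Rinv_le_contravar; lra. }
    replace (Z n) with (Z n / Y n * Y n) by (field; lra).
    apply Rmult_le_compat_r; [lra|]. replace ((c + A) / w) with (c / w + A / w) by (field; lra). lra.
  - field. repeat split; lra.
Qed.

(** By [p_approx] the ratio of the [p] is that of the [Y] times [1 + O((1 + y)/sqrt n)], with
    [y = s/sqrt n]. The powers of [y] are absorbed by lowering the rate from [c/2] to [c/4]. *)
Lemma p_ratio_half : exists K5 n5, 0 <= K5 /\ (1 <= n5)%nat /\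
  forall n s, (n5 <= n)%nat -> (2 * s <= n)%nat ->
  Rabs (p (n - s) / p n - exp (- (c / sqrt (INR n) * INR s))) <=
    K5 / sqrt (INR n) * exp (- (c / 4 / sqrt (INR n) * INR s)).
Proof.
  destruct p_approx as [k [Hk Hp]]. destruct Y_decay as [K1 [HK1 HY]].
  destruct Y_ratio as [K2 [HK2 HQ]]. destruct (nat_above ((2 * k) ^ 2 + 1)) as [n5 Hn5].
  assert (Hc4 : 0 < c / 4) by lra.
  exists (K2 * (/ (c / 4) + 4 / (c / 4) ^ 2) + K1 * (12 * k + 6 * / (c / 4))), (S n5).
  pose proof (Rinv_0_lt_compat _ Hc4) as Hic.
  assert (Hic2 : 0 <= 4 / (c / 4) ^ 2) by (apply Rdiv_le_0_compat; nra).
  split; [apply Rplus_le_le_0_compat; apply Rmult_le_pos; lra|]. split; [lia|].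
  intros n s Hn5n Hs. assert (Hn : (1 <= n)%nat) by lia.
  specialize (HY n s Hn ltac:(lia)). specialize (HQ n s Hn Hs).
  destruct (Hp n Hn) as [e [He Ep]]. destruct (Hp (n - s)%nat ltac:(lia)) as [e' [He' Ep']].
  assert (HnR : (2 * k) ^ 2 + 1 <= INR n) by (apply Rle_trans with (1 := Hn5), le_INR; lia).
  assert (HnR1 : 1 <= INR n) by (apply (le_INR 1), Hn).
  pose proof (sqrt_INR_ge1 n Hn) as Hw. pose proof (sqrt_INR_sq n) as Hw2.
  pose proof (Y_pos n Hn) as HYn. pose proof (Y_pos (n - s) ltac:(lia)) as HYm.
  pose proof (sqrt_INR_ge1 (n - s) ltac:(lia)) as Hv. pose proof (sqrt_INR_sq (n - s)) as Hv2.
  assert (Hm : INR (n - s) = INR n - INR s) by (apply minus_INR; lia).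
  assert (H2m : 2 * INR s <= INR n).
  { change 2 with (INR 2). rewrite <- mult_INR. apply le_INR. lia. }
  pose proof (pos_INR s) as Hs0.
  set (w := sqrt (INR n)) in *. set (v := sqrt (INR (n - s))) in *.
  set (y := INR s / w). assert (Hy : 0 <= y) by (apply Rdiv_le_0_compat; lra).
  replace (c / w * INR s) with (c * y) in * by (unfold y; field; lra).
  replace (c / 2 / w * INR s) with (c / 2 * y) in * by (unfold y; field; lra).
  replace (c / 4 / w * INR s) with (c / 4 * y) in * by (unfold y; field; lra).
  fold y in HQ. replace (INR s / INR n) with (y / w) in HQ by (unfold y; rewrite <- Hw2; field; lra).
  assert (Hyw : y / w <= 1 / 2).
  { unfold y. replace (INR s / w / w) with (INR s / INR n) by (rewrite <- Hw2; field; lra).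
    apply (Rmult_le_reg_r (INR n)); [lra|]. replace (INR s / INR n * INR n) with (INR s) by (field; lra). lra. }
  set (d := exp (- (c / 4 * y))).
  assert (Ed : exp (- (c / 2 * y)) = d * d) by (unfold d; rewrite <- exp_plus; f_equal; field).
  rewrite Ed in *. assert (Hd : 0 < d) by apply exp_pos.
  assert (D1 : y * d <= / (c / 4)) by (apply le_exp_scaled; lra).
  assert (D2 : y ^ 2 * d <= 4 / (c / 4) ^ 2) by (apply sq_le_exp_scaled; lra).
  assert (D3 : d <= 1) by (unfold d; rewrite <- exp_0; apply exp_le_mono; nra).
  set (Q := Y (n - s) / Y n) in *.
  assert (HQ0 : 0 <= Q <= K1 * (d * d)).
  { unfold Q. split; [apply Rdiv_le_0_compat; lra|]. apply (Rmult_le_reg_r (Y n)); [easy|].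
    replace (Y (n - s) / Y n * Y n) with (Y (n - s)) by (field; lra). easy. }
  assert (Hkw : k / w <= 1 / 2).
  { apply (Rmult_le_reg_r w); [lra|]. replace (k / w * w) with k by (field; lra). nra. }
  assert (Hkw0 : 0 <= k / w) by (apply Rdiv_le_0_compat; lra).
  assert (Hvk : k / v <= 2 * (k / w)).
  { apply (Rmult_le_reg_r (v * w)); [nra|]. replace (k / v * (v * w)) with (k * w) by (field; lra).
    replace (2 * (k / w) * (v * w)) with (k * (2 * v)) by (field; lra).
    apply Rmult_le_compat_l; [easy|]. nra. }
  apply Rabs_le_between in He. apply Rabs_le_between in He'.
  (* [1 + g] is [n (1 + e') / ((n - s) (1 + e))]. *)
  set (g := (INR n * (e' - e) + INR s * (1 + e)) / (INR (n - s) * (1 + e))).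
  assert (Hden : 0 < INR (n - s) * (1 + e)) by (rewrite Hm; nra).
  assert (Hg : Rabs g <= (12 * k + 6 * y) / w).
  { unfold g, Rdiv at 1. rewrite Rabs_mult, Rabs_inv, (Rabs_right (INR (n - s) * (1 + e))) by lra.
    apply (Rmult_le_reg_r (INR (n - s) * (1 + e))); [easy|]. rewrite Rmult_assoc, Rinv_l, Rmult_1_r by lra.
    apply Rle_trans with ((12 * (k / w) + 6 * (y / w)) * (INR n / 4)).
    - replace (6 * (y / w)) with (6 * INR s / INR n) by (unfold y; rewrite <- Hw2; field; lra).
      replace ((12 * (k / w) + 6 * INR s / INR n) * (INR n / 4)) with (INR n * (3 * (k / w)) + 3 / 2 * INR s) by (field; lra).
      assert (INR n * Rabs (e' - e) <= INR n * (3 * (k / w))).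
      { apply Rmult_le_compat_l; [lra|]. apply Rabs_le. lra. }
      eapply Rle_trans; [apply Rabs_triang|]. rewrite !Rabs_mult.
      rewrite (Rabs_right (INR n)), (Rabs_right (INR s)), (Rabs_right (1 + e)) by lra.
      assert (INR s * (1 + e) <= INR s * (3 / 2)) by (apply Rmult_le_compat_l; lra). lra.
    - replace ((12 * k + 6 * y) / w) with (12 * (k / w) + 6 * (y / w)) by (field; lra).
      assert (0 <= y / w) by (apply Rdiv_le_0_compat; lra).
      apply Rmult_le_compat_l; [lra|]. rewrite Hm. nra. }
  assert (Epq : p (n - s) / p n = Q + Q * g).
  { rewrite Ep, Ep'. unfold g, Q. rewrite Hm. field. repeat split; try lra; nra. }
  rewrite Epq. replace (Q + Q * g - exp (- (c * y))) with ((Q - exp (- (c * y))) + Q * g) by ring.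
  eapply Rle_trans; [apply Rabs_triang|]. rewrite Rabs_mult, (Rabs_right Q) by lra.
  apply Rle_trans with (K2 * (d * d) * (y / w * (1 + y)) + K1 * (d * d) * ((12 * k + 6 * y) / w)).
  { apply Rplus_le_compat; [exact HQ|]. apply Rmult_le_compat; auto using Rabs_pos; lra. }
  replace (K2 * (d * d) * (y / w * (1 + y)) + K1 * (d * d) * ((12 * k + 6 * y) / w))
    with ((K2 * (y * d + y ^ 2 * d) + K1 * (12 * k * d + 6 * (y * d))) * (/ w * d)) by (field; lra).
  replace ((K2 * (/ (c / 4) + 4 / (c / 4) ^ 2) + K1 * (12 * k + 6 * / (c / 4))) / w * d)
    with ((K2 * (/ (c / 4) + 4 / (c / 4) ^ 2) + K1 * (12 * k + 6 * / (c / 4))) * (/ w * d)) by (unfold Rdiv; ring).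
  apply Rmult_le_compat_r.
  - apply Rmult_le_pos; [left; apply Rinv_0_lt_compat; lra|lra].
  - apply Rplus_le_compat; apply Rmult_le_compat_l; try lra.
    assert (k * d <= k * 1) by (apply Rmult_le_compat_l; lra). lra.
Qed.

Lemma p_mono m n : (m <= n)%nat -> p m <= p n.
Proof. intros H; induction H; [lra|]. pose proof (p_incr m0); lra. Qed.

(** For [2 s > n] the two terms are small separately: by monotonicity [p (n - s)] is at most [p] at
    [n - n/2], where the previous bound gives decay in [sqrt n]. The rate [c/32] leaves enough of
    this decay to produce both the factor [1/sqrt n] and the exponential in [s <= n]. *)
Theorem p_ratio : exists K6 n6, 0 <= K6 /\ (1 <= n6)%nat /\
  forall n s, (n6 <= n)%nat ->
  Rabs (shift s p n / p n - exp (- (c / sqrt (INR n) * INR s))) <=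
    K6 / sqrt (INR n) * exp (- (c / 32 / sqrt (INR n) * INR s)).
Proof.
  destruct p_ratio_half as [K5 [n5 [HK5 [Hn5 H]]]].
  assert (Hc : 0 < c / 32) by lra. pose proof (Rinv_0_lt_compat _ Hc) as Hic.
  exists ((1 + K5) * (exp (c / 8) * / (c / 32)) + / (c / 32) + K5), n5.
  assert (He8 : 0 < exp (c / 8)) by apply exp_pos.
  assert (HT : 0 <= (1 + K5) * (exp (c / 8) * / (c / 32))).
  { apply Rmult_le_pos; [lra|]. apply Rmult_le_pos; lra. }
  split; [lra|]. split; [easy|]. intros n s Hn.
  pose proof (sqrt_INR_ge1 n ltac:(lia)) as Hw. pose proof (sqrt_INR_sq n) as Hw2.
  set (w := sqrt (INR n)) in *. pose proof (pos_INR s) as Hs0.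
  assert (Hiw : 0 < / w) by (apply Rinv_0_lt_compat; lra).
  assert (Hcw : 0 < c * / w) by nra.
  destruct (Nat.le_gt_cases (2 * s) n) as [Hs|Hs].
  - rewrite shift_le by lia. eapply Rle_trans; [apply H; lia|]. fold w. unfold Rdiv.
    apply Rmult_le_compat; try (left; apply exp_pos).
    + apply Rmult_le_pos; lra.
    + apply Rmult_le_compat_r; lra.
    + apply exp_neg_le. nra.
  - assert (Hsn : INR n <= 2 * INR s).
    { change 2 with (INR 2). rewrite <- mult_INR. apply le_INR. lia. }
    assert (Hww : w <= 2 * (INR s / w)).
    { apply (Rmult_le_reg_r w); [lra|]. replace (2 * (INR s / w) * w) with (2 * INR s) by (field; lra). lra. }
    set (y := INR s / w) in *.
    replace (c / w * INR s) with (c * y) in * by (unfold y; field; lra).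
    replace (c / 32 / w * INR s) with (c / 32 * y) in * by (unfold y; field; lra).
    set (d := exp (- (c / 32 * y))). assert (Hd : 0 < d) by apply exp_pos.
    pose proof (le_exp_scaled (c / 32) w Hc) as Dw.
    assert (B1 : exp (- (c * y)) <= / (c / 32) / w * d).
    { apply Rle_trans with (exp (- (c / 32 * w)) * d).
      - unfold d. rewrite <- exp_plus. apply exp_le_mono. nra.
      - apply Rmult_le_compat_r; [lra|]. apply (Rmult_le_reg_l w); [lra|].
        replace (w * (/ (c / 32) / w)) with (/ (c / 32)) by (field; lra). easy. }
    assert (B2 : 0 <= shift s p n / p n <= (1 + K5) * (exp (c / 8) * / (c / 32)) / w * d).
    { pose proof (p_pos n) as Hpn.
      assert (B0 : 0 <= (1 + K5) * (exp (c / 8) * / (c / 32)) / w * d).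
      { apply Rmult_le_pos; [apply Rmult_le_pos; lra|lra]. }
      destruct (Nat.le_gt_cases s n) as [Hle|Hgt].
      2:{ rewrite shift_gt by easy. unfold Rdiv. rewrite Rmult_0_l. lra. }
      rewrite shift_le by easy. pose proof (p_pos (n - s)) as Hpm. split.
      { apply Rdiv_le_0_compat; lra. }
      set (t := (n / 2)%nat).
      assert (Ht : (2 * t <= n <= 2 * t + 1)%nat).
      { unfold t. pose proof (Nat.div_mod n 2 ltac:(lia)). pose proof (Nat.mod_upper_bound n 2 ltac:(lia)). lia. }
      apply Rle_trans with (p (n - t) / p n).
      { apply Rmult_le_compat_r; [left; now apply Rinv_0_lt_compat|]. apply p_mono. lia. }
      specialize (H n t Hn ltac:(lia)). fold w in H. apply Rabs_le_between in H.
      assert (Ht2 : INR n <= 2 * INR t + 1).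
      { change 2 with (INR 2). rewrite <- mult_INR, <- S_INR. apply le_INR. lia. }
      set (z := INR t / w). pose proof (pos_INR t) as Ht0.
      replace (c / w * INR t) with (c * z) in H by (unfold z; field; lra).
      replace (c / 4 / w * INR t) with (c / 4 * z) in H by (unfold z; field; lra).
      assert (Hz : 0 <= z) by (apply Rdiv_le_0_compat; lra).
      assert (Hz2 : w <= 2 * z + 1).
      { apply (Rmult_le_reg_r w); [lra|]. replace ((2 * z + 1) * w) with (2 * INR t + w) by (unfold z; field; lra). lra. }
      assert (Hyw : y <= w).
      { unfold y. apply (Rmult_le_reg_r w); [lra|]. replace (INR s / w * w) with (INR s) by (field; lra).
        rewrite Hw2. now apply le_INR. }
      apply Rle_trans with ((1 + K5) * exp (- (c / 4 * z))).
      { assert (exp (- (c * z)) <= exp (- (c / 4 * z))) by (apply exp_neg_le; nra).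
        pose proof (exp_pos (- (c / 4 * z))).
        assert (K5 / w <= K5) by (rewrite <- (Rdiv_1_r K5) at 2; apply Rmult_le_compat_l; [easy|apply Rinv_le_contravar; lra]).
        assert (K5 / w * exp (- (c / 4 * z)) <= K5 * exp (- (c / 4 * z))) by (apply Rmult_le_compat_r; lra).
        lra. }
      replace ((1 + K5) * (exp (c / 8) * / (c / 32)) / w * d)
        with ((1 + K5) * (exp (c / 8) * / (c / 32) / w * d)) by (unfold Rdiv; ring).
      apply Rmult_le_compat_l; [lra|].
      apply Rle_trans with (exp (c / 8) * exp (- (c / 32 * w)) * d).
      - unfold d. rewrite <- !exp_plus. apply exp_le_mono. nra.
      - apply Rmult_le_compat_r; [lra|]. unfold Rdiv at 3. rewrite Rmult_assoc. apply Rmult_le_compat_l; [lra|].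
        apply (Rmult_le_reg_l w); [lra|]. rewrite (Rmult_comm (/ (c / 32))), <- Rmult_assoc, Rinv_r, Rmult_1_l by lra.
        easy. }
    replace (((1 + K5) * (exp (c / 8) * / (c / 32)) + / (c / 32) + K5) / w * d) with
      ((1 + K5) * (exp (c / 8) * / (c / 32)) / w * d + / (c / 32) / w * d + K5 / w * d) by (unfold Rdiv; ring).
    assert (0 <= K5 / w * d) by (apply Rmult_le_pos; [apply Rmult_le_pos; lra|lra]).
    pose proof (exp_pos (- (c * y))). apply Rabs_le. lra.
Qed.
End Renewal.

(** * The value of zeta(2) *)

Lemma le_of_derive (f df : R -> R) a b :
  a <= b -> (forall x, a <= x <= b -> is_derive f x (df x)) ->
  (forall x, a <= x <= b -> 0 <= df x) -> f a <= f b.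
Proof.
  intros Hab Hd Hp. destruct (MVT_gen f a b df) as [x [Hx E]].
  - intros x Hx. rewrite Rmin_left, Rmax_right in Hx by lra. apply Hd; lra.
  - intros x Hx. rewrite Rmin_left, Rmax_right in Hx by lra.
    apply continuity_pt_filterlim, (ex_derive_continuous f x). exists (df x). now apply Hd.
  - rewrite Rmin_left, Rmax_right in Hx by lra. specialize (Hp x Hx). nra.
Qed.

Lemma x_cos_le_sin x : 0 <= x -> x <= PI / 2 -> x * cos x <= sin x.
Proof.
  intros H0 H1.
  assert (H : sin 0 - 0 * cos 0 <= sin x - x * cos x).
  { apply (le_of_derive (fun t => sin t - t * cos t) (fun t => t * sin t)); [easy| |].
    - intros t _. auto_derive; [easy|]. ring.
    - intros t Ht. apply Rmult_le_pos; [lra|]. apply sin_ge_0; pose proof PI_RGT_0; lra. }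
  rewrite sin_0 in H. lra.
Qed.

(** The cosecant squared is [1 + cot^2], and [x <= tan x]. *)
Lemma csc_sq_bounds x : 0 < x -> x < PI / 2 -> / x ^ 2 <= / sin x ^ 2 <= 1 + / x ^ 2.
Proof.
  intros H0 H1. pose proof PI_RGT_0.
  assert (Hs : 0 < sin x) by (apply sin_gt_0; lra).
  assert (Hc : 0 < cos x) by (apply cos_gt_0; lra).
  assert (Hsx : sin x < x) by (apply sin_lt_x; lra).
  pose proof (x_cos_le_sin x ltac:(lra) ltac:(lra)) as Ht.
  assert (E : sin x ^ 2 + cos x ^ 2 = 1) by (rewrite <- !Rsqr_pow2; apply sin2_cos2).
  split.
  - apply Rinv_le_contravar; [nra|]. apply pow_incr; lra.
  - apply (Rmult_le_reg_r (sin x ^ 2 * x ^ 2)); [apply Rmult_lt_0_compat; apply pow_lt; lra|].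
    replace (/ sin x ^ 2 * (sin x ^ 2 * x ^ 2)) with (x ^ 2) by (field; lra).
    replace ((1 + / x ^ 2) * (sin x ^ 2 * x ^ 2)) with (sin x ^ 2 * x ^ 2 + sin x ^ 2) by (field; lra).
    assert ((x * cos x) ^ 2 <= sin x ^ 2) by (apply pow_incr; nra). nra.
Qed.

(** The odd multiples of [PI/(4N)] fill [(0, PI/2)]; replacing the cosecant squared by [1/x^2] there
    yields the sum of [1/(2k+1)^2]. The choice makes doubling [N] the same as halving angles. *)
Definition csc_sum (N : nat) : R :=
  rsum N (fun k => / sin ((2 * INR k + 1) * PI / (4 * INR N)) ^ 2).

(* Halving the angle: [4 / sin^2 x = 1 / sin^2 (x/2) + 1 / sin^2 (PI/2 - x/2)]. *)
Lemma csc_sum_double N : (1 <= N)%nat -> csc_sum (2 * N) = 4 * csc_sum N.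
Proof.
  intros HN. assert (HNR : 1 <= INR N) by (apply (le_INR 1), HN). pose proof PI_RGT_0.
  unfold csc_sum. replace (2 * N)%nat with (N + N)%nat at 1 by lia. rewrite rsum_split.
  rewrite (rsum_rev N (fun i => / sin ((2 * INR (N + i) + 1) * PI / (4 * INR (2 * N))) ^ 2)).
  rewrite <- rsum_plus, <- rsum_scal. apply rsum_ext; intros k Hk.
  replace (N + (N - 1 - k))%nat with (2 * N - 1 - k)%nat by lia.
  rewrite !minus_INR, mult_INR by lia. simpl (INR 1). simpl (INR 2).
  assert (HkR : INR k + 1 <= INR N) by (rewrite <- S_INR; apply le_INR, Hk). pose proof (pos_INR k).
  set (t := (2 * INR k + 1) * PI / (4 * (2 * INR N))).
  replace ((2 * ((1 + 1) * INR N - 1 - INR k) + 1) * PI / (4 * ((1 + 1) * INR N))) with (PI / 2 - t)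
    by (unfold t; field; lra).
  replace ((2 * INR k + 1) * PI / (4 * ((1 + 1) * INR N))) with t by (unfold t; field; lra).
  replace ((2 * INR k + 1) * PI / (4 * INR N)) with (2 * t) by (unfold t; field; lra).
  rewrite sin_2a, sin_shift.
  assert (Ht : 0 < t < PI / 2).
  { unfold t. split; [apply Rdiv_lt_0_compat; nra|].
    apply (Rmult_lt_reg_r (4 * (2 * INR N))); [lra|].
    replace ((2 * INR k + 1) * PI / (4 * (2 * INR N)) * (4 * (2 * INR N))) with ((2 * INR k + 1) * PI) by (field; lra).
    nra. }
  assert (0 < sin t) by (apply sin_gt_0; lra). assert (0 < cos t) by (apply cos_gt_0; lra).
  assert (E : sin t ^ 2 + cos t ^ 2 = 1) by (rewrite <- !Rsqr_pow2; apply sin2_cos2).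
  apply (Rmult_eq_reg_r (sin t ^ 2 * cos t ^ 2)); [|apply Rmult_integral_contrapositive; split; apply pow_nonzero; lra].
  transitivity (sin t ^ 2 + cos t ^ 2); [|rewrite E]; field; lra.
Qed.

Lemma csc_sum_pow2 n : csc_sum (2 ^ n) = 2 * INR (2 ^ n) ^ 2.
Proof.
  induction n as [|n IH].
  - unfold csc_sum. simpl. rewrite Rplus_0_l. replace ((2 * 0 + 1) * PI / (4 * 1)) with (PI / 4) by field.
    rewrite sin_PI4. pose proof Rlt_sqrt2_0. pose proof (sqrt_sqrt 2 ltac:(lra)) as E.
    replace (1 / sqrt 2 * (1 / sqrt 2 * 1)) with (/ (sqrt 2 * sqrt 2)) by (field; lra). rewrite E. field.
  - rewrite Nat.pow_succ_r', csc_sum_double, IH by (apply Nat.pow_lower_bound; lia).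
    rewrite mult_INR. simpl (INR 2). ring.
Qed.

Definition inv_sq_sum (N : nat) : R := rsum N (fun k => / INR (S k) ^ 2).

Lemma inv_sq_sum_tail N M : (1 <= N <= M)%nat ->
  inv_sq_sum N <= inv_sq_sum M <= inv_sq_sum N + / INR N - / INR M.
Proof.
  intros [H1 H2]. induction H2 as [|M H2 IH]; [lra|].
  unfold inv_sq_sum in *. cbn [rsum]. rewrite S_INR.
  assert (1 <= INR M) by (apply (le_INR 1); lia).
  assert (0 < / (INR M + 1) ^ 2) by (apply Rinv_0_lt_compat, pow_lt; lra).
  assert (/ (INR M + 1) ^ 2 <= / INR M - / (INR M + 1)).
  { replace (/ INR M - / (INR M + 1)) with (/ (INR M * (INR M + 1))) by (field; lra).
    apply Rinv_le_contravar; nra. }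
  lra.
Qed.

Lemma inv_sq_sum_double N :
  inv_sq_sum (2 * N) = rsum N (fun k => / (2 * INR k + 1) ^ 2) + inv_sq_sum N / 4.
Proof.
  induction N as [|N IH]; [unfold inv_sq_sum; simpl; lra|].
  replace (2 * S N)%nat with (S (S (2 * N))) by lia. unfold inv_sq_sum in *. cbn [rsum]. rewrite IH.
  rewrite !S_INR, mult_INR. simpl (INR 2). pose proof (pos_INR N). field. split; lra.
Qed.

(** [csc_sq_bounds] costs at most 1 per term, hence [N] in all, against the exact value [2 N^2]. *)
Lemma odd_sum_bounds n :
  PI ^ 2 / 8 - PI ^ 2 / 16 / INR (2 ^ n) <= rsum (2 ^ n) (fun k => / (2 * INR k + 1) ^ 2) <= PI ^ 2 / 8.
Proof.
  pose proof (csc_sum_pow2 n) as E. set (N := (2 ^ n)%nat) in *.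
  assert (HN : (1 <= N)%nat) by (apply Nat.pow_lower_bound; lia).
  assert (HNR : 1 <= INR N) by (apply (le_INR 1), HN). clearbody N.
  pose proof PI_RGT_0 as HPI. set (S := rsum N (fun k => / (2 * INR k + 1) ^ 2)).
  set (f := 16 * INR N ^ 2 / PI ^ 2).
  assert (Hb : f * S <= csc_sum N <= INR N + f * S).
  { unfold S, f, csc_sum. rewrite <- rsum_scal.
    match goal with |- _ <= _ <= INR N + ?s => replace (INR N + s) with (rsum N (fun _ => 1) + s)
      by (rewrite rsum_const; ring) end.
    rewrite <- rsum_plus.
    split; apply rsum_le; intros k Hk; pose proof (pos_INR k);
    assert (HkR : INR k + 1 <= INR N) by (rewrite <- S_INR; apply le_INR, Hk);
    set (x := (2 * INR k + 1) * PI / (4 * INR N));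
    (assert (Hx : 0 < x < PI / 2);
     [ unfold x; split; [apply Rdiv_lt_0_compat; nra|];
       apply (Rmult_lt_reg_r (4 * INR N)); [lra|];
       replace ((2 * INR k + 1) * PI / (4 * INR N) * (4 * INR N)) with ((2 * INR k + 1) * PI) by (field; lra);
       nra |]);
    destruct (csc_sq_bounds x ltac:(lra) ltac:(lra));
    (replace (16 * INR N ^ 2 / PI ^ 2 * / (2 * INR k + 1) ^ 2) with (/ x ^ 2) by (unfold x; field; lra)); lra. }
  rewrite E in Hb. assert (Hf : 0 < f) by (unfold f; apply Rdiv_lt_0_compat; nra).
  assert (E1 : f * (PI ^ 2 / 8) = 2 * INR N ^ 2) by (unfold f; field; lra).
  assert (E2 : f * (PI ^ 2 / 16 / INR N) = INR N) by (unfold f; field; lra).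
  split; apply (Rmult_le_reg_l f); lra.
Qed.

(** The odd sums are controlled along powers of 2. There the sum to [2M] is the odd sum plus a
    quarter of the sum to [M], and nearly equals the latter, so three quarters of it is [PI^2/8] up
    to [O(1/M)]. The telescoping tail bound then reaches every [N]. *)
Theorem basel N : (1 <= N)%nat -> 0 <= PI ^ 2 / 6 - inv_sq_sum N <= / INR N.
Proof.
  intros HN.
  assert (H4 : PI ^ 2 <= 16) by (pose proof PI_RGT_0; pose proof PI_4; nra).
  assert (H : forall n, PI ^ 2 / 6 - 3 / INR (2 ^ n) <= inv_sq_sum (2 ^ n) <= PI ^ 2 / 6).
  { intros n. pose proof (odd_sum_bounds n) as Ho. pose proof (inv_sq_sum_double (2 ^ n)) as Ed.
    assert (HM : (1 <= 2 ^ n)%nat) by (apply Nat.pow_lower_bound; lia).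
    pose proof (inv_sq_sum_tail (2 ^ n) (2 * 2 ^ n) ltac:(lia)) as Ht.
    rewrite Ed in Ht. assert (HMR : 1 <= INR (2 ^ n)) by (apply (le_INR 1), HM).
    assert (0 < / INR (2 * 2 ^ n)) by (apply Rinv_0_lt_compat, lt_0_INR; lia).
    assert (Hi : 0 < / INR (2 ^ n)) by (apply Rinv_0_lt_compat; lra).
    unfold Rdiv in *. nra. }
  destruct (INR_unbounded (INR N)) as [m Hm].
  assert (Hpow : forall n, (n < 2 ^ n)%nat) by (intros; apply Nat.pow_gt_lin_r; lia).
  split.
  - destruct (inv_sq_sum_tail N (2 ^ N)) as [A _]; [specialize (Hpow N); lia|]. specialize (H N). lra.
  - apply Rnot_lt_le; intros Hlt. set (d := PI ^ 2 / 6 - inv_sq_sum N - / INR N) in *.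
    assert (Hd : 0 < d) by (unfold d; lra).
    destruct (nat_above (3 / d + INR N)) as [n Hn].
    assert (HnN : (N <= n)%nat).
    { apply INR_le. assert (0 < 3 / d) by (apply Rdiv_lt_0_compat; lra). lra. }
    specialize (Hpow n). destruct (H n) as [A _].
    destruct (inv_sq_sum_tail N (2 ^ n)) as [_ B]; [lia|].
    apply lt_INR in Hpow. assert (HnR : 1 <= INR n) by (apply (le_INR 1); lia).
    assert (0 < / INR (2 ^ n)) by (apply Rinv_0_lt_compat; lra).
    assert (3 / INR (2 ^ n) < d).
    { pose proof (pos_INR N). apply (Rmult_lt_reg_r (INR (2 ^ n) / d)); [apply Rdiv_lt_0_compat; lra|].
      replace (3 / INR (2 ^ n) * (INR (2 ^ n) / d)) with (3 / d) by (field; lra).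
      replace (d * (INR (2 ^ n) / d)) with (INR (2 ^ n)) by (field; lra). lra. }
    unfold d in *. lra.
Qed.

(** * Euler's constant and Bose sums *)

Lemma ln_le_sub1 x : 0 < x -> ln x <= x - 1.
Proof. intros H. pose proof (exp_ineq1_le (ln x)) as E. rewrite exp_ln in E by easy. lra. Qed.

Lemma ln_ge_sub1 x : 0 < x -> 1 - / x <= ln x.
Proof.
  intros H. pose proof (ln_le_sub1 (/ x) (Rinv_0_lt_compat _ H)) as E.
  rewrite ln_Rinv in E by easy. lra.
Qed.

Definition harmonic (N : nat) : R := rsum N (fun k => / INR (S k)).

Lemma harmonic_step N :
  harmonic (S (S N)) - ln (INR (S (S N))) <= harmonic (S N) - ln (INR (S N)).
Proof.
  unfold harmonic. cbn [rsum]. pose proof (lt_0_INR (S N) ltac:(lia)) as H1.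
  pose proof (lt_0_INR (S (S N)) ltac:(lia)) as H2.
  pose proof (ln_ge_sub1 (INR (S (S N)) / INR (S N)) ltac:(apply Rdiv_lt_0_compat; easy)) as E.
  unfold Rdiv in E. rewrite ln_mult, ln_Rinv in E by (auto using Rinv_0_lt_compat).
  replace (1 - / (INR (S (S N)) * / INR (S N))) with (/ INR (S (S N))) in E.
  - lra.
  - rewrite (S_INR (S N)). rewrite (S_INR (S N)) in H2. field. lra.
Qed.

Lemma ln_le_harmonic N : ln (INR (S N)) <= harmonic N.
Proof.
  induction N as [|N IH]; [simpl; rewrite ln_1; unfold harmonic; simpl; lra|].
  unfold harmonic in *. cbn [rsum]. pose proof (lt_0_INR (S N) ltac:(lia)) as H1.
  pose proof (lt_0_INR (S (S N)) ltac:(lia)) as H2.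
  pose proof (ln_le_sub1 (INR (S (S N)) / INR (S N)) ltac:(apply Rdiv_lt_0_compat; easy)) as E.
  unfold Rdiv in E. rewrite ln_mult, ln_Rinv in E by (auto using Rinv_0_lt_compat).
  replace (INR (S (S N)) * / INR (S N) - 1) with (/ INR (S N)) in E.
  - lra.
  - rewrite (S_INR (S N)). field. lra.
Qed.

Lemma harmonic_sum_n N : sum_n (fun k => / INR (S k)) N = harmonic (S N).
Proof.
  induction N as [|N IH]; [rewrite sum_O; unfold harmonic; simpl; field|].
  rewrite sum_Sn, IH. reflexivity.
Qed.

(** [real (Lim_seq _)] carries information only once convergence to a finite limit is proved: the
    sequence decreases and stays nonnegative. Its index is one behind, since [sum_n] to [N] has
    [S N] terms. *)
Lemma euler_gamma_lim : is_lim_seq (fun N => harmonic N - ln (INR N)) euler_gamma.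
Proof.
  apply is_lim_seq_incr_1.
  apply (is_lim_seq_ext (fun N => sum_n (fun k => / INR (S k)) N - ln (INR (S N)))).
  { intros N. now rewrite harmonic_sum_n. }
  unfold euler_gamma. apply Lim_seq_correct'.
  apply (ex_finite_lim_seq_decr _ 0).
  - intros N. rewrite !harmonic_sum_n. apply harmonic_step.
  - intros N. rewrite harmonic_sum_n. pose proof (ln_le_harmonic N) as E.
    unfold harmonic in *. cbn [rsum].
    assert (0 < / INR (S N)) by (apply Rinv_0_lt_compat, lt_0_INR; lia). lra.
Qed.

(** [bose u] sums [exp (- u j)] over [j >= 1]. [bose_reg] removes its pole at 0, and [bose_prim] is
    the primitive of [bose_reg] that tends to 0 at 0. *)
Definition bose (u : R) : R := / (exp u - 1).
Definition bose_reg (u : R) : R := bose u - / u.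
Definition bose_prim (u : R) : R := ln (1 - exp (- u)) - ln u.

Lemma exp_minus1_pos u : 0 < u -> u < exp u - 1.
Proof. intros H. pose proof (exp_ineq1 u ltac:(lra)). lra. Qed.

Lemma bose_pos u : 0 < u -> 0 < bose u.
Proof. intros H. pose proof (exp_minus1_pos u H). apply Rinv_0_lt_compat. lra. Qed.

Lemma bose_reg_bounds u : 0 < u -> -1 <= bose_reg u <= 0.
Proof.
  intros H. pose proof (exp_minus1_pos u H). unfold bose_reg, bose. split.
  - assert (E : exp u * (1 - u) <= 1).
    { pose proof (exp_ineq1_le (- u)). pose proof (exp_pos u).
      assert (exp u * exp (- u) = 1) by (rewrite <- exp_plus, Rplus_opp_r; apply exp_0). nra. }
    apply (Rmult_le_reg_r (u * (exp u - 1))); [nra|].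
    replace ((/ (exp u - 1) - / u) * (u * (exp u - 1))) with (u - (exp u - 1)) by (field; lra). nra.
  - assert (/ (exp u - 1) <= / u) by (apply Rinv_le_contravar; lra). lra.
Qed.

Lemma bose_prim_derive u : 0 < u -> is_derive bose_prim u (bose_reg u).
Proof.
  intros H. assert (He : exp (- u) < 1) by (rewrite <- exp_0; apply exp_increasing; lra).
  pose proof (exp_minus1_pos u H). pose proof (exp_pos (- u)).
  unfold bose_prim. auto_derive; [lra|].
  unfold bose_reg, bose. assert (E : exp u = / exp (- u)) by (rewrite exp_Ropp; field; apply Rgt_not_eq, exp_pos).
  rewrite E in *. field. repeat split; try lra.
Qed.

Lemma sinh_ge t : 0 <= t -> 2 * t <= exp t - exp (- t).
Proof.
  intros Ht.
  assert (H : exp 0 - exp (- 0) - 2 * 0 <= exp t - exp (- t) - 2 * t).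
  { apply (le_of_derive (fun t => exp t - exp (- t) - 2 * t) (fun t => exp t + exp (- t) - 2)); [easy| |].
    - intros x _. auto_derive; [easy|]. ring.
    - intros x _. assert (E : exp x * exp (- x) = 1) by (rewrite <- exp_plus, Rplus_opp_r; apply exp_0).
      pose proof (exp_pos x). pose proof (exp_pos (- x)). pose proof (pow2_ge_0 (exp x - exp (- x))). nra. }
  rewrite Ropp_0, exp_0 in H. lra.
Qed.

(** The derivative is nonnegative exactly when [u <= 2 sinh (u/2)]. *)
Lemma bose_reg_incr x y : 0 < x -> x <= y -> bose_reg x <= bose_reg y.
Proof.
  intros Hx Hxy.
  apply (le_of_derive bose_reg (fun u => / u ^ 2 - exp u / (exp u - 1) ^ 2)); [easy| |].
  - intros u Hu. pose proof (exp_minus1_pos u ltac:(lra)). unfold bose_reg, bose.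
    auto_derive; [lra|]. field. lra.
  - intros u Hu. pose proof (exp_minus1_pos u ltac:(lra)) as He.
    assert (E : u ^ 2 * exp u <= (exp u - 1) ^ 2).
    { pose proof (sinh_ge (u / 2) ltac:(lra)) as Hs.
      assert (E1 : exp u = exp (u / 2) * exp (u / 2)) by (rewrite <- exp_plus; f_equal; field).
      assert (E2 : exp (u / 2) * exp (- (u / 2)) = 1) by (rewrite <- exp_plus, Rplus_opp_r; apply exp_0).
      pose proof (exp_pos (u / 2)). set (g := exp (u / 2)) in *.
      replace (exp u - 1) with (g * (g - exp (- (u / 2)))) by (rewrite E1; lra). rewrite E1.
      replace (u ^ 2 * (g * g)) with ((g * (2 * (u / 2))) ^ 2) by field. apply pow_incr. nra. }
    apply (Rmult_le_reg_r (u ^ 2 * (exp u - 1) ^ 2)); [apply Rmult_lt_0_compat; apply pow_lt; lra|].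
    replace ((/ u ^ 2 - exp u / (exp u - 1) ^ 2) * (u ^ 2 * (exp u - 1) ^ 2))
      with ((exp u - 1) ^ 2 - u ^ 2 * exp u) by (field; lra). lra.
Qed.

Lemma bose_prim_diff x y : 0 < x -> x <= y ->
  bose_reg x * (y - x) <= bose_prim y - bose_prim x <= bose_reg y * (y - x).
Proof.
  intros Hx Hxy. destruct (MVT_gen bose_prim x y bose_reg) as [u [Hu E]].
  - intros u Hu. rewrite Rmin_left, Rmax_right in Hu by lra. apply bose_prim_derive; lra.
  - intros u Hu. rewrite Rmin_left, Rmax_right in Hu by lra.
    apply continuity_pt_filterlim, (ex_derive_continuous bose_prim u).
    exists (bose_reg u). apply bose_prim_derive; lra.
  - rewrite Rmin_left, Rmax_right in Hu by lra. rewrite E.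
    split; apply Rmult_le_compat_r; try lra; apply bose_reg_incr; lra.
Qed.

Lemma bose_prim_small a : 0 < a -> - a <= bose_prim a <= 0.
Proof.
  intros H. unfold bose_prim. assert (He : exp (- a) < 1) by (rewrite <- exp_0; apply exp_increasing; lra).
  split.
  - assert (E : ln (a * exp (- a)) <= ln (1 - exp (- a))).
    { apply ln_le; [apply Rmult_lt_0_compat; [easy|apply exp_pos]|].
      pose proof (exp_minus1_pos a H). pose proof (exp_pos (- a)).
      assert (exp a * exp (- a) = 1) by (rewrite <- exp_plus, Rplus_opp_r; apply exp_0). nra. }
    rewrite ln_mult, ln_exp in E by (auto using exp_pos). lra.
  - assert (ln (1 - exp (- a)) <= ln a); [|lra]. apply ln_le; [lra|].
    pose proof (exp_ineq1_le (- a)). lra.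
Qed.

(* Monotonicity of [bose_reg] makes its Riemann sum telescope against [bose_prim]. *)
Lemma bose_reg_sum a M : 0 < a -> (1 <= M)%nat ->
  Rabs (a * rsum M (fun k => bose_reg (a * INR (S k))) - bose_prim (a * INR M)) <= a.
Proof.
  intros Ha HM. pose proof (bose_prim_small a Ha) as H0. pose proof (bose_reg_bounds a Ha) as Hq.
  assert (H : - a + bose_prim (a * INR M) <= a * rsum M (fun k => bose_reg (a * INR (S k)))
    <= bose_prim (a * INR (S M)) - bose_prim a).
  { induction HM as [|M HM IH].
    - simpl. rewrite Rplus_0_l, Rmult_1_r.
      pose proof (bose_prim_diff a (a * (1 + 1)) Ha ltac:(nra)). nra.
    - cbn [rsum]. rewrite Rmult_plus_distr_l.
      assert (0 < INR M) by (apply lt_0_INR; lia).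
      pose proof (bose_prim_diff (a * INR M) (a * INR (S M)) ltac:(nra) ltac:(rewrite S_INR; nra)) as D1.
      pose proof (bose_prim_diff (a * INR (S M)) (a * INR (S (S M))) ltac:(rewrite S_INR; nra) ltac:(rewrite !S_INR; nra)) as D2.
      replace (a * INR (S M) - a * INR M) with a in D1 by (rewrite S_INR; ring).
      replace (a * INR (S (S M)) - a * INR (S M)) with a in D2 by (rewrite !S_INR; ring). lra. }
  assert (HMR : 1 <= INR M) by (apply (le_INR 1), HM).
  pose proof (bose_prim_diff (a * INR M) (a * INR (S M)) ltac:(nra) ltac:(rewrite S_INR; nra)) as D1.
  replace (a * INR (S M) - a * INR M) with a in D1 by (rewrite S_INR; ring).
  pose proof (bose_reg_bounds (a * INR (S M)) ltac:(rewrite S_INR; nra)).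
  apply Rabs_le. nra.
Qed.

(** [a] times the sum is the [bose_reg] part, about [- ln (a M)], plus [harmonic M], about
    [ln M + gamma]; [ln M] cancels. Three errors of size [a] (the Riemann sum, the convergence to
    [gamma], and [ln (1 - exp (- a M))]) become 3 after division by [a], uniformly in [a]. *)
Lemma bose_sum_lim a : 0 < a -> exists M0, forall M, (M0 <= M)%nat ->
  Rabs (rsum M (fun k => bose (a * INR (S k))) - (euler_gamma - ln a) / a) <= 3.
Proof.
  intros Ha. destruct (proj2 (is_lim_seq_spec _ _) euler_gamma_lim (mkposreal a Ha)) as [M1 H1].
  (* For [x <= 1/2], [ln (1 - x) >= - 2 x]; with [x <= a/2] this is at least [- a]. *)
  simpl in H1. set (d := Rmin (1 / 2) (a / 2)).
  assert (Hd : 0 < d) by (unfold d; apply Rmin_glb_lt; lra).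
  destruct (nat_above (/ (a * d))) as [M2 H2].
  exists (S (M1 + M2)). intros M HM. specialize (H1 M ltac:(lia)).
  assert (HMR : 1 <= INR M) by (apply (le_INR 1); lia).
  pose proof (bose_reg_sum a M Ha ltac:(lia)) as H3.
  replace (rsum M (fun k => bose (a * INR (S k)))) with
    (rsum M (fun k => bose_reg (a * INR (S k))) + / a * harmonic M).
  2:{ unfold harmonic. rewrite <- rsum_scal, <- rsum_plus. apply rsum_ext; intros k _.
      unfold bose_reg. pose proof (lt_0_INR (S k) ltac:(lia)). rewrite Rinv_mult. ring. }
  assert (He : exp (- (a * INR M)) <= d).
  { pose proof (le_exp_scaled a (INR M) Ha) as E.
    assert (/ (a * d) <= INR M) by (apply Rle_trans with (1 := H2), le_INR; lia).
    assert (E2 : / a <= d * INR M).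
    { replace (/ a) with (d * / (a * d)) by (field; lra). apply Rmult_le_compat_l; lra. }
    apply (Rmult_le_reg_l (INR M)); lra. }
  assert (Hd1 : d <= 1 / 2) by apply Rmin_l. assert (Hd2 : d <= a / 2) by apply Rmin_r.
  pose proof (exp_pos (- (a * INR M))) as Hep.
  unfold bose_prim in H3. rewrite ln_mult in H3 by lra.
  set (x := exp (- (a * INR M))) in *.
  assert (Hl : - a <= ln (1 - x) <= 0).
  { pose proof (ln_ge_sub1 (1 - x) ltac:(lra)) as L1. pose proof (ln_le_sub1 (1 - x) ltac:(lra)) as L2.
    split; [|lra]. assert (/ (1 - x) <= 1 + 2 * x); [|lra].
    apply (Rmult_le_reg_r (1 - x)); [lra|]. rewrite Rinv_l by lra. nra. }
  apply Rabs_lt_between in H1. apply Rabs_le_between in H3.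
  set (s := rsum M _) in *.
  replace (s + / a * harmonic M - (euler_gamma - ln a) / a) with
    (/ a * (a * s + harmonic M - euler_gamma + ln a)) by (field; lra).
  rewrite Rabs_mult, (Rabs_right (/ a)) by (left; now apply Rinv_0_lt_compat).
  apply (Rmult_le_reg_l a); [easy|]. rewrite <- Rmult_assoc, Rinv_r, Rmult_1_l by lra.
  apply Rabs_le. lra.
Qed.

Lemma bose_sum_le a M : 0 < a ->
  rsum M (fun k => bose (a * INR (S k))) <= (euler_gamma - ln a) / a + 3.
Proof.
  intros Ha. destruct (bose_sum_lim a Ha) as [M0 H].
  apply Rle_trans with (rsum (M + M0) (fun k => bose (a * INR (S k)))).
  - apply rsum_le_extend; [lia|]. intros k. left. apply bose_pos.
    apply Rmult_lt_0_compat; [easy|apply lt_0_INR; lia].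
  - specialize (H (M + M0)%nat ltac:(lia)). apply Rabs_le_between in H. lra.
Qed.

(* Abel summation: bounded partial sums against the monotone bounded [bose_reg]. *)
Lemma bose_reg_abel a g B M : 0 < a ->
  (forall N, Rabs (rsum N g) <= B) ->
  Rabs (rsum M (fun k => g k * bose_reg (a * INR (S k)))) <= 2 * B.
Proof.
  intros Ha Hg. set (q := fun k => bose_reg (a * INR (S k))).
  assert (Hpos : forall k, 0 < a * INR (S k)) by (intros; apply Rmult_lt_0_compat; [easy|apply lt_0_INR; lia]).
  assert (HB : 0 <= B) by (apply Rle_trans with (2 := Hg O), Rabs_pos).
  assert (Hq : forall k, -1 <= q k <= 0) by (intros; apply bose_reg_bounds, Hpos).
  assert (Hm : forall k, 0 <= q (S k) - q k).
  { intros k. assert (q k <= q (S k)); [|lra]. apply bose_reg_incr; [apply Hpos|].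
    apply Rmult_le_compat_l; [lra|]. apply le_INR; lia. }
  assert (E : forall N, rsum N (fun k => g k * q k) =
    rsum N g * q N - rsum N (fun k => rsum (S k) g * (q (S k) - q k))).
  { induction N as [|N IH]; cbn [rsum] in *; [ring|]. rewrite IH. ring. }
  fold q. change (fun k => g k * bose_reg (a * INR (S k))) with (fun k => g k * q k). rewrite E.
  assert (H1 : Rabs (rsum M g * q M) <= B * 1).
  { rewrite Rabs_mult. apply Rmult_le_compat; auto using Rabs_pos. apply Rabs_le. specialize (Hq M). lra. }
  assert (H2 : Rabs (rsum M (fun k => rsum (S k) g * (q (S k) - q k))) <= B * (q M - q O)).
  { rewrite <- (rsum_telescope M q), <- rsum_scal. apply rsum_abs; intros k _.
    rewrite Rabs_mult, (Rabs_right (q (S k) - q k)) by (apply Rle_ge, Hm).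
    apply Rmult_le_compat_r; auto. }
  assert (H3 : B * (q M - q O) <= B * 1) by (apply Rmult_le_compat_l; [easy|]; pose proof (Hq M); pose proof (Hq O); lra).
  unfold Rminus at 1. eapply Rle_trans; [apply Rabs_triang|]. rewrite Rabs_Ropp. lra.
Qed.

(** * Trigonometric series *)

Definition cos_sum (M : nat) (t : R) : R := rsum M (fun k => cos (INR (S k) * t) / INR (S k)).
Definition sin_sum (M : nat) (t : R) : R := rsum M (fun k => sin (INR (S k) * t) / INR (S k)).

Lemma dirichlet_cos M t :
  2 * sin (t / 2) * rsum M (fun k => cos (INR (S k) * t)) = sin ((INR M + / 2) * t) - sin (t / 2).
Proof.
  induction M as [|M IH].
  - simpl. replace ((0 + / 2) * t) with (t / 2) by field. ring.
  - cbn [rsum]. rewrite Rmult_plus_distr_l, IH, S_INR.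
    replace ((INR M + 1 + / 2) * t) with ((INR M + 1) * t + t / 2) by field.
    replace ((INR M + / 2) * t) with ((INR M + 1) * t - t / 2) by field.
    rewrite sin_plus, sin_minus. ring.
Qed.

Lemma dirichlet_sin M t :
  2 * sin (t / 2) * rsum M (fun k => sin (INR (S k) * t)) = cos (t / 2) - cos ((INR M + / 2) * t).
Proof.
  induction M as [|M IH].
  - simpl. replace ((0 + / 2) * t) with (t / 2) by field. ring.
  - cbn [rsum]. rewrite Rmult_plus_distr_l, IH, S_INR.
    replace ((INR M + 1 + / 2) * t) with ((INR M + 1) * t + t / 2) by field.
    replace ((INR M + / 2) * t) with ((INR M + 1) * t - t / 2) by field.
    rewrite cos_plus, cos_minus. ring.
Qed.

Lemma is_derive_rsum M (f : nat -> R -> R) (df : nat -> R) (t : R) :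
  (forall k, is_derive (f k) t (df k)) ->
  is_derive (fun t => rsum M (fun k => f k t)) t (rsum M df).
Proof.
  intros H. induction M as [|M IH]; cbn [rsum]; [exact (is_derive_const 0 t)|].
  apply (is_derive_plus (fun t => rsum M (fun k => f k t)) (f M)); auto.
Qed.

Lemma sin_sum_derive M t : is_derive (sin_sum M) t (rsum M (fun k => cos (INR (S k) * t))).
Proof.
  apply (is_derive_rsum M (fun k t => sin (INR (S k) * t) / INR (S k))). intros k.
  pose proof (lt_0_INR (S k) ltac:(lia)). set (x := INR (S k)) in *. clearbody x.
  auto_derive; [easy|]. field; lra.
Qed.

Lemma cos_sum_derive M t : is_derive (cos_sum M) t (- rsum M (fun k => sin (INR (S k) * t))).
Proof.
  rewrite <- (Rmult_1_l (rsum M _)), Ropp_mult_distr_l, <- rsum_scal.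
  apply (is_derive_rsum M (fun k t => cos (INR (S k) * t) / INR (S k))). intros k.
  pose proof (lt_0_INR (S k) ltac:(lia)). set (x := INR (S k)) in *. clearbody x.
  auto_derive; [easy|]. field; lra.
Qed.

Lemma lipschitz_between (f df : R -> R) a b B :
  (forall x, Rmin a b <= x <= Rmax a b -> is_derive f x (df x) /\ Rabs (df x) <= B) ->
  Rabs (f b - f a) <= B * Rabs (b - a).
Proof.
  intros H. destruct (MVT_gen f a b df) as [x [Hx E]].
  - intros x Hx. apply H. lra.
  - intros x Hx. apply continuity_pt_filterlim, (ex_derive_continuous f x). exists (df x). now apply H.
  - rewrite E, Rabs_mult. apply Rmult_le_compat_r; [apply Rabs_pos|]. now apply H.
Qed.

Lemma sin_half_ge th x : 0 < th < 2 * PI -> Rmin th PI <= x <= Rmax th PI ->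
  0 < sin (th / 2) <= sin (x / 2).
Proof.
  intros H Hx. split; [apply sin_gt_0; lra|].
  destruct (Rle_or_lt th PI).
  - rewrite Rmin_left, Rmax_right in Hx by lra. apply sin_incr_1; lra.
  - rewrite Rmin_right, Rmax_left in Hx by lra. apply sin_decr_1; lra.
Qed.

Section Trig.
Variable th : R.
Hypothesis Hth : 0 < th < 2 * PI.
Let s0 := sin (th / 2).

Lemma inv_sin_sq_bound N a b x : 0 < N -> Rabs a <= 1 -> Rabs b <= 1 -> s0 <= x ->
  Rabs (a * b / (4 * N * x ^ 2)) <= / (4 * N * s0 ^ 2).
Proof.
  intros HN Ha Hb Hx. assert (Hs : 0 < s0) by (apply sin_gt_0; lra).
  assert (0 < s0 ^ 2) by (apply pow_lt; easy).
  assert (s0 ^ 2 <= x ^ 2) by (apply pow_incr; lra).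
  unfold Rdiv. rewrite !Rabs_mult, (Rabs_right (/ _)) by (left; apply Rinv_0_lt_compat; nra).
  rewrite <- (Rmult_1_l (/ (4 * N * s0 ^ 2))).
  apply Rmult_le_compat; [apply Rmult_le_pos; apply Rabs_pos|left; apply Rinv_0_lt_compat; nra| |].
  - rewrite <- (Rmult_1_l 1). apply Rmult_le_compat; auto using Rabs_pos.
  - apply Rinv_le_contravar; nra.
Qed.

Lemma Rabs_cos_le x : Rabs (cos x) <= 1.
Proof. apply Rabs_le, COS_bound. Qed.

Lemma Rabs_sin_le x : Rabs (sin x) <= 1.
Proof. apply Rabs_le, SIN_bound. Qed.

(** The derivative of [sin_sum] is a Dirichlet kernel, whose oscillating part
    [sin (N t) / (2 sin (t/2))] is not small. The corrector [cos (N t) / (2 N sin (t/2))] cancels it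
    and leaves a derivative [O(1/N)]. Comparison with [PI] stays away from the singularities at 0
    and [2 PI]. *)
Lemma sin_sum_diff M (N := INR M + / 2) :
  Rabs ((sin_sum M PI + PI / 2 + cos (N * PI) / (2 * N * sin (PI / 2))) -
        (sin_sum M th + th / 2 + cos (N * th) / (2 * N * sin (th / 2)))) <=
  / (4 * N * s0 ^ 2) * Rabs (PI - th).
Proof.
  assert (HN : 0 < N) by (unfold N; pose proof (pos_INR M); lra).
  apply (lipschitz_between (fun t => sin_sum M t + t / 2 + cos (N * t) / (2 * N * sin (t / 2)))
    (fun t => - (cos (N * t) * cos (t / 2) / (4 * N * sin (t / 2) ^ 2)))).
  intros t Ht. destruct (sin_half_ge th t Hth Ht) as [H1 H2]. fold s0 in H1, H2. split.
  - assert (E : is_derive (fun t => t / 2 + cos (N * t) / (2 * N * sin (t / 2))) t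
      (/ 2 - sin (N * t) / (2 * sin (t / 2)) - cos (N * t) * cos (t / 2) / (4 * N * sin (t / 2) ^ 2))).
    { auto_derive; [apply Rmult_integral_contrapositive; split; lra|]. change (t * / 2) with (t / 2). field. lra. }
    pose proof (is_derive_plus (sin_sum M) _ t _ _ (sin_sum_derive M t) E) as D.
    apply (is_derive_ext (fun t => plus (sin_sum M t) (t / 2 + cos (N * t) / (2 * N * sin (t / 2))))).
    { intros u. unfold plus; simpl. ring. }
    replace (- (cos (N * t) * cos (t / 2) / (4 * N * sin (t / 2) ^ 2))) with
      (plus (rsum M (fun k => cos (INR (S k) * t))) (/ 2 - sin (N * t) / (2 * sin (t / 2)) - cos (N * t) * cos (t / 2) / (4 * N * sin (t / 2) ^ 2))); [exact D|].
    lazymatch goal with |- @plus _ ?a ?b = ?r => change (a + b = r) end.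
    pose proof (dirichlet_cos M t) as Dc. fold N in Dc.
    replace (rsum M _) with ((sin (N * t) - sin (t / 2)) / (2 * sin (t / 2)));
      [|rewrite <- Dc; field; lra].
    field. lra.
  - rewrite Rabs_Ropp. apply inv_sin_sq_bound; auto using Rabs_cos_le.
Qed.

(** The same device, with [ln (2 sin (t/2))] balancing the non-oscillating part. The value at [PI]
    is now an alternating harmonic sum. *)
Lemma cos_sum_diff M (N := INR M + / 2) :
  Rabs ((cos_sum M PI + ln (2 * sin (PI / 2)) - sin (N * PI) / (2 * N * sin (PI / 2))) -
        (cos_sum M th + ln (2 * sin (th / 2)) - sin (N * th) / (2 * N * sin (th / 2)))) <=
  / (4 * N * s0 ^ 2) * Rabs (PI - th).
Proof.
  assert (HN : 0 < N) by (unfold N; pose proof (pos_INR M); lra).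
  apply (lipschitz_between (fun t => cos_sum M t + ln (2 * sin (t / 2)) - sin (N * t) / (2 * N * sin (t / 2)))
    (fun t => sin (N * t) * cos (t / 2) / (4 * N * sin (t / 2) ^ 2))).
  intros t Ht. destruct (sin_half_ge th t Hth Ht) as [H1 H2]. fold s0 in H1, H2. split.
  - assert (E : is_derive (fun t => ln (2 * sin (t / 2)) - sin (N * t) / (2 * N * sin (t / 2))) t
      (cos (t / 2) / (2 * sin (t / 2)) - cos (N * t) / (2 * sin (t / 2))
        + sin (N * t) * cos (t / 2) / (4 * N * sin (t / 2) ^ 2))).
    { auto_derive; [repeat split; try lra; apply Rmult_integral_contrapositive; split; lra|]. change (t * / 2) with (t / 2). field. lra. }
    pose proof (is_derive_plus (cos_sum M) _ t _ _ (cos_sum_derive M t) E) as D.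
    apply (is_derive_ext (fun t => plus (cos_sum M t) (ln (2 * sin (t / 2)) - sin (N * t) / (2 * N * sin (t / 2))))).
    { intros u. unfold plus; simpl. ring. }
    match type of D with is_derive _ _ ?d => replace (sin (N * t) * cos (t / 2) / (4 * N * sin (t / 2) ^ 2)) with d;
      [exact D|] end.
    lazymatch goal with |- @plus _ ?a ?b = ?r => change (a + b = r) end.
    pose proof (dirichlet_sin M t) as Dc. fold N in Dc.
    replace (rsum M _) with ((cos (t / 2) - cos (N * t)) / (2 * sin (t / 2)));
      [|rewrite <- Dc; field; lra].
    field. lra.
  - apply inv_sin_sq_bound; auto using Rabs_cos_le, Rabs_sin_le.
Qed.

(** Collects, up to the factor [1/N], the Lipschitz bound and the correctors at [PI] and at [th]. *)
Let B := / (4 * s0 ^ 2) * Rabs (PI - th) + / 2 + / (2 * s0).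

Lemma half_quot_bound N a x : 0 < N -> Rabs a <= 1 -> 0 < x -> Rabs (a / (2 * N * x)) <= / (2 * x) / N.
Proof.
  intros HN Ha Hx. assert (0 < 2 * N * x) by (apply Rmult_lt_0_compat; lra).
  unfold Rdiv. rewrite Rabs_mult, (Rabs_right (/ _)) by (left; apply Rinv_0_lt_compat; lra).
  replace (/ (2 * x) * / N) with (1 * / (2 * N * x)) by (field; lra).
  apply Rmult_le_compat_r; [left; apply Rinv_0_lt_compat; lra|easy].
Qed.

Lemma sin_sum_PI M : sin_sum M PI = 0.
Proof.
  apply rsum_0; intros k _. assert (E : sin (INR (S k) * PI) = 0).
  { apply sin_eq_0_1. exists (Z.of_nat (S k)). now rewrite INR_IZR_INZ. }
  rewrite E. unfold Rdiv. ring.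
Qed.

Lemma sin_sum_bound M : Rabs (sin_sum M th - (PI - th) / 2) <= B / (INR M + / 2).
Proof.
  pose proof (sin_sum_diff M) as H. cbv zeta in H. set (N := INR M + / 2) in *.
  assert (HN : 0 < N) by (unfold N; pose proof (pos_INR M); lra).
  assert (Hs : 0 < s0) by (apply sin_gt_0; lra).
  pose proof (half_quot_bound N (cos (N * PI)) (sin (PI / 2)) HN (Rabs_cos_le _) ltac:(rewrite sin_PI2; lra)) as H1.
  pose proof (half_quot_bound N (cos (N * th)) s0 HN (Rabs_cos_le _) Hs) as H2.
  unfold s0 in H2 at 1. rewrite sin_sum_PI in H. rewrite sin_PI2 in *. unfold B.
  replace (_ / N) with (/ (4 * N * s0 ^ 2) * Rabs (PI - th) + / (2 * 1) / N + / (2 * s0) / N) by (field; lra).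
  apply Rabs_le_between in H, H1, H2. apply Rabs_le. lra.
Qed.

Lemma cos_sum_bound M :
  Rabs (cos_sum M th + ln (2 * sin (th / 2)) - (cos_sum M PI + ln 2)) <= B / (INR M + / 2).
Proof.
  pose proof (cos_sum_diff M) as H. cbv zeta in H. set (N := INR M + / 2) in *.
  assert (HN : 0 < N) by (unfold N; pose proof (pos_INR M); lra).
  assert (Hs : 0 < s0) by (apply sin_gt_0; lra).
  pose proof (half_quot_bound N (sin (N * PI)) (sin (PI / 2)) HN (Rabs_sin_le _) ltac:(rewrite sin_PI2; lra)) as H1.
  pose proof (half_quot_bound N (sin (N * th)) s0 HN (Rabs_sin_le _) Hs) as H2.
  unfold s0 in H2 at 1. rewrite sin_PI2 in *. rewrite (Rmult_1_r 2) in *. unfold B.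
  replace (_ / N) with (/ (4 * N * s0 ^ 2) * Rabs (PI - th) + / 2 / N + / (2 * s0) / N) by (field; lra).
  apply Rabs_le_between in H, H1, H2. apply Rabs_le. lra.
Qed.

Lemma cos_sum_PI_even N : cos_sum (2 * N) PI = harmonic N - harmonic (2 * N).
Proof.
  induction N as [|N IH]; [unfold cos_sum, harmonic; simpl; ring|].
  replace (2 * S N)%nat with (S (S (2 * N))) by lia.
  unfold cos_sum, harmonic in *. cbn [rsum]. rewrite IH.
  assert (E1 : cos (INR (S (2 * N)) * PI) = -1).
  { rewrite S_INR, mult_INR. simpl (INR 2).
    replace (((1 + 1) * INR N + 1) * PI) with (PI + 2 * INR N * PI) by ring.
    rewrite cos_period. apply cos_PI. }
  assert (E2 : cos (INR (S (S (2 * N))) * PI) = 1).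
  { rewrite !S_INR, mult_INR. simpl (INR 2).
    replace (((1 + 1) * INR N + 1 + 1) * PI) with (0 + 2 * INR (S N) * PI) by (rewrite S_INR; ring).
    rewrite cos_period. apply cos_0. }
  rewrite E1, E2. rewrite !S_INR, mult_INR. simpl (INR 2). pose proof (pos_INR N). field. lra.
Qed.

Lemma lim_seq_bound_half (u : nat -> R) l K :
  (forall M, Rabs (u M - l) <= K / (INR M + / 2)) -> is_lim_seq u l.
Proof.
  intros H. apply is_lim_seq_spec. intros eps. pose proof (cond_pos eps) as He.
  destruct (nat_above (K / eps)) as [M0 HM]. exists M0. intros M HMM.
  apply le_INR in HMM. pose proof (pos_INR M0). apply Rle_lt_trans with (1 := H M).
  apply (Rmult_lt_reg_r ((INR M + / 2) / eps)); [apply Rdiv_lt_0_compat; lra|].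
  replace (K / (INR M + / 2) * ((INR M + / 2) / eps)) with (K / eps) by (field; lra).
  replace (eps * ((INR M + / 2) / eps)) with (INR M + / 2) by (field; lra). lra.
Qed.

Lemma is_lim_seq_double u l : is_lim_seq u l -> is_lim_seq (fun N => u (2 * N)%nat) l.
Proof.
  intros H. apply (is_lim_seq_subseq u l (fun N => (2 * N)%nat)); auto.
  apply eventually_subseq. intros n; lia.
Qed.

(* Even cutoffs suffice for the final estimate and spare the odd case here. *)
Lemma cos_sum_PI_lim : is_lim_seq (fun N => cos_sum (2 * N) PI) (- ln 2).
Proof.
  apply (is_lim_seq_ext_loc (fun N => (harmonic N - ln (INR N)) -
    (harmonic (2 * N) - ln (INR (2 * N))) - ln 2)).
  - exists 1%nat. intros N HN. rewrite cos_sum_PI_even, mult_INR, ln_mult by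
      (try apply lt_0_INR; simpl; try lra; lia). simpl (INR 2). replace (1 + 1) with 2 by ring. ring.
  - replace (- ln 2) with (euler_gamma - euler_gamma - ln 2) by ring.
    apply is_lim_seq_minus'; [|apply is_lim_seq_const].
    apply is_lim_seq_minus'; [apply euler_gamma_lim|].
    apply (is_lim_seq_double (fun N => harmonic N - ln (INR N))), euler_gamma_lim.
Qed.

Lemma sin_sum_lim : is_lim_seq (fun N => sin_sum (2 * N) th) ((PI - th) / 2).
Proof.
  apply (is_lim_seq_double (fun N => sin_sum N th)), (lim_seq_bound_half _ _ B). apply sin_sum_bound.
Qed.

Lemma cos_sum_lim : is_lim_seq (fun N => cos_sum (2 * N) th) (- ln (2 * sin (th / 2))).
Proof.
  apply (is_lim_seq_ext (fun N => (cos_sum (2 * N) th + ln (2 * sin (th / 2)) - (cos_sum (2 * N) PI + ln 2))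
    + cos_sum (2 * N) PI + (ln 2 - ln (2 * sin (th / 2))))); [intros; ring|].
  replace (- ln (2 * sin (th / 2))) with (0 + - ln 2 + (ln 2 - ln (2 * sin (th / 2)))) by ring.
  apply is_lim_seq_plus'; [|apply is_lim_seq_const]. apply is_lim_seq_plus'; [|apply cos_sum_PI_lim].
  apply (is_lim_seq_double (fun N => cos_sum N th + ln (2 * sin (th / 2)) - (cos_sum N PI + ln 2))).
  apply (lim_seq_bound_half _ _ B). intros M. rewrite Rminus_0_r. apply cos_sum_bound.
Qed.

(** [1 - e^{i th}] has modulus [2 sin (th/2)] and argument [- (PI - th)/2]. Its real part
    [2 sin^2 (th/2)] is positive, so [carg] is in its first branch, and the negated logarithm has as
    coordinates the limits of [cos_sum] and [sin_sum]. *)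
Lemma Clog_one_minus_cis :
  Clog (Cminus (RtoC 1) (cis th)) = (ln (2 * sin (th / 2)), - ((PI - th) / 2)).
Proof.
  assert (Hs : 0 < s0) by (apply sin_gt_0; lra).
  assert (Ec : cos th = 1 - 2 * s0 * s0).
  { replace th with (2 * (th / 2)) at 1 by field. apply cos_2a_sin. }
  assert (Es : sin th = 2 * s0 * cos (th / 2)).
  { replace th with (2 * (th / 2)) at 1 by field. apply sin_2a. }
  assert (E : Cminus (RtoC 1) (cis th) = (2 * s0 * s0, - (2 * s0 * cos (th / 2)))).
  { unfold Cminus, Cplus, Copp, RtoC, cis. simpl. rewrite Ec, Es. f_equal; ring. }
  rewrite E. unfold Clog, carg, Cmod. simpl. f_equal.
  - f_equal. fold s0. replace (_ + _) with ((2 * s0) ^ 2).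
    + rewrite sqrt_pow2 by lra. reflexivity.
    + assert (E1 : s0 ^ 2 + cos (th / 2) ^ 2 = 1) by (rewrite <- !Rsqr_pow2; apply sin2_cos2).
      replace (cos (th / 2) * (cos (th / 2) * 1)) with (1 - s0 ^ 2) by lra.
      transitivity (4 * s0 ^ 2 * (s0 ^ 2 + cos (th / 2) ^ 2)); [rewrite E1; ring|ring].
  - destruct (Rlt_dec 0 (2 * s0 * s0)) as [_|Hn]; [|exfalso; apply Hn; nra].
    replace (- (2 * s0 * cos (th / 2)) / (2 * s0 * s0)) with (- (cos (th / 2) / s0)) by (field; lra).
    rewrite atan_opp. f_equal.
    replace (cos (th / 2) / s0) with (tan ((PI - th) / 2)); [apply atan_tan; lra|].
    unfold tan. replace ((PI - th) / 2) with (PI / 2 - th / 2) by field.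
    now rewrite sin_shift, cos_shift.
Qed.
End Trig.

(** * Discrete Fourier transform *)

(** Has the shape of the sum in [c_const], to which it is convertible. *)
Definition csum (l : list nat) (F : nat -> C) : C := fold_right Cplus (RtoC 0) (map F l).

Lemma csum_ext l F G : (forall x, In x l -> F x = G x) -> csum l F = csum l G.
Proof.
  intros H. unfold csum. induction l as [|x l IH]; simpl; [reflexivity|].
  rewrite H by (simpl; auto). f_equal. apply IH. intros; apply H; simpl; auto.
Qed.

Lemma csum_plus l F G : csum l (fun x => Cplus (F x) (G x)) = Cplus (csum l F) (csum l G).
Proof. unfold csum. induction l as [|x l IH]; simpl; [|rewrite IH]; ring. Qed.

Lemma csum_minus l F G : csum l (fun x => Cminus (F x) (G x)) = Cminus (csum l F) (csum l G).
Proof. unfold csum. induction l as [|x l IH]; simpl; [|rewrite IH]; ring. Qed.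

Lemma csum_scal l c F : csum l (fun x => Cmult c (F x)) = Cmult c (csum l F).
Proof. unfold csum. induction l as [|x l IH]; simpl; [|rewrite IH]; ring. Qed.

Lemma csum_swap l l' F :
  csum l (fun x => csum l' (fun y => F x y)) = csum l' (fun y => csum l (fun x => F x y)).
Proof.
  induction l as [|x l IH].
  - change (RtoC 0 = csum l' (fun _ => RtoC 0)).
    induction l' as [|y l' IH]; [reflexivity|].
    change (RtoC 0 = Cplus (RtoC 0) (csum l' (fun _ => RtoC 0))). rewrite <- IH. ring.
  - change (Cplus (csum l' (fun y => F x y)) (csum l (fun x => csum l' (fun y => F x y))) =
      csum l' (fun y => Cplus (F x y) (csum l (fun x => F x y)))).
    rewrite IH, csum_plus. reflexivity.
Qed.

Lemma csum_seq_S a n F : csum (seq a (S n)) F = Cplus (csum (seq a n) F) (F (a + n)%nat).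
Proof.
  rewrite seq_S. unfold csum. rewrite map_app, fold_right_app. simpl.
  generalize (F (a + n)%nat). induction (map F (seq a n)) as [|x l IH]; intros z; simpl; [ring|].
  rewrite IH. ring.
Qed.

Lemma cis_plus a b : cis (a + b) = Cmult (cis a) (cis b).
Proof. unfold cis, Cmult. simpl. rewrite cos_plus, sin_plus. f_equal; ring. Qed.

Lemma one_minus_cis_neq0 th : 0 < th < 2 * PI -> Cminus (RtoC 1) (cis th) <> RtoC 0.
Proof.
  intros H E. apply (f_equal fst) in E. unfold Cminus, Cplus, Copp, RtoC, cis in E. simpl in E.
  assert (Ec : cos th = 1 - 2 * sin (th / 2) * sin (th / 2)).
  { replace th with (2 * (th / 2)) at 1 by field. apply cos_2a_sin. }
  assert (0 < sin (th / 2)) by (apply sin_gt_0; lra). nra.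
Qed.

Section Roots.
Variable m : nat.
Hypothesis Hm : (1 <= m)%nat.

Lemma m_pos : 0 < INR m.
Proof. apply lt_0_INR; lia. Qed.

Lemma W_plus a b : omega_pow m (a + b) = Cmult (omega_pow m a) (omega_pow m b).
Proof.
  unfold omega_pow. rewrite <- cis_plus. f_equal. rewrite plus_IZR. pose proof m_pos. field. lra.
Qed.

Lemma W_0 : omega_pow m 0 = RtoC 1.
Proof.
  unfold omega_pow, cis, RtoC. replace (2 * PI * 0 / INR m) with 0 by (unfold Rdiv; ring).
  now rewrite cos_0, sin_0.
Qed.

Lemma W_m_nat q : omega_pow m (Z.of_nat m * Z.of_nat q) = RtoC 1.
Proof.
  unfold omega_pow. rewrite mult_IZR, <- !INR_IZR_INZ. pose proof m_pos.
  replace (2 * PI * (INR m * INR q) / INR m) with (0 + 2 * INR q * PI) by (field; lra).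
  unfold cis. rewrite cos_period, sin_period, cos_0, sin_0. reflexivity.
Qed.

Lemma W_m z : omega_pow m (Z.of_nat m * z) = RtoC 1.
Proof.
  destruct (Z.le_ge_cases 0 z) as [H|H].
  - rewrite <- (Z2Nat.id z H). apply W_m_nat.
  - pose proof (W_m_nat (Z.to_nat (- z))) as E. rewrite Z2Nat.id in E by lia.
    assert (E0 := W_0). replace 0%Z with (Z.of_nat m * z + Z.of_nat m * (- z))%Z in E0 by lia.
    rewrite W_plus, E in E0. rewrite <- E0. ring.
Qed.

Lemma W_mod z : omega_pow m z = omega_pow m (z mod Z.of_nat m).
Proof.
  rewrite (Z.div_mod z (Z.of_nat m)) at 1 by lia. rewrite W_plus, W_m. ring.
Qed.

Definition angle (l : nat) : R := 2 * PI * INR l / INR m.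

Lemma W_angle l : omega_pow m (Z.of_nat l) = cis (angle l).
Proof. unfold omega_pow, angle. now rewrite (INR_IZR_INZ l). Qed.

Lemma angle_range l : (1 <= l < m)%nat -> 0 < angle l < 2 * PI.
Proof.
  intros [H1 H2]. pose proof m_pos. apply (le_INR 1) in H1. apply lt_INR in H2. simpl in H1.
  pose proof PI_RGT_0. unfold angle. split; [apply Rdiv_lt_0_compat; nra|].
  apply (Rmult_lt_reg_r (INR m)); [easy|].
  replace (2 * PI * INR l / INR m * INR m) with (2 * PI * INR l) by (field; lra). nra.
Qed.

Lemma W_neq1 z : (z mod Z.of_nat m)%Z <> 0%Z -> Cminus (RtoC 1) (omega_pow m z) <> RtoC 0.
Proof.
  intros H. rewrite W_mod. pose proof (Z.mod_pos_bound z (Z.of_nat m) ltac:(lia)).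
  set (r := (z mod Z.of_nat m)%Z) in *. clearbody r.
  rewrite <- (Z2Nat.id r) by lia. rewrite W_angle.
  apply one_minus_cis_neq0, angle_range. lia.
Qed.

Lemma W_neq1_nat l : (1 <= l < m)%nat -> Cminus (RtoC 1) (omega_pow m (Z.of_nat l)) <> RtoC 0.
Proof. intros H. apply W_neq1. rewrite Z.mod_small; lia. Qed.

Lemma W_geometric z a n :
  Cmult (Cminus (RtoC 1) (omega_pow m z)) (csum (seq a n) (fun t => omega_pow m (Z.of_nat t * z))) =
  Cminus (omega_pow m (Z.of_nat a * z)) (omega_pow m (Z.of_nat (a + n) * z)).
Proof.
  induction n as [|n IH].
  - rewrite Nat.add_0_r. unfold csum. simpl. ring.
  - rewrite csum_seq_S, Cmult_plus_distr_l, IH.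
    replace (Z.of_nat (a + S n) * z)%Z with (z + Z.of_nat (a + n) * z)%Z by lia. rewrite W_plus. ring.
Qed.

Lemma W_sum_full z a : (z mod Z.of_nat m)%Z <> 0%Z ->
  csum (seq a m) (fun t => omega_pow m (Z.of_nat t * z)) = RtoC 0.
Proof.
  intros H. pose proof (W_geometric z a m) as E.
  replace (Z.of_nat (a + m) * z)%Z with (Z.of_nat a * z + Z.of_nat m * z)%Z in E by lia.
  rewrite W_plus, W_m in E.
  pose proof (W_neq1 z H) as Hn. set (w := Cminus (RtoC 1) (omega_pow m z)) in *.
  set (s := csum _ _) in *. replace s with (Cmult (Cinv w) (Cmult w s)).
  - rewrite E. ring.
  - rewrite Cmult_assoc, Cinv_l by easy. ring.
Qed.

Lemma W_sum_divides z a n : (z mod Z.of_nat m)%Z = 0%Z ->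
  csum (seq a n) (fun t => omega_pow m (Z.of_nat t * z)) = RtoC (INR n).
Proof.
  intros H. induction n as [|n IH]; [reflexivity|].
  rewrite csum_seq_S, IH, S_INR, RtoC_plus. f_equal.
  rewrite (Z.div_mod z (Z.of_nat m)) by lia. rewrite H, Z.add_0_r.
  rewrite Z.mul_assoc, (Z.mul_comm (Z.of_nat (a + n))), <- Z.mul_assoc. apply W_m.
Qed.

Variable i : nat.
Hypothesis Hi : (1 <= i <= m)%nat.

Definition mean : R := (INR (m + 1) - 2 * INR i) / (2 * INR m).
(* [excess] is [m]-periodic in [k]. *)
Definition excess (k : nat) : R := INR (col_weight m i k) - INR k / INR m.
Definition dev (k : nat) : R := excess k - mean.

Definition dft (l : nat) : C :=
  Copp (Cdiv (Cmult (RtoC (/ INR m)) (omega_pow m (- (Z.of_nat l * (Z.of_nat i - 1)))))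
    (Cminus (RtoC 1) (omega_pow m (Z.of_nat l)))).

Definition dft_inv (k : nat) : C :=
  csum (seq 1 (m - 1)) (fun l => Cmult (dft l) (omega_pow m (Z.of_nat l * Z.of_nat k))).

Lemma mod_iff k :
  (S k mod m = i mod m)%nat <-> ((Z.of_nat (S k) - Z.of_nat i) mod Z.of_nat m = 0)%Z.
Proof. rewrite <- Z.cong_iff_0, <- !Nat2Z.inj_mod. split; [now intros ->|apply Nat2Z.inj]. Qed.

Lemma col_weight_S k :
  col_weight m i (S k) = (col_weight m i k + if Nat.eqb (S k mod m) (i mod m) then 1 else 0)%nat.
Proof.
  unfold col_weight. rewrite seq_S, map_app, list_sum_app. simpl map. simpl list_sum.
  now rewrite Nat.add_0_r.
Qed.

Lemma dev_S k :
  dev (S k) - dev k = (if Nat.eqb (S k mod m) (i mod m) then 1 else 0) - / INR m.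
Proof.
  unfold dev, excess. rewrite col_weight_S, plus_INR, S_INR. pose proof m_pos.
  destruct (_ =? _)%nat; simpl (INR _); field; lra.
Qed.

(** Each term becomes [omega^{l(k+1-i)}/m]; adding [l = 0] completes the sum over all characters,
    which is [m] or 0. *)
Lemma dft_inv_S k :
  Cminus (dft_inv (S k)) (dft_inv k) =
  RtoC ((if Nat.eqb (S k mod m) (i mod m) then 1 else 0) - / INR m).
Proof.
  unfold dft_inv. rewrite <- csum_minus. pose proof m_pos as Hmp.
  set (z := (Z.of_nat (S k) - Z.of_nat i)%Z).
  rewrite (csum_ext _ _ (fun l => Cmult (RtoC (/ INR m)) (omega_pow m (Z.of_nat l * z)))).
  2:{ intros l Hl. apply in_seq in Hl. pose proof (W_neq1_nat l ltac:(lia)) as Hw.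
      replace (Z.of_nat l * Z.of_nat (S k))%Z with (Z.of_nat l + Z.of_nat l * Z.of_nat k)%Z by lia.
      replace (Z.of_nat l * z)%Z with (- (Z.of_nat l * (Z.of_nat i - 1)) + Z.of_nat l * Z.of_nat k)%Z
        by (unfold z; lia).
      rewrite !W_plus. unfold dft. field. exact Hw. }
  rewrite csum_scal.
  assert (E : csum (seq 0 m) (fun l => omega_pow m (Z.of_nat l * z)) =
    Cplus (RtoC 1) (csum (seq 1 (m - 1)) (fun l => omega_pow m (Z.of_nat l * z)))).
  { replace m with (S (m - 1)) at 1 by lia. cbn [seq]. unfold csum at 1. cbn [map fold_right].
    rewrite <- W_0. reflexivity. }
  destruct (Nat.eqb_spec (S k mod m) (i mod m)) as [H|H].
  - rewrite mod_iff in H. rewrite W_sum_divides in E by exact H.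
    replace (csum _ _) with (Cminus (RtoC (INR m)) (RtoC 1)) by (rewrite E; ring).
    rewrite <- RtoC_minus, <- RtoC_mult. f_equal. field. lra.
  - rewrite mod_iff in H. rewrite W_sum_full in E by exact H.
    replace (csum (seq 1 (m - 1)) _) with (Copp (RtoC 1)).
    + rewrite <- RtoC_opp, <- RtoC_mult. f_equal. ring.
    + match type of E with _ = Cplus _ ?s => replace s with (Cminus (Cplus (RtoC 1) s) (RtoC 1)) by ring end.
      rewrite <- E. ring.
Qed.

Lemma col_weight_small k : (k <= m)%nat -> col_weight m i k = if (i <=? k)%nat then 1%nat else 0%nat.
Proof.
  induction k as [|k IH]; intros Hk.
  - destruct i; [lia|reflexivity].
  - rewrite col_weight_S, IH by lia.
    assert (E : Nat.eqb (S k mod m) (i mod m) = Nat.eqb (S k) i).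
    { apply Bool.eq_true_iff_eq. rewrite !Nat.eqb_eq. split; [|now intros ->]. intros E.
      destruct (Nat.eq_dec (S k) m) as [Ek|]; destruct (Nat.eq_dec i m) as [Ei|]; [congruence| | |].
      - rewrite Ek, Nat.Div0.mod_same, Nat.mod_small in E by lia. lia.
      - rewrite Ei, Nat.Div0.mod_same, Nat.mod_small in E by lia. lia.
      - rewrite !Nat.mod_small in E by lia. exact E. }
    rewrite E. destruct (Nat.leb_spec i k), (Nat.leb_spec i (S k)), (Nat.eqb_spec (S k) i); lia.
Qed.

Lemma dev_sum_period : rsum m (fun k => dev (S k)) = 0.
Proof.
  pose proof m_pos.
  assert (E : forall n, (n <= m)%nat -> rsum n (fun k => INR (col_weight m i (S k))) = INR (n + 1 - i)).
  { induction n as [|n IH]; intros Hn; cbn [rsum].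
    - replace (0 + 1 - i)%nat with 0%nat by lia. reflexivity.
    - rewrite IH, col_weight_small by lia. destruct (Nat.leb_spec i (S n)).
      + replace (S n + 1 - i)%nat with (n + 1 - i + 1)%nat by lia. now rewrite plus_INR.
      + replace (S n + 1 - i)%nat with 0%nat by lia. replace (n + 1 - i)%nat with 0%nat by lia. simpl; ring. }
  unfold dev, excess. rewrite !rsum_minus, E, rsum_const by lia.
  unfold Rdiv. rewrite rsum_scal_r, rsum_INR. unfold mean. rewrite minus_INR, plus_INR by lia.
  simpl (INR 1). field. lra.
Qed.

(** Equal differences leave only a constant [c0]. Both sides sum to 0 over one period, so
    [m c0 = 0]. *)
Lemma dev_dft k : RtoC (dev k) = dft_inv k.
Proof.
  pose proof m_pos as Hmp.
  assert (Hc : forall k, Cminus (RtoC (dev k)) (dft_inv k) = Cminus (RtoC (dev 0)) (dft_inv 0)).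
  { induction k0 as [|k0 IH]; [reflexivity|]. rewrite <- IH.
    pose proof (dft_inv_S k0) as E. rewrite <- dev_S, RtoC_minus in E.
    replace (dft_inv (S k0)) with (Cplus (Cminus (dft_inv (S k0)) (dft_inv k0)) (dft_inv k0)) by ring.
    rewrite E. ring. }
  set (c0 := Cminus (RtoC (dev 0)) (dft_inv 0)) in *.
  assert (H1 : csum (seq 1 m) (fun k => RtoC (dev k)) = RtoC 0).
  { rewrite <- dev_sum_period. generalize m as n. induction n as [|n IH]; [reflexivity|].
    rewrite csum_seq_S, IH. cbn [rsum]. rewrite RtoC_plus. reflexivity. }
  assert (H2 : csum (seq 1 m) dft_inv = RtoC 0).
  { unfold dft_inv. rewrite csum_swap.
    rewrite (csum_ext _ _ (fun _ => Cmult (RtoC 0) (RtoC 0))).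
    - rewrite csum_scal. ring.
    - intros l Hl. apply in_seq in Hl. rewrite csum_scal.
      rewrite (csum_ext _ _ (fun t => omega_pow m (Z.of_nat t * Z.of_nat l)))
        by (intros; f_equal; lia).
      rewrite W_sum_full by (rewrite Z.mod_small; lia). ring. }
  assert (H3 : csum (seq 1 m) (fun _ => c0) = Cmult (RtoC (INR m)) c0).
  { generalize m as n. induction n as [|n IH]; [unfold csum; simpl; ring|].
    rewrite csum_seq_S, IH, S_INR, RtoC_plus. ring. }
  assert (E : Cmult (RtoC (INR m)) c0 = RtoC 0).
  { rewrite <- H3, (csum_ext _ _ (fun k => Cminus (RtoC (dev k)) (dft_inv k)))
      by (intros; symmetry; apply Hc).
    rewrite csum_minus, H1, H2. ring. }
  assert (E0 : c0 = RtoC 0).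
  { replace c0 with (Cmult (RtoC (/ INR m)) (Cmult (RtoC (INR m)) c0)).
    - rewrite E. ring.
    - rewrite Cmult_assoc, <- RtoC_mult, Rinv_l by lra. ring. }
  specialize (Hc k). rewrite E0 in Hc.
  replace (RtoC (dev k)) with (Cplus (Cminus (RtoC (dev k)) (dft_inv k)) (dft_inv k)) by ring.
  rewrite Hc. ring.
Qed.

Lemma dev_period k : dev (k + m) = dev k.
Proof.
  apply RtoC_inj. rewrite !dev_dft. unfold dft_inv. apply csum_ext; intros l _. f_equal.
  replace (Z.of_nat l * Z.of_nat (k + m))%Z with (Z.of_nat l * Z.of_nat k + Z.of_nat m * Z.of_nat l)%Z by lia.
  rewrite W_plus, W_m. ring.
Qed.

(** A period of [dev] sums to 0, so the partial sums are periodic too. *)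
Lemma dev_sum_bounded : exists B, forall N, Rabs (rsum N (fun k => dev (S k))) <= B.
Proof.
  set (P := fun N => rsum N (fun k => dev (S k))).
  assert (HP : forall N, P (N + m)%nat = P N).
  { induction N as [|N IH]; [apply dev_sum_period|].
    change (P (N + m)%nat + dev (S (N + m)) = P N + dev (S N)). rewrite IH.
    now rewrite <- (dev_period (S N)). }
  exists (rsum m (fun k => Rabs (P k))). intros N. change (Rabs (P N) <= rsum m (fun k => Rabs (P k))).
  induction N as [N IH] using (well_founded_induction Wf_nat.lt_wf).
  destruct (Nat.le_gt_cases m N) as [H|H].
  - replace N with (N - m + m)%nat by lia. rewrite HP. apply IH. lia.
  - replace m with (N + S (m - S N))%nat by lia. rewrite rsum_split, rsum_first, Nat.add_0_r.
    assert (0 <= rsum N (fun k => Rabs (P k))) by (apply rsum_nonneg; intros; apply Rabs_pos).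
    assert (0 <= rsum (m - S N) (fun k => Rabs (P (N + S k)%nat))) by (apply rsum_nonneg; intros; apply Rabs_pos).
    lra.
Qed.

(** * The logarithmic series of the deviation *)

Definition is_clim (u : nat -> C) (l : C) : Prop :=
  is_lim_seq (fun n => fst (u n)) (fst l) /\ is_lim_seq (fun n => snd (u n)) (snd l).

Lemma is_clim_ext u v l : (forall n, u n = v n) -> is_clim u l -> is_clim v l.
Proof.
  intros H [H1 H2]. split; eapply is_lim_seq_ext; try eassumption; intros; simpl; now rewrite H.
Qed.

Lemma is_clim_plus u v a b :
  is_clim u a -> is_clim v b -> is_clim (fun n => Cplus (u n) (v n)) (Cplus a b).
Proof. intros [H1 H2] [H3 H4]. split; simpl; now apply is_lim_seq_plus'. Qed.

Lemma is_clim_scal c u a : is_clim u a -> is_clim (fun n => Cmult c (u n)) (Cmult c a).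
Proof.
  intros [H1 H2]. split; simpl.
  - apply is_lim_seq_minus'; [apply (is_lim_seq_scal_l _ (fst c) _ H1)|apply (is_lim_seq_scal_l _ (snd c) _ H2)].
  - apply is_lim_seq_plus'; [apply (is_lim_seq_scal_l _ (fst c) _ H2)|apply (is_lim_seq_scal_l _ (snd c) _ H1)].
Qed.

Lemma is_clim_csum l u a : (forall x, In x l -> is_clim (u x) (a x)) ->
  is_clim (fun n => csum l (fun x => u x n)) (csum l a).
Proof.
  induction l as [|x l IH]; intros H.
  - split; apply is_lim_seq_const.
  - apply (is_clim_plus (u x) (fun n => csum l (fun x => u x n)) (a x) (csum l a)); simpl in H; auto.
Qed.

Lemma dev_weighted_sum M :
  RtoC (rsum M (fun k => dev (S k) / INR (S k))) =
  csum (seq 1 (m - 1)) (fun l => Cmult (dft l) (cos_sum M (angle l), sin_sum M (angle l))).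
Proof.
  induction M as [|M IH].
  - symmetry. transitivity (csum (seq 1 (m - 1)) (fun _ => Cmult (RtoC 0) (RtoC 0))).
    + apply csum_ext; intros l _. unfold cos_sum, sin_sum. simpl. change (0, 0) with (RtoC 0). ring.
    + rewrite csum_scal. change (rsum 0 _) with 0. ring.
  - cbn [rsum]. rewrite RtoC_plus, IH. unfold Rdiv. rewrite RtoC_mult, dev_dft. unfold dft_inv.
    rewrite Cmult_comm, <- csum_scal, <- csum_plus. apply csum_ext; intros l _.
    replace (Z.of_nat l * Z.of_nat (S M))%Z with (Z.of_nat (S M) * Z.of_nat l)%Z by lia.
    assert (E : omega_pow m (Z.of_nat (S M) * Z.of_nat l) = cis (INR (S M) * angle l)).
    { unfold omega_pow, angle. f_equal. rewrite mult_IZR, <- !INR_IZR_INZ. pose proof m_pos. field. lra. }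
    rewrite E.
    transitivity (Cmult (dft l) (Cplus (cos_sum M (angle l), sin_sum M (angle l))
       (Cmult (RtoC (/ INR (S M))) (cis (INR (S M) * angle l))))); [ring|]. f_equal.
    unfold cos_sum, sin_sum. cbn [rsum]. unfold Cplus, Cmult, cis, RtoC. cbn [fst snd].
    f_equal; unfold Rdiv; ring.
Qed.

(** The complex sum of logarithms in [c_const] is, up to its factor, the limit of real partial sums;
    the imaginary part is a limit of zeros, so [c_const] is real. The factors [2 / Cpart] match
    [1/a = 2 sqrt n / C] in the final estimate. *)
Lemma dev_series : exists L : R, is_lim_seq (fun N => rsum (2 * N) (fun k => dev (S k) / INR (S k))) L /\
  c_const m i = RtoC ((euler_gamma + ln (2 / Cpart)) * (2 * mean) / Cpart + 2 / Cpart * L).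
Proof.
  set (T := fun l => Cmult (dft l) (Copp (Clog (Cminus (RtoC 1) (omega_pow m (Z.of_nat l)))))).
  assert (H : is_clim (fun N => RtoC (rsum (2 * N) (fun k => dev (S k) / INR (S k))))
    (csum (seq 1 (m - 1)) T)).
  { eapply is_clim_ext; [intros n; symmetry; apply dev_weighted_sum|].
    apply (is_clim_csum _ (fun l n => Cmult (dft l) (cos_sum (2 * n) (angle l), sin_sum (2 * n) (angle l)))).
    intros l Hl. apply in_seq in Hl. pose proof (angle_range l ltac:(lia)) as Ha.
    apply is_clim_scal. rewrite W_angle, Clog_one_minus_cis by easy. split; simpl.
    - now apply cos_sum_lim.
    - rewrite Ropp_involutive. now apply sin_sum_lim. }
  destruct H as [H1 H2]. cbn [fst snd RtoC] in H1, H2.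
  set (s := csum (seq 1 (m - 1)) T) in *. exists (fst s). split; [exact H1|].
  assert (E0 : snd s = 0).
  { apply is_lim_seq_unique in H2. rewrite Lim_seq_const in H2. now inversion H2. }
  assert (Es : s = RtoC (fst s)) by (destruct s as [x y]; simpl in *; now rewrite E0).
  assert (HC : 0 < Cpart).
  { unfold Cpart. apply Rmult_lt_0_compat; [apply PI_RGT_0|apply sqrt_lt_R0; lra]. }
  pose proof m_pos as Hmp.
  rewrite RtoC_plus, (RtoC_mult (2 / Cpart)).
  transitivity (Cplus (RtoC ((euler_gamma + ln (2 / Cpart)) * (2 * mean) / Cpart)) (Cmult (RtoC (2 / Cpart)) s));
    [|do 2 f_equal; exact Es].
  unfold c_const. f_equal.
  - f_equal. unfold mean. field. lra.
  - unfold s. change (Cmult (RtoC (2 / (Cpart * INR m))) (csum (seq 1 (m - 1)) (fun l =>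
      Cmult (Cdiv (omega_pow m (- (Z.of_nat l * (Z.of_nat i - 1)))%Z)
                  (Cminus (RtoC 1) (omega_pow m (Z.of_nat l))))
            (Clog (Cminus (RtoC 1) (omega_pow m (Z.of_nat l)))))) =
      Cmult (RtoC (2 / Cpart)) (csum (seq 1 (m - 1)) T)).
    replace (2 / (Cpart * INR m)) with (2 / Cpart * / INR m) by (field; lra).
    rewrite RtoC_mult, <- Cmult_assoc, <- csum_scal. f_equal. apply csum_ext; intros l Hl.
    apply in_seq in Hl. pose proof (W_neq1_nat l ltac:(lia)). unfold T, dft. field. easy.
Qed.
End Roots.

(** * Assembly *)

Section CountingSequence.
Variable enum : nat -> list (list nat).
Hypothesis Henum : forall n, NoDup (enum n) /\ (forall l, In l (enum n) <-> is_partition n l).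

Let p (n : nat) : R := INR (length (enum n)).
Let a := count_upto enum.

Lemma count_upto_1 n : a 1 n = 1.
Proof.
  induction n as [|n IH]; unfold a in *; rewrite count_upto_S, count_upto_0 by exact Henum.
  - rewrite shift_gt by lia. simpl. ring.
  - rewrite shift_le by lia. replace (S n - 1)%nat with n by lia. rewrite IH. simpl. ring.
Qed.

(** The exact count is the integer part of [n/2], plus 1; these bounds are those of
    [sigma_close_base]. *)
Lemma count_upto_2 n : (INR n + 1) / 2 <= a 2 n <= INR n / 2 + 1.
Proof.
  induction n as [n IH] using (well_founded_induction Wf_nat.lt_wf).
  unfold a in *. rewrite count_upto_S by exact Henum. pose proof (count_upto_1 n) as E1.
  unfold a in E1. rewrite E1. destruct n as [|[|n]].
  - rewrite shift_gt by lia. simpl. lra.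
  - rewrite shift_gt by lia. simpl. lra.
  - rewrite shift_le by lia. specialize (IH n ltac:(lia)). replace (S (S n) - 2)%nat with n by lia.
    rewrite !S_INR. lra.
Qed.

(** Starts at parts at most 1, where the count is constantly 1; with no part allowed it would drop
    from 1 to 0. *)
Lemma count_upto_incr k n : a (S k) n <= a (S k) (S n) /\ 1 <= a (S k) n.
Proof.
  revert n. induction k as [|k IHk]; intros n; [rewrite !count_upto_1; lra|].
  induction n as [n IHn] using (well_founded_induction Wf_nat.lt_wf).
  assert (Hs : forall x, 0 <= shift (S (S k)) (a (S (S k))) x).
  { intros x. unfold shift. destruct (S (S k) <=? x)%nat; [apply pos_INR|lra]. }
  unfold a in *. rewrite (count_upto_S enum Henum (S k) n), (count_upto_S enum Henum (S k) (S n)).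
  destruct (IHk n) as [H1 H2]. pose proof (Hs n) as Hs1.
  split; [|lra]. assert (shift (S (S k)) (count_upto enum (S (S k))) n <=
    shift (S (S k)) (count_upto enum (S (S k))) (S n)); [|lra].
  destruct (Nat.le_gt_cases (S (S k)) n) as [H|H].
  - rewrite !shift_le by lia. replace (S n - S (S k))%nat with (S (n - S (S k))) by lia. apply IHn. lia.
  - rewrite shift_gt by easy. specialize (Hs (S n)). lra.
Qed.

Lemma num_eq_count n k : (n <= k)%nat -> p n = a k n.
Proof. intros H. unfold p, a. now rewrite count_upto_all. Qed.

Lemma num_pos n : 0 < p n.
Proof. rewrite (num_eq_count n (S n)) by lia. pose proof (count_upto_incr n n). lra. Qed.

Lemma num_incr n : p n <= p (S n).
Proof. rewrite (num_eq_count n (S n)), (num_eq_count (S n) (S n)) by lia. apply count_upto_incr. Qed.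

Lemma cumul_eq N n : (n <= N)%nat -> cumul N p n = rsum n p.
Proof.
  intros H. unfold cumul. rewrite (rsum_extend n N); [|easy|intros; apply shift_gt; lia].
  rewrite (rsum_rev n p). apply rsum_ext; intros s Hs. rewrite shift_le by lia. f_equal; lia.
Qed.

Lemma cumul2_eq N n : (n <= N)%nat -> cumul2 N p n = rsum (S n) (fun x => rsum x p).
Proof.
  intros H. unfold cumul2. rewrite (rsum_extend n N); [|easy|intros; rewrite shift_gt by lia; ring].
  clear H. rewrite rsum_rev. rewrite (rsum_ext _ _ (fun x => INR (n - x) * p x)).
  2:{ intros x Hx. rewrite shift_le by lia. f_equal; f_equal; lia. }
  induction n as [|n IH]; [simpl; ring|].
  change (rsum (S (S n)) (fun x => rsum x p)) with (rsum (S n) (fun x => rsum x p) + rsum (S n) p).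
  rewrite <- IH. cbn [rsum]. replace (S n - n)%nat with 1%nat by lia. simpl (INR 1).
  rewrite (rsum_ext n _ (fun x => INR (n - x) * p x + p x)).
  - rewrite rsum_plus. ring.
  - intros x Hx. replace (S n - x)%nat with (S (n - x)) by lia. rewrite S_INR. ring.
Qed.

Lemma num_almost_renewal n :
  Rabs (INR n * p n - PI ^ 2 / 6 * rsum (S n) (fun x => rsum x p)) <= 14 * rsum n p.
Proof.
  rewrite <- (cumul_eq (S n) n), <- (cumul2_eq (S n) n) by lia.
  unfold p at 1. rewrite total_size by exact Henum. fold p.
  (* The part sizes 3, 4, ... are adjoined one at a time; with parts up to [2 + n], the counts agree
     with [p] on all arguments up to [n]. *)
  assert (H : forall k, sigma_close (PI ^ 2 / 6) 14 (S n) (a (2 + k))).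
  { induction k as [|k IH].
    - apply sigma_close_base; [exact basel|]. apply count_upto_2.
    - apply (sigma_close_step _ _ _ (S (2 + k)) (a (2 + k))); [lia| |exact IH].
      intros x. apply (count_upto_S enum Henum). }
  specialize (H n n ltac:(lia)).
  rewrite (lambert_ext (S n) INR INR p (a (2 + n))); [|auto|intros; apply num_eq_count; lia].
  replace (cumul2 (S n) p n) with (cumul2 (S n) (a (2 + n)) n).
  2:{ apply rsum_ext; intros s _. f_equal. apply shift_ext; intros; symmetry; apply num_eq_count; lia. }
  replace (cumul (S n) p n) with (cumul (S n) (a (2 + n)) n).
  2:{ apply rsum_ext; intros s _. apply shift_ext; intros; symmetry; apply num_eq_count; lia. }
  exact H.
Qed.
End CountingSequence.

Lemma Cpart_half_sq : (Cpart / 2) ^ 2 = PI ^ 2 / 6.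
Proof.
  unfold Cpart. replace ((PI * sqrt (2 / 3) / 2) ^ 2) with (PI ^ 2 * (sqrt (2 / 3) * sqrt (2 / 3)) / 4) by field.
  rewrite sqrt_sqrt by lra. field.
Qed.

Lemma Cpart_half_ge1 : 1 <= Cpart / 2.
Proof.
  assert (H : 0 < Cpart / 2).
  { unfold Cpart. pose proof PI_RGT_0. assert (0 < sqrt (2 / 3)) by (apply sqrt_lt_R0; lra). nra. }
  pose proof Cpart_half_sq as E. pose proof PI2_3_2. assert (9 <= PI ^ 2) by nra. nra.
Qed.

Lemma geometric_bose u M : 0 < u ->
  rsum M (fun j => exp (- (u * INR (S j)))) = bose u * (1 - exp (- (u * INR M))).
Proof.
  intros Hu. pose proof (exp_minus1_pos u Hu). unfold bose. induction M as [|M IH].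
  - simpl. rewrite Rmult_0_r, Ropp_0, exp_0. ring.
  - cbn [rsum]. rewrite IH.
    assert (E : exp (- (u * INR M)) = exp (- (u * INR (S M))) * exp u).
    { rewrite <- exp_plus. f_equal. rewrite S_INR. ring. }
    rewrite E. field. lra.
Qed.

(** * The Lambert series of the excess *)

Section Lattice.
Variables m i : nat.
Hypothesis Hm : (1 <= m)%nat.
Hypothesis Hi : (1 <= i <= m)%nat.

Lemma excess_bounded : exists G, 0 <= G /\ forall k, Rabs (excess m i (S k)) <= G.
Proof.
  destruct (dev_sum_bounded m Hm i Hi) as [B HB].
  exists (2 * B + Rabs (mean m i)). split.
  - pose proof (HB O) as H. pose proof (Rabs_pos (mean m i)). pose proof (Rabs_pos (rsum 0 (fun k => dev m i (S k)))). lra.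
  - intros k. replace (excess m i (S k)) with (dev m i (S k) + mean m i) by (unfold dev; ring).
    eapply Rle_trans; [apply Rabs_triang|]. apply Rplus_le_compat_r.
    pose proof (HB k) as H1. pose proof (HB (S k)) as H2. cbn [rsum] in H2.
    apply Rabs_le_between in H1, H2. apply Rabs_le. lra.
Qed.

(** The inner geometric sum turns the weight [excess] into [excess * bose], which splits as [mean *
    bose + dev * bose_reg + dev / (a k)]: a Bose sum, an Abel sum and the convergent series of [L].
    [K] is chosen before [a], so it is uniform as [a] tends to 0; only the cutoff depends on [a]. *)
Lemma lambert_series_asymp (L : R) :
  is_lim_seq (fun N => rsum (2 * N) (fun k => dev m i (S k) / INR (S k))) L ->
  exists K, forall a, 0 < a -> exists N0, forall N, (N0 <= N)%nat ->
    Rabs (rsum (2 * N) (fun k => rsum (2 * N) (fun j =>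
        excess m i (S k) * exp (- (a * INR (S k) * INR (S j)))))
      - (mean m i * (euler_gamma - ln a) + L) / a) <= K.
Proof.
  intros HL. destruct (dev_sum_bounded m Hm i Hi) as [B HB]. destruct excess_bounded as [G [HG HGb]].
  (* The final 2 is 1 for the convergence to [L], known within [a] and divided by [a], and 1 for the
     truncated geometric tails. *)
  exists (3 * Rabs (mean m i) + 2 * B + 2). intros a Ha.
  destruct (bose_sum_lim a Ha) as [M1 H1].
  assert (H2 : exists M2, forall N, (M2 <= N)%nat ->
    Rabs (rsum (2 * N) (fun k => dev m i (S k) / INR (S k)) - L) < a).
  { apply is_lim_seq_spec in HL. exact (HL (mkposreal a Ha)). }
  destruct H2 as [M2 H2].
  (* Bounds [sum |excess| bose] for every cutoff; the geometric tails carry an extra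
     [exp (- a M) <= 1/(a M)], so [M >= |U|/a] brings them below 1. *)
  set (U := G * ((euler_gamma - ln a) / a + 3)).
  destruct (nat_above (Rabs U / a)) as [M3 H3].
  exists (S (M1 + M2 + M3)). intros N HN. specialize (H1 (2 * N)%nat ltac:(lia)).
  specialize (H2 N ltac:(lia)).
  set (M := (2 * N)%nat) in *.
  assert (HM : (1 <= M)%nat) by (unfold M; lia). assert (HMR : 1 <= INR M) by (apply (le_INR 1), HM).
  assert (Hpos : forall k, 0 < a * INR (S k)) by (intros; apply Rmult_lt_0_compat; [easy|apply lt_0_INR; lia]).
  assert (E : rsum M (fun k => rsum M (fun j => excess m i (S k) * exp (- (a * INR (S k) * INR (S j))))) =
    mean m i * rsum M (fun k => bose (a * INR (S k))) +
    rsum M (fun k => dev m i (S k) * bose_reg (a * INR (S k))) +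
    / a * rsum M (fun k => dev m i (S k) / INR (S k)) -
    rsum M (fun k => excess m i (S k) * (bose (a * INR (S k)) * exp (- (a * INR (S k) * INR M))))).
  { rewrite <- !rsum_scal, <- !rsum_plus, <- rsum_minus. apply rsum_ext; intros k _.
    rewrite rsum_scal, geometric_bose by apply Hpos.
    replace (bose_reg (a * INR (S k))) with (bose (a * INR (S k)) - / (a * INR (S k))) by reflexivity.
    replace (dev m i (S k)) with (excess m i (S k) - mean m i) by reflexivity.
    pose proof (lt_0_INR (S k) ltac:(lia)). field. lra. }
  rewrite E.
  pose proof (bose_reg_abel a (fun k => dev m i (S k)) B M Ha HB) as H4.
  assert (H5 : Rabs (rsum M (fun k => excess m i (S k) * (bose (a * INR (S k)) * exp (- (a * INR (S k) * INR M))))) <= 1).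
  { apply Rle_trans with (rsum M (fun k => (G * exp (- (a * INR M))) * bose (a * INR (S k)))).
    - apply rsum_abs; intros k _. pose proof (bose_pos _ (Hpos k)) as Hb.
      pose proof (exp_pos (- (a * INR (S k) * INR M))).
      rewrite !Rabs_mult, (Rabs_right (bose _)), (Rabs_right (exp _)) by lra.
      assert (He : exp (- (a * INR (S k) * INR M)) <= exp (- (a * INR M))).
      { apply exp_neg_le. rewrite S_INR. pose proof (pos_INR k). assert (0 <= a * INR M) by nra. nra. }
      replace (G * exp (- (a * INR M)) * bose (a * INR (S k))) with (G * (bose (a * INR (S k)) * exp (- (a * INR M)))) by ring.
      apply Rmult_le_compat; [apply Rabs_pos|nra|apply HGb|]. apply Rmult_le_compat_l; lra.
    - rewrite rsum_scal. pose proof (bose_sum_le a M Ha) as Hs.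
      pose proof (exp_pos (- (a * INR M))) as Hep.
      apply Rle_trans with (exp (- (a * INR M)) * Rabs U).
      { rewrite (Rmult_comm G), Rmult_assoc. apply Rmult_le_compat_l; [lra|].
        apply Rle_trans with U; [|apply Rle_abs]. apply Rmult_le_compat_l; lra. }
      pose proof (le_exp_scaled a (INR M) Ha) as He.
      assert (H6 : Rabs U / a <= INR M) by (apply Rle_trans with (1 := H3), le_INR; unfold M; lia).
      assert (H7 : Rabs U <= a * INR M).
      { apply (Rmult_le_reg_r (/ a)); [now apply Rinv_0_lt_compat|].
        replace (a * INR M * / a) with (INR M) by (field; lra). exact H6. }
      apply Rle_trans with (exp (- (a * INR M)) * (a * INR M)); [apply Rmult_le_compat_l; lra|].
      replace (exp (- (a * INR M)) * (a * INR M)) with (a * (INR M * exp (- (a * INR M)))) by ring.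
      apply Rle_trans with (a * / a); [apply Rmult_le_compat_l; lra|]. rewrite Rinv_r; lra. }
  set (s1 := rsum M (fun k => bose (a * INR (S k)))) in *.
  set (s2 := rsum M (fun k => dev m i (S k) * bose_reg (a * INR (S k)))) in *.
  set (s3 := rsum M (fun k => dev m i (S k) / INR (S k))) in *.
  set (s4 := rsum M (fun k => excess m i (S k) * (bose (a * INR (S k)) * exp (- (a * INR (S k) * INR M))))) in *.
  replace (mean m i * s1 + s2 + / a * s3 - s4 - (mean m i * (euler_gamma - ln a) + L) / a) with
    (mean m i * (s1 - (euler_gamma - ln a) / a) + s2 + / a * (s3 - L) - s4) by (field; lra).
  assert (B1 : Rabs (mean m i * (s1 - (euler_gamma - ln a) / a)) <= 3 * Rabs (mean m i)).
  { rewrite Rabs_mult, Rmult_comm. apply Rmult_le_compat_r; [apply Rabs_pos|easy]. }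
  assert (B3 : Rabs (/ a * (s3 - L)) <= 1).
  { pose proof (Rinv_0_lt_compat a Ha). rewrite Rabs_mult, (Rabs_right (/ a)) by lra.
    apply Rle_trans with (/ a * a); [apply Rmult_le_compat_l; lra|]. rewrite Rinv_l; lra. }
  apply Rabs_le_between in B1, B3, H4, H5. apply Rabs_le. lra.
Qed.
End Lattice.

Lemma lambert_extend N M f u n : (n <= N)%nat -> (n <= M)%nat -> lambert N f u n = lambert M f u n.
Proof.
  assert (H : forall N M, (n <= N)%nat -> (N <= M)%nat -> lambert M f u n = lambert N f u n).
  { intros N' M' H1 H2. unfold lambert. rewrite (rsum_extend N' M'); [|easy|].
    - apply rsum_ext; intros k _. apply rsum_extend; [easy|]. intros. rewrite shift_gt by nia. ring.
    - intros k A B. apply rsum_0; intros. rewrite shift_gt by nia. ring. }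
  intros H1 H2. destruct (Nat.le_ge_cases N M); [symmetry|]; now apply H.
Qed.

Section Average.
Variables m i : nat.
Hypothesis Hm : (1 <= m)%nat.
Hypothesis Hi : (1 <= i <= m)%nat.
Variable enum : nat -> list (list nat).
Hypothesis Henum : forall n, NoDup (enum n) /\ (forall l, In l (enum n) <-> is_partition n l).

Let p (n : nat) : R := INR (length (enum n)).
Let c : R := Cpart / 2.

(** [total_size] divided by [m] writes [n/m] as a double sum over the same ratios, so subtracting it
    turns the weight into [excess]. Shifts beyond [n] vanish, which leaves the cutoff free for the
    asymptotics. *)
Lemma avgX_excess n M : (n <= M)%nat ->
  avgX m i (enum n) - INR n / INR m =
  rsum M (fun k => rsum M (fun j => excess m i (S k) * (shift (S k * S j) p n / p n))).
Proof.
  intros HM. pose proof (num_pos enum Henum n) as Hp. change (0 < p n) in Hp. pose proof (m_pos m Hm) as Hmp.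
  unfold avgX. rewrite total_X by exact Henum. fold (p n). change (fun x => INR (length (enum x))) with p.
  replace (INR n / INR m) with (/ INR m * (INR n * p n) / p n) by (field; lra).
  pose proof (total_size enum Henum n) as E. change (INR n * p n = lambert (S n) INR p n) in E. rewrite E.
  rewrite !(lambert_extend (S n) M) by lia.
  transitivity ((lambert M (fun k => INR (col_weight m i k)) p n - / INR m * lambert M INR p n) / p n);
    [field; lra|].
  unfold lambert. rewrite <- rsum_scal, <- rsum_minus. unfold Rdiv at 1. rewrite <- rsum_scal_r.
  apply rsum_ext; intros k _. rewrite <- rsum_scal, <- rsum_minus, <- rsum_scal_r.
  apply rsum_ext; intros j _. unfold excess. field. lra.
Qed.

(** Replacing the ratios by exponentials costs [G K6 / sqrt n] times a Bose sum at
    [b = c/(32 sqrt n)], that is, [O(log n)]; the rest is [lambert_series_asymp] at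
    [a = c/sqrt n]. *)
Lemma avgX_asymp (L : R) :
  is_lim_seq (fun N => rsum (2 * N) (fun k => dev m i (S k) / INR (S k))) L ->
  exists K N0, forall n, (N0 <= n)%nat ->
    Rabs (avgX m i (enum n) - INR n / INR m
      - (mean m i * (euler_gamma - ln (c / sqrt (INR n))) + L) / (c / sqrt (INR n))) <= K * ln (INR n).
Proof.
  intros HL. pose proof Cpart_half_ge1 as Hc. fold c in Hc.
  destruct (p_ratio p c 14 Hc ltac:(lra) (num_pos enum Henum) (num_incr enum Henum)) as [K6 [n6 [HK6 [Hn6 H6]]]].
  { intros n. unfold c. rewrite Cpart_half_sq. apply (num_almost_renewal enum Henum). }
  destruct (lambert_series_asymp m i Hm Hi L HL) as [K0 HK0].
  destruct (excess_bounded m i Hm Hi) as [G [HG HGb]].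
  (* The part of [(1/sqrt n) ((gamma - ln b)/b + 3)] without [ln n], bounded in absolute value. *)
  set (V := Rabs (euler_gamma - ln (c / 32)) * (32 / c) + 3).
  (* [n >= 3] gives [ln n >= 1], so constants are absorbed into multiples of [ln n]. *)
  exists (G * K6 * (32 / c + V) + Rabs K0), (n6 + 3)%nat. intros n Hn.
  assert (Hn3 : 3 <= INR n) by (replace 3 with (INR 3) by (simpl; ring); apply le_INR; lia).
  assert (Hln : 1 <= ln (INR n)).
  { rewrite <- (ln_exp 1). apply ln_le; [apply exp_pos|]. pose proof exp_le_3. lra. }
  pose proof (sqrt_INR_ge1 n ltac:(lia)) as Hw. pose proof (sqrt_INR_sq n) as Hw2.
  specialize (fun s => H6 n s ltac:(lia)). set (w := sqrt (INR n)) in *.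
  assert (Hlw : ln w = ln (INR n) / 2) by (rewrite <- Hw2, ln_mult by lra; field).
  set (a := c / w) in *. set (b := c / 32 / w) in *.
  assert (Ha : 0 < a) by (apply Rdiv_lt_0_compat; lra).
  assert (Hb : 0 < b) by (apply Rdiv_lt_0_compat; lra).
  (* The cutoff depends on [n]: it must exceed both [n], for the exact formula, and the threshold
     belonging to [a = c/sqrt n]. *)
  destruct (HK0 a Ha) as [N0 HN0]. set (N := (N0 + n)%nat). specialize (HN0 N ltac:(unfold N; lia)).
  set (M := (2 * N)%nat) in *.
  rewrite (avgX_excess n M) by (unfold M, N; lia).
  set (s := rsum M (fun k => rsum M (fun j => excess m i (S k) * exp (- (a * INR (S k) * INR (S j)))))) in *.
  set (s' := rsum M _).
  assert (H1 : Rabs (s' - s) <= G * K6 * (32 / c + V) * ln (INR n)).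
  { unfold s, s'. rewrite <- rsum_minus.
    apply Rle_trans with (rsum M (fun k => (G * (K6 / w)) * bose (b * INR (S k)))).
    - apply rsum_abs; intros k _. rewrite <- rsum_minus.
      pose proof (lt_0_INR (S k) ltac:(lia)) as Hk.
      assert (Hbk : 0 < b * INR (S k)) by (apply Rmult_lt_0_compat; easy).
      apply Rle_trans with (rsum M (fun j => (G * (K6 / w)) * exp (- (b * INR (S k) * INR (S j))))).
      + apply rsum_abs; intros j _. rewrite <- Rmult_minus_distr_l, Rabs_mult, (Rmult_assoc G).
        apply Rmult_le_compat; auto using Rabs_pos.
        replace (a * INR (S k) * INR (S j)) with (a * INR (S k * S j)) by (rewrite mult_INR; ring).
        replace (b * INR (S k) * INR (S j)) with (b * INR (S k * S j)) by (rewrite mult_INR; ring).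
        apply H6.
      + rewrite rsum_scal, geometric_bose by easy.
        assert (0 <= K6 / w) by (apply Rdiv_le_0_compat; lra).
        apply Rmult_le_compat_l; [apply Rmult_le_pos; lra|].
        pose proof (bose_pos _ Hbk). pose proof (exp_pos (- (b * INR (S k) * INR M))). nra.
    - rewrite rsum_scal. pose proof (bose_sum_le b M Hb) as Hs.
      assert (Elb : ln b = ln (c / 32) - ln w).
      { unfold b, Rdiv. rewrite ln_mult, ln_Rinv; try lra. apply Rinv_0_lt_compat; lra. }
      apply Rle_trans with (G * (K6 / w) * ((euler_gamma - ln b) / b + 3)).
      { apply Rmult_le_compat_l; [|easy]. apply Rmult_le_pos; [lra|]. apply Rdiv_le_0_compat; lra. }
      replace (G * (K6 / w) * ((euler_gamma - ln b) / b + 3)) with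
        (G * K6 * ((euler_gamma - ln b) * (32 / c) + 3 / w)) by (unfold b; field; lra).
      rewrite (Rmult_assoc (G * K6)). apply Rmult_le_compat_l; [apply Rmult_le_pos; lra|].
      rewrite Elb, Hlw. assert (H32 : 0 < 32 / c) by (apply Rdiv_lt_0_compat; lra).
      assert (H3w : 3 / w <= 3).
      { apply (Rmult_le_reg_r w); [lra|]. replace (3 / w * w) with 3 by (field; lra). lra. }
      pose proof (Rle_abs (euler_gamma - ln (c / 32))) as Hab.
      pose proof (Rabs_pos (euler_gamma - ln (c / 32))) as Hab0.
      assert (HV : 0 <= V) by (unfold V; nra).
      assert ((euler_gamma - ln (c / 32)) * (32 / c) <= Rabs (euler_gamma - ln (c / 32)) * (32 / c))
        by (apply Rmult_le_compat_r; lra).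
      assert (V <= V * ln (INR n)) by nra. unfold V in *. nra. }
  pose proof (Rle_abs K0). assert (K0 <= Rabs K0 * ln (INR n)) by (pose proof (Rabs_pos K0); nra).
  apply Rabs_le_between in H1, HN0. apply Rabs_le. lra.
Qed.
End Average.

Theorem theorem2 (m i : nat) (Hm : (1 <= m)%nat) (Hi1 : (1 <= i)%nat)
  (Him : (i <= m)%nat) (enum : nat -> list (list nat))
  (Henum : forall n, NoDup (enum n) /\
                     (forall l, In l (enum n) <-> is_partition n l)) :
  exists K : R, exists N : nat, forall n : nat, (N <= n)%nat ->
    Cmod (Cminus
            (RtoC (avgX m i (enum n) - INR n / INR m
                   - (INR (m + 1) - 2 * INR i) / (2 * Cpart * INR m)
                     * sqrt (INR n) * ln (INR n)))
            (Cmult (c_const m i) (RtoC (sqrt (INR n)))))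
    <= K * ln (INR n).
Proof.
  destruct (dev_series m Hm i (conj Hi1 Him)) as [L [HL Ec]].
  destruct (avgX_asymp m i Hm (conj Hi1 Him) enum Henum L HL) as [K [N0 H]].
  exists K, (S N0). intros n Hn. specialize (H n ltac:(lia)).
  pose proof Cpart_half_ge1 as Hc. pose proof (sqrt_INR_ge1 n ltac:(lia)) as Hw.
  pose proof (sqrt_INR_sq n) as Hw2. set (w := sqrt (INR n)) in *.
  pose proof (m_pos m Hm) as Hmp.
  (* With [a = (C/2)/sqrt n] one has [1/a = 2 sqrt n / C] and [- ln a = ln (2/C) + (ln n)/2], so the
     two expressions are equal and the bound carries over unchanged. *)
  rewrite Ec, <- RtoC_mult, <- RtoC_minus, Cmod_R. eapply Rle_trans; [right|exact H]. f_equal.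
  assert (E1 : ln (2 / Cpart) = - ln (Cpart / 2)).
  { rewrite <- ln_Rinv by lra. f_equal. field. lra. }
  assert (E2 : ln (Cpart / 2 / w) = ln (Cpart / 2) - ln (INR n) / 2).
  { unfold Rdiv at 1. rewrite ln_mult, ln_Rinv by (try apply Rinv_0_lt_compat; lra).
    rewrite <- Hw2, ln_mult by lra. field. }
  rewrite E1, E2. unfold mean. field. lra.
Qed.
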